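(* Let $n\geq 3$ and let $a_n=\tfrac{2^{n-1}}{2^n-1}\pi$, $b_n=\tfrac{2^n}{2^n-1}\pi$, $c_n=\tfrac{2^{n-1}(2^n-2)}{2^n-1}\pi$, $d_n=\tfrac{2^{2n-1}}{2^n-1}\pi$, $e_n=\tfrac{2^n-2}{2^n-1}\pi$. Define $\psi_n\in L^2(\mathbb{R})$ by \[\hat\psi_n(\xi)=\begin{cases}1 & \text{if } \xi\in[-b_n,-a_n]\cup[c_n,\tfrac{a_n}{2}+2^{n-1}\pi]\cup[\tfrac{e_n}{2}+2^{n-1}\pi,d_n],\\ \tfrac{1}{\sqrt2} & \text{if } \xi\in[\tfrac{a_n}{2},\tfrac{e_n}{2}]\cup[a_n,e_n]\cup[\tfrac{a_n}{2}+2^{n-1}\pi,\tfrac{e_n}{2}+2^{n-1}\pi],\\ -\tfrac{1}{\sqrt2} & \text{if } \xi\in[a_n+2^n\pi,e_n+2^n\pi],\\ 0 & \text{otherwise.}\end{cases}\] Then $\psi_n$ is an orthonormal wavelet of $L^2(\mathbb{R})$ and belongs to the class $\mathcal{M}_{n-2}$.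
   Context: Fourier transform: $\hat f(\xi)=\int_{\mathbb{R}}f(x)e^{-i\xi x}\,dx$. A function $\psi\in L^2(\mathbb{R})$ is an (orthonormal) wavelet if $\{\psi_{j,k}(x)=2^{j/2}\psi(2^jx-k): j,k\in\mathbb{Z}\}$ is an orthonormal basis of $L^2(\mathbb{R})$. For a wavelet $\psi$ let $V_0=\overline{\operatorname{span}}\{\psi_{l,k}: l<0,\ k\in\mathbb{Z}\}$. For $k\geq 0$ let $\mathcal{L}_k$ be the set of wavelets $\psi$ whose space $V_0$ is invariant under all translations $f\mapsto f(\cdot-\tfrac{m}{2^k})$, $m\in\mathbb{Z}$, and let $\mathcal{M}_k=\mathcal{L}_k\setminus\mathcal{L}_{k+1}$ (Weber's equivalence classes). *)

(* Defs.v *)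
From HB Require Import structures.
From mathcomp Require Import all_boot all_order all_algebra.
From mathcomp Require Import all_classical all_reals all_analysis.
From mathcomp Require Import complex.
Set Implicit Arguments. Unset Strict Implicit. Unset Printing Implicit Defensive.
Import Order.TTheory GRing.Theory Num.Theory ComplexField.
Local Open Scope ring_scope.
Local Open Scope complex_scope.

(* MathComp + MathComp-Analysis; R : realType, complex numbers R[i]
   (mathcomp-real-closed), Lebesgue measure/integral from mathcomp-analysis. *)

Section Wavelets.
Variable R : realType.

Definition cfun := R -> R[i].

Local Notation mu := (@lebesgue_measure R).

(* |z|^2 *)
Definition cnorm2 (z : R[i]) : R := complex.Re z ^+ 2 + complex.Im z ^+ 2.

(* f belongs to L^2(R) (complex valued) *)
Definition L2 (f : cfun) : Prop :=
  measurable_fun setT (fun x => complex.Re (f x)) /\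
  measurable_fun setT (fun x => complex.Im (f x)) /\
  (\int[mu]_x (cnorm2 (f x))%:E < +oo)%E.

(* L^2 norm and inner product <f, g> = \int f conj(g) *)
Definition norm2 (f : cfun) : R :=
  Num.sqrt (Rintegral mu setT (fun x => cnorm2 (f x))).

Definition inner (f g : cfun) : R[i] :=
  (Rintegral mu setT (fun x => complex.Re (f x * (g x)^*)))
    +i* (Rintegral mu setT (fun x => complex.Im (f x * (g x)^*))).

Definition csub (f g : cfun) : cfun := fun x => f x - g x.

(* psi_{j,k}(x) = 2^{j/2} psi(2^j x - k) *)
Definition dil_trans (psi : cfun) (j k : int) : cfun :=
  fun x => (Num.sqrt ((2 : R) ^ j))%:C * psi ((2 : R) ^ j * x - k%:~R).

(* finite linear combination \sum c * psi_{j,k} *)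
Definition lincomb (psi : cfun) (s : seq (int * int * R[i])) : cfun :=
  fun x => \sum_(t <- s) t.2 * dil_trans psi t.1.1 t.1.2 x.

(* f lies in the closed (in L^2) linear span of {psi_{j,k} : S j k} *)
Definition in_closed_span (S : int -> int -> Prop) (psi : cfun) (f : cfun) : Prop :=
  L2 f /\
  forall eps : R, 0 < eps ->
    exists s : seq (int * int * R[i]),
      (forall t, t \in s -> S t.1.1 t.1.2) /\
      norm2 (csub f (lincomb psi s)) < eps.

(* psi is an orthonormal wavelet: {psi_{j,k}} is an orthonormal basis of L^2 *)
Definition is_wavelet (psi : cfun) : Prop :=
  (forall j k, L2 (dil_trans psi j k)) /\
  (forall j k j' k',
      inner (dil_trans psi j k) (dil_trans psi j' k')
      = if (j == j') && (k == k') then 1 else 0) /\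
  (forall f, L2 f -> in_closed_span (fun _ _ => True) psi f).

(* V_0 = closed span of {psi_{l,k} : l < 0} *)
Definition V0 (psi : cfun) (f : cfun) : Prop :=
  in_closed_span (fun l _ => l < 0) psi f.

(* translation f |-> f(. - t) *)
Definition transl (t : R) (f : cfun) : cfun := fun x => f (x - t).

(* Weber's classes L_k and M_k = L_k \ L_{k+1} *)
Definition in_Lk (k : nat) (psi : cfun) : Prop :=
  is_wavelet psi /\
  forall (m : int) (f : cfun), V0 psi f -> V0 psi (transl (m%:~R / 2 ^+ k) f).

Definition in_Mk (k : nat) (psi : cfun) : Prop :=
  in_Lk k psi /\ ~ in_Lk k.+1 psi.

(* The constants of the theorem *)
Definition a_n (n : nat) : R := (2 ^+ n.-1) / (2 ^+ n - 1) * pi.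
Definition b_n (n : nat) : R := (2 ^+ n) / (2 ^+ n - 1) * pi.
Definition c_n (n : nat) : R := (2 ^+ n.-1 * (2 ^+ n - 2)) / (2 ^+ n - 1) * pi.
Definition d_n (n : nat) : R := (2 ^+ (2 * n).-1) / (2 ^+ n - 1) * pi.
Definition e_n (n : nat) : R := (2 ^+ n - 2) / (2 ^+ n - 1) * pi.

(* \hat psi_n (real valued); endpoints (a null set) resolved by the order
   of the cases *)
Definition psihat (n : nat) (xi : R) : R :=
  let a := a_n n in let b := b_n n in let c := c_n n in
  let d := d_n n in let e := e_n n in
  let P := 2 ^+ n.-1 * pi in
  if (xi \in `[- b, - a]) || (xi \in `[c, a / 2 + P]) || (xi \in `[e / 2 + P, d])
  then 1
  else if (xi \in `[a / 2, e / 2]) || (xi \in `[a, e]) || (xi \in `[a / 2 + P, e / 2 + P])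
  then 1 / Num.sqrt 2
  else if xi \in `[a + 2 ^+ n * pi, e + 2 ^+ n * pi]
  then - (1 / Num.sqrt 2)
  else 0.

(* psi_n = inverse Fourier transform of psihat (psihat is in L^1 /\ L^2):
   psi_n(x) = 1/(2 pi) \int psihat(xi) e^{i xi x} d xi *)
Definition psi_n (n : nat) : cfun := fun x =>
  ((Rintegral mu setT (fun xi => psihat n xi * cos (xi * x)) / (2 * pi))
    +i* (Rintegral mu setT (fun xi => psihat n xi * sin (xi * x)) / (2 * pi))).

End Wavelets.

(* Main.v *)
(* Write w for the Fourier transform of psi_n, P = 2^(n-1) pi and B = [a/2, e/2).
   Shifting pieces of the support of w by multiples of 2 pi tiles an interval of
   length 2 pi with weights |w|^2 adding up to 1, while w(2^q y) w(y) vanishes for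
   q >= 2 and equals (1_B - 1_(B + P)) / 2 for q = 1; this gives orthonormality.
   By density of trigonometric polynomials, the closed span of the level 0 wavelets
   corresponds to the functions f supported on supp w with f(y + P) = f(y) on B and
   f(y + 2 P) = - f(y) on 2 B.  Hence every function on B u (B + P) splits into a
   symmetric part (level 0) and an antisymmetric part (level -1), and dilating yields
   completeness.  On the Fourier side V_0 is everything supported in the dilates
   2^l supp w with l < -1 and in the part of supp w / 2 outside B u (B + P), plus the
   antisymmetric functions on B u (B + P); translation by t multiplies by exp(- i t y),
   which preserves antisymmetry when exp(i t P) = 1, and for t = 2^-(n-1) exchanges
   the symmetric and antisymmetric functions.

   Plancherel's theorem is derived from Parseval's identity on an interval by
   sampling the inverse Fourier transform on a grid and averaging over its offsets. *)
Require Import Defs.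
From HB Require Import structures.
From mathcomp Require Import all_boot all_order all_algebra.
From mathcomp Require Import all_classical all_reals all_analysis.
From mathcomp Require Import complex.
From mathcomp Require Import measurable_realfun zify ring lra.
Set Implicit Arguments. Unset Strict Implicit. Unset Printing Implicit Defensive.
Import Order.TTheory GRing.Theory Num.Theory ComplexField.
Import numFieldNormedType.Exports.
Local Open Scope classical_set_scope.
Local Open Scope ring_scope.
Local Open Scope complex_scope.


(** The constants come from the relation [(2^n - 1) a = P]. With [e = 2 pi - 2 a] it gives P - a =
    2^(n-1) e and P + a = 2^(n-1) 2 a. Thus the block [P - a, P + a) is a dilate of [e, 2 a),
    exactly what [a, e) leaves out of [a, 2 a), a fundamental interval for dilation by 2 on the
    positive half line; the block [- 2 a, - a) serves the negative one. The price is an overlap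
    modulo 2 pi: B and B + P lie over the same cell, and so do 2 B and 2 B + 2 P, so multiples of w
    by 2 pi-periodic functions are constrained there. The negative sign of w on 2 B + 2 P is what
    makes the two constraints complementary.

    On the analytic side the obstacle is to let the Fourier transform act on L^2. All frequency-side
    work is done with bounded functions of bounded support, for which the integrals converge and
    Fubini's theorem applies; their inverse transforms are dense in L^2, and Plancherel's theorem
    transfers approximations and inner products to the wavelets. *)

Section ComplexIntegrals.
Variable R : realType.
Local Notation mu := (@lebesgue_measure R).
Local Notation cRe := (@complex.Re R).
Local Notation cIm := (@complex.Im R).

(** * Complex-valued functions: modulus, measurability, squared norm, affine substitutions *)

Definition cj (z : R[i]) : R[i] := cRe z +i* - cIm z.
Arguments cj : simpl never.

Lemma cnorm2_ge0 (z : R[i]) : 0 <= cnorm2 z.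
Proof. by rewrite /cnorm2 addr_ge0 // sqr_ge0. Qed.

Lemma cnorm2M (z w : R[i]) : cnorm2 (z * w) = cnorm2 z * cnorm2 w.
Proof. case: z => a b; case: w => c d; rewrite /cnorm2 /=; ring. Qed.

Lemma cnorm2J (z : R[i]) : cnorm2 (cj z) = cnorm2 z.
Proof. case: z => a b; rewrite /cnorm2 /=; ring. Qed.

Lemma cnorm2_real (r : R) : cnorm2 r%:C = r ^+ 2.
Proof. rewrite /cnorm2 /=; ring. Qed.

Lemma cnorm2_0 : cnorm2 (0 : R[i]) = 0.
Proof. rewrite /cnorm2 /=; ring. Qed.

Lemma cnorm2D_le (z w : R[i]) : cnorm2 (z + w) <= 2 * cnorm2 z + 2 * cnorm2 w.
Proof.
case: z => a b; case: w => c d; rewrite /cnorm2 /=.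
have := sqr_ge0 (a - c); have := sqr_ge0 (b - d); nra.
Qed.

Lemma mulJ_cnorm2 (z : R[i]) : z * cj z = (cnorm2 z)%:C.
Proof. by case: z => a b; apply/eqP; rewrite eq_complex /cnorm2 /=; apply/andP; split; apply/eqP; ring. Qed.

Lemma sqr_Re_le (z : R[i]) : cRe z ^+ 2 <= cnorm2 z.
Proof. by rewrite /cnorm2 lerDl sqr_ge0. Qed.

Lemma sqr_Im_le (z : R[i]) : cIm z ^+ 2 <= cnorm2 z.
Proof. by rewrite /cnorm2 lerDr sqr_ge0. Qed.

Definition cm (f : R -> R[i]) : Prop :=
  measurable_fun setT (fun x => cRe (f x)) /\
  measurable_fun setT (fun x => cIm (f x)).

Lemma cmD f g : cm f -> cm g -> cm (fun x => f x + g x).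
Proof.
move=> [f1 f2] [g1 g2]; split.
- rewrite (_ : (fun x => _) = (fun x => cRe (f x) + cRe (g x))).
    exact: measurable_funD.
  by apply/funext => x; case: (f x) (g x) => a b [c d].
- rewrite (_ : (fun x => _) = (fun x => cIm (f x) + cIm (g x))).
    exact: measurable_funD.
  by apply/funext => x; case: (f x) (g x) => a b [c d].
Qed.

Lemma cmM f g : cm f -> cm g -> cm (fun x => f x * g x).
Proof.
move=> [f1 f2] [g1 g2]; split.
- rewrite (_ : (fun x => _) =
    (fun x => cRe (f x) * cRe (g x) - cIm (f x) * cIm (g x))).
    by apply: measurable_funB; exact: measurable_funM.
  by apply/funext => x; case: (f x) (g x) => a b [c d].
- rewrite (_ : (fun x => _) =
    (fun x => cRe (f x) * cIm (g x) + cIm (f x) * cRe (g x))).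
    by apply: measurable_funD; exact: measurable_funM.
  by apply/funext => x; case: (f x) (g x) => a b [c d].
Qed.

Lemma cm_cst (z : R[i]) : cm (fun=> z).
Proof. by split; exact: measurable_cst. Qed.

Lemma cmN f : cm f -> cm (fun x => - f x).
Proof.
move=> mf; rewrite (_ : (fun x => _) = (fun x => (-1) * f x)).
  exact: cmM (cm_cst _) mf.
by apply/funext => x; rewrite mulN1r.
Qed.

Lemma cmB f g : cm f -> cm g -> cm (fun x => f x - g x).
Proof. by move=> mf mg; apply: cmD => //; exact: cmN. Qed.

Lemma cmJ f : cm f -> cm (fun x => cj (f x)).
Proof.
move=> [f1 f2]; split.
- by rewrite (_ : (fun x => _) = (fun x => cRe (f x))) //; apply/funext => x; case: (f x).
- rewrite (_ : (fun x => _) = (fun x => - cIm (f x))); first exact: measurable_funN.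
  by apply/funext => x; case: (f x).
Qed.

Lemma cm_real (r : R -> R) : measurable_fun setT r -> cm (fun x => (r x)%:C).
Proof. by move=> mr; split => //; exact: measurable_cst. Qed.

Lemma cm_sum (I : Type) (s : seq I) (F : I -> R -> R[i]) :
  (forall i, cm (F i)) -> cm (fun x => \sum_(i <- s) F i x).
Proof.
move=> mF; elim: s => [|i s IH].
  by under eq_fun do rewrite big_nil; exact: cm_cst.
by under eq_fun do rewrite big_cons; exact: cmD.
Qed.

Lemma measurable_affine (a b : R) : measurable_fun setT (fun x : R => a * x + b).
Proof.
by apply: measurable_funD; [exact: measurable_funM|exact: measurable_cst].
Qed.

Lemma cm_comp f (h : R -> R) : cm f -> measurable_fun setT h -> cm (fun x => f (h x)).
Proof.
move=> [f1 f2] mh; split.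
  exact: (measurableT_comp f1 mh).
exact: (measurableT_comp f2 mh).
Qed.

Lemma measurable_cnorm2 f : cm f -> measurable_fun setT (fun x => cnorm2 (f x)).
Proof. by move=> [f1 f2]; apply: measurable_funD; exact: measurable_funX. Qed.

Definition expi (t : R) : R[i] := cos t +i* sin t.

Lemma expi0 : expi 0 = 1.
Proof. by rewrite /expi cos0 sin0. Qed.

Lemma expiD s t : expi (s + t) = expi s * expi t.
Proof.
by rewrite /expi cosD sinD; apply/eqP; rewrite eq_complex /=; apply/andP; split; apply/eqP; ring.
Qed.

Lemma expiJ t : cj (expi t) = expi (- t).
Proof. by rewrite /expi cosN sinN /cj. Qed.

Lemma cnorm2_expi t : cnorm2 (expi t) = 1.
Proof. by rewrite /cnorm2 /= cos2Dsin2. Qed.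

Lemma expi_2piz (k : int) : expi (2 * pi * k%:~R) = 1.
Proof.
have H (n : nat) : expi (2 * pi * n%:R) = 1.
  elim: n => [|n IH]; first by rewrite mulr0 expi0.
  have -> : 2 * pi * n.+1%:R = 2 * pi * n%:R + pi *+ 2 :> R.
    by rewrite -natr1 -mulr_natl; ring.
  by rewrite expiD IH mul1r /expi cos2pi sin2pi.
case: k => n; first exact: H.
rewrite NegzE mulrNz mulrN -expiJ.
by rewrite (H n.+1) /cj /= oppr0.
Qed.

Lemma expi_period (t : R) (k : int) : expi (t + 2 * pi * k%:~R) = expi t.
Proof. by rewrite expiD expi_2piz mulr1. Qed.

Lemma measurable_cos : measurable_fun setT (@cos R).
Proof. by apply: continuous_measurable_fun; exact: continuous_cos. Qed.

Lemma measurable_sin : measurable_fun setT (@sin R).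
Proof. by apply: continuous_measurable_fun; exact: continuous_sin. Qed.

Lemma cm_expi : cm expi.
Proof. by split; [exact: measurable_cos|exact: measurable_sin]. Qed.

Lemma cm_expiM (a : R) : cm (fun x => expi (x * a)).
Proof. by apply: (cm_comp cm_expi); exact: measurable_funM. Qed.

(** Values in the extended reals let comparisons and limits be stated before integrability is
    known. *)
Definition sqn (f : R -> R[i]) : \bar R := (\int[mu]_x (cnorm2 (f x))%:E)%E.

Lemma sqn_ge0 f : (0 <= sqn f)%E.
Proof. by apply: integral_ge0 => x _; rewrite lee_fin cnorm2_ge0. Qed.

Lemma sqn_le f g (k : R) : 0 <= k -> cm f -> cm g ->
  (forall x, cnorm2 (f x) <= k * cnorm2 (g x)) -> (sqn f <= k%:E * sqn g)%E.
Proof.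
move=> k0 mf mg fg; rewrite /sqn -ge0_integralZl_EFin //=.
- apply: ge0_le_integral => //=.
  + by move=> x _; rewrite lee_fin cnorm2_ge0.
  + by apply/measurable_EFinP; exact: measurable_cnorm2.
  + by apply/measurable_EFinP; apply: measurable_funM => //; exact: measurable_cnorm2.
  + by move=> x _; rewrite -EFinM lee_fin.
- by move=> x _; rewrite lee_fin cnorm2_ge0.
- by apply/measurable_EFinP; exact: measurable_cnorm2.
Qed.

Lemma sqn_le1 f g : cm f -> cm g ->
  (forall x, cnorm2 (f x) <= cnorm2 (g x)) -> (sqn f <= sqn g)%E.
Proof.
move=> mf mg fg; rewrite -[leRHS]mul1e; apply: sqn_le => // x.
by rewrite mul1r.
Qed.

Lemma eq_sqn f g : (forall x, cnorm2 (f x) = cnorm2 (g x)) -> sqn f = sqn g.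
Proof. by move=> fg; rewrite /sqn; apply: eq_integral => x _; rewrite fg. Qed.

Lemma sqn_D f g : cm f -> cm g -> (sqn (fun x => f x + g x)%R <= 2%:E * sqn f + 2%:E * sqn g)%E.
Proof.
move=> mf mg.
have mf2 : measurable_fun setT (EFin \o (fun x => cnorm2 (f x))).
  by apply/measurable_EFinP; exact: measurable_cnorm2.
have mg2 : measurable_fun setT (EFin \o (fun x => cnorm2 (g x))).
  by apply/measurable_EFinP; exact: measurable_cnorm2.
rewrite /sqn -!ge0_integralZl_EFin //=; try by move=> x _; rewrite lee_fin cnorm2_ge0.
rewrite -ge0_integralD //=; last 4 first.
- by move=> x _; rewrite -EFinM lee_fin mulr_ge0 // cnorm2_ge0.
- by apply/measurable_EFinP; apply: measurable_funM => //; exact: measurable_cnorm2.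
- by move=> x _; rewrite -EFinM lee_fin mulr_ge0 // cnorm2_ge0.
- by apply/measurable_EFinP; apply: measurable_funM => //; exact: measurable_cnorm2.
apply: ge0_le_integral => //=.
- by move=> x _; rewrite lee_fin cnorm2_ge0.
- by apply/measurable_EFinP; apply: measurable_cnorm2; exact: cmD.
- by apply/measurable_EFinP; apply: measurable_funD; apply: measurable_funM => //; exact: measurable_cnorm2.
- by move=> x _; rewrite -!EFinM -EFinD lee_fin cnorm2D_le.
Qed.

(** Stands in for the triangle inequality: by [cnorm2D_le], two errors below [e / 4] add up to one
    below [e]. The factors 4 in later tolerances come from here. *)
Lemma sqn_lt_D f g (e : R) : cm f -> cm g ->
  (sqn f < (e / 4)%:E)%E -> (sqn g < (e / 4)%:E)%E -> (sqn (fun x => f x + g x)%R < e%:E)%E.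
Proof.
move=> mf mg fe ge; apply: le_lt_trans (sqn_D mf mg) _.
have -> : (e%:E = 2%:E * (e / 4)%:E + 2%:E * (e/4)%:E)%E.
  by rewrite -!EFinM -EFinD; congr EFin; lra.
by apply: lteD; rewrite lte_pmul2l.
Qed.

Lemma sqn_Z (z : R[i]) f : cm f -> sqn (fun x => z * f x) = ((cnorm2 z)%:E * sqn f)%E.
Proof.
move=> mf; rewrite /sqn -ge0_integralZl_EFin //=.
- by apply: eq_integral => x _; rewrite cnorm2M EFinM.
- by move=> x _; rewrite lee_fin cnorm2_ge0.
- by apply/measurable_EFinP; exact: measurable_cnorm2.
- exact: cnorm2_ge0.
Qed.

(** Uniqueness of Lebesgue measure: [a] times the image measure gives every interval []u, v]] its
    length. *)
Lemma lebesgue_measure_affine (a b : R) : 0 < a ->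
  forall A, measurable A ->
  pushforward mu ((fun x : R => a * x + b) : measurableTypeR R -> measurableTypeR R) A
  = (a^-1%:E * mu A)%E.
Proof.
move=> a0 A mA.
have ma : measurable_fun setT ((fun x : R => a * x + b) : measurableTypeR R -> measurableTypeR R).
  exact: measurable_affine.
have a0' : 0 <= a by exact: ltW.
have E : mu A = mscale (NngNum a0') (measure_function_pushforward__canonical__measure_function_Measure mu ma) A.
  apply: (@lebesgue_measure_unique R (mscale (NngNum a0') (measure_function_pushforward__canonical__measure_function_Measure mu ma))) => //= _ [[u v]] _ <-.
  rewrite /mscale /= /pushforward.
  have -> : (fun x : R => a * x + b) @^-1` `]u, v] = `](u - b) / a, (v - b) / a]%classic.
    apply/seteqP; split => x /=; rewrite !in_itv /= => /andP[h1 h2].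
      by rewrite ltr_pdivrMr // ler_pdivlMr // mulrC ltrBlDr h1 /= lerBrDr h2.
    move: h1 h2; rewrite ltr_pdivrMr // ler_pdivlMr // mulrC => h1 h2.
    by rewrite -ltrBlDr h1 -lerBrDr h2.
  rewrite !lebesgue_measure_itv /= !lte_fin.
  rewrite ltr_pM2r ?invr_gt0 // ltrD2r; case: ifPn => _; last by rewrite mule0.
  by rewrite -EFinB -EFinM; congr EFin; field; rewrite gt_eqF.
rewrite E /mscale /= muleA -EFinM mulVf ?gt_eqF //.
by rewrite mul1e.
Qed.

Lemma ge0_int_affine (a b : R) (f : R -> \bar R) : 0 < a ->
  measurable_fun setT f -> (forall x, (0 <= f x)%E) ->
  (\int[mu]_x f (a * x + b)%R = a^-1%:E * \int[mu]_x f x)%E.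
Proof.
move=> a0 mf f0.
have ma : measurable_fun setT ((fun x : R => a * x + b) : measurableTypeR R -> measurableTypeR R).
  exact: measurable_affine.
have := @ge0_integral_pushforward _ _ (measurableTypeR R) (measurableTypeR R) R _ ma mu setT f
  measurableT mf (fun y _ => f0 y).
rewrite preimage_setT /= => <-.
have a0' : 0 <= a^-1 by rewrite invr_ge0 ltW.
transitivity (\int[mscale (NngNum a0') mu]_x f x)%E.
  apply: eq_measure_integral => A mA _.
  exact: (lebesgue_measure_affine b a0 mA).
by rewrite ge0_integral_mscale.
Qed.

Lemma sqn_affine (a b : R) f : 0 < a -> cm f ->
  sqn (fun x => f (a * x + b)) = (a^-1%:E * sqn f)%E.
Proof.
move=> a0 mf; rewrite /sqn.
rewrite -(@ge0_int_affine a b (fun x => (cnorm2 (f x))%:E)) //.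
- by apply/measurable_EFinP; exact: measurable_cnorm2.
- by move=> x; rewrite lee_fin cnorm2_ge0.
Qed.

Lemma Rint_affine (a b : R) (f : R -> R) : 0 < a -> measurable_fun setT f ->
  mu.-integrable setT (EFin \o f) ->
  Rintegral mu setT (fun x => f (a * x + b)) = a^-1 * Rintegral mu setT f.
Proof.
move=> a0 mf intf.
have mEf : measurable_fun setT (EFin \o f) by exact/measurable_EFinP.
rewrite /Rintegral.
have E1 : (\int[mu]_x (f (a * x + b))%:E =
   a^-1%:E * \int[mu]_x ((EFin \o f)^\+ x) - a^-1%:E * \int[mu]_x ((EFin \o f)^\- x))%E.
  rewrite integralE -!(@ge0_int_affine a b) //.
  - by congr (_ - _)%E; apply: eq_integral => x _; rewrite ?funeposE ?funenegE.
  - by apply: measurable_funeneg.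
  - by apply: measurable_funepos.
have p1 := integral_funepos_lt_pinfty measurableT intf.
have p2 := integral_funeneg_lt_pinfty measurableT intf.
have E2 : (\int[mu]_x (f x)%:E = \int[mu]_x ((EFin \o f)^\+ x) - \int[mu]_x ((EFin \o f)^\- x))%E.
  by rewrite integralE.
rewrite E1 E2.
have F1 : (\int[mu]_x ((EFin \o f)^\+ x))%E \is a fin_num.
  by rewrite ge0_fin_numE // integral_ge0.
have F2 : (\int[mu]_x ((EFin \o f)^\- x))%E \is a fin_num.
  by rewrite ge0_fin_numE // integral_ge0.
by rewrite -(fineK F1) -(fineK F2) /=; ring.
Qed.

End ComplexIntegrals.

#[global] Arguments cj {R} z : simpl never.
#[global] Arguments inner {R} f g : simpl never.
#[global] Arguments cnorm2 {R} z : simpl never.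

(** * Integrals, inner products and the class of bounded functions of bounded support *)

Section L2Theory.
Variable R : realType.
Local Notation mu := (@lebesgue_measure R).
Local Notation cRe := (@complex.Re R).
Local Notation cIm := (@complex.Im R).
Implicit Types (f g h : R -> R[i]).

Lemma cReD (z w : R[i]) : cRe (z + w) = cRe z + cRe w.
Proof. by case: z w => a b [c d]. Qed.

Lemma cImD (z w : R[i]) : cIm (z + w) = cIm z + cIm w.
Proof. by case: z w => a b [c d]. Qed.

Lemma cReM (z w : R[i]) : cRe (z * w) = cRe z * cRe w - cIm z * cIm w.
Proof. by case: z w => a b [c d]. Qed.

Lemma cImM (z w : R[i]) : cIm (z * w) = cRe z * cIm w + cIm z * cRe w.
Proof. by case: z w => a b [c d]. Qed.

Lemma cReJ (z : R[i]) : cRe (cj z) = cRe z.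
Proof. by case: z. Qed.

Lemma cImJ (z : R[i]) : cIm (cj z) = - cIm z.
Proof. by case: z. Qed.

Lemma cReN (z : R[i]) : cRe (- z) = - cRe z.
Proof. by case: z. Qed.

Lemma cjD (z w : R[i]) : cj (z + w) = cj z + cj w.
Proof. by case: z w => a b [c d]; rewrite /cj /= opprD. Qed.

Lemma cjM (z w : R[i]) : cj (z * w) = cj z * cj w.
Proof.
by case: z w => a b [c d]; apply/eqP; rewrite eq_complex /cj /=; apply/andP; split; apply/eqP; ring.
Qed.

Lemma cjK (z : R[i]) : cj (cj z) = z.
Proof. by case: z => a b; rewrite /cj /= opprK. Qed.

Lemma cj_real (r : R) : cj r%:C = r%:C.
Proof. by rewrite /cj /= oppr0. Qed.

Lemma cjN (z : R[i]) : cj (- z) = - cj z.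
Proof. by case: z. Qed.

Lemma cj1 : cj (1 : R[i]) = 1.
Proof. by rewrite /cj /= oppr0. Qed.

Lemma cj0 : cj (0 : R[i]) = 0.
Proof. by rewrite /cj /= oppr0. Qed.

Lemma Re_real (r : R) : cRe r%:C = r. Proof. by []. Qed.

Lemma Im_real (r : R) : cIm r%:C = 0. Proof. by []. Qed.

Lemma complex_ext (z w : R[i]) : cRe z = cRe w -> cIm z = cIm w -> z = w.
Proof. by case: z w => a b [c d] /= -> ->. Qed.

Definition Cint f : Prop :=
  mu.-integrable setT (EFin \o (fun x => cRe (f x))) /\
  mu.-integrable setT (EFin \o (fun x => cIm (f x))).

Definition ci f : R[i] :=
  Rintegral mu setT (fun x => cRe (f x)) +i* Rintegral mu setT (fun x => cIm (f x)).

Lemma eq_ci f g : (forall x, f x = g x) -> ci f = ci g.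
Proof. by move=> fg; congr ci; apply/funext. Qed.

Lemma Cint_cm f : Cint f -> cm f.
Proof.
by move=> [/integrableP[/measurable_EFinP m1 _] /integrableP[/measurable_EFinP m2 _]].
Qed.

Lemma CintD f g : Cint f -> Cint g -> Cint (fun x => f x + g x).
Proof.
move=> [f1 f2] [g1 g2]; split.
- rewrite (_ : _ \o _ = (EFin \o (fun x => cRe (f x))) \+ (EFin \o (fun x => cRe (g x)))).
    exact: integrableD.
  by apply/funext => x /=; rewrite cReD.
- rewrite (_ : _ \o _ = (EFin \o (fun x => cIm (f x))) \+ (EFin \o (fun x => cIm (g x)))).
    exact: integrableD.
  by apply/funext => x /=; rewrite cImD.
Qed.

Lemma integrable_lin (u v : R -> R) (a b : R) :
  mu.-integrable setT (EFin \o u) -> mu.-integrable setT (EFin \o v) ->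
  mu.-integrable setT (EFin \o (fun x => a * u x + b * v x)).
Proof.
move=> iu iv; rewrite (_ : _ \o _ =
   (fun x => a%:E * (EFin \o u) x)%E \+ (fun x => b%:E * (EFin \o v) x)%E).
  by apply: integrableD => //; exact: integrableZl.
by apply/funext => x /=.
Qed.

Lemma Rint_lin (u v : R -> R) (a b : R) :
  mu.-integrable setT (EFin \o u) -> mu.-integrable setT (EFin \o v) ->
  Rintegral mu setT (fun x => a * u x + b * v x) =
  a * Rintegral mu setT u + b * Rintegral mu setT v.
Proof.
move=> iu iv.
have H (c : R) w : mu.-integrable setT (EFin \o w) -> mu.-integrable setT (EFin \o (fun x => c * w x)).
  by move=> iw; have := integrableZl measurableT c iw.
by rewrite RintegralD ?RintegralZl //; exact: H.
Qed.

Lemma CintZ (z : R[i]) f : Cint f -> Cint (fun x => z * f x).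
Proof.
move=> [f1 f2]; split.
- rewrite (_ : _ \o _ = EFin \o (fun x => cRe z * cRe (f x) + (- cIm z) * cIm (f x))).
    exact: integrable_lin.
  by apply/funext => x /=; rewrite cReM mulNr.
- rewrite (_ : _ \o _ = EFin \o (fun x => cRe z * cIm (f x) + cIm z * cRe (f x))).
    exact: integrable_lin.
  by apply/funext => x /=; rewrite cImM.
Qed.

Lemma Cint0 : Cint (fun=> 0).
Proof. by split; exact: integrable0. Qed.

Lemma ciD f g : Cint f -> Cint g -> ci (fun x => f x + g x) = ci f + ci g.
Proof.
move=> [f1 f2] [g1 g2]; apply: complex_ext; rewrite ?cReD ?cImD /=.
- by under eq_Rintegral do rewrite cReD; exact: RintegralD.
- by under eq_Rintegral do rewrite cImD; exact: RintegralD.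
Qed.

Lemma ciZ (z : R[i]) f : Cint f -> ci (fun x => z * f x) = z * ci f.
Proof.
move=> [f1 f2]; apply: complex_ext; rewrite ?cReM ?cImM /=.
- under eq_Rintegral do rewrite cReM -mulNr.
  by rewrite Rint_lin // mulNr.
- under eq_Rintegral do rewrite cImM.
  by rewrite Rint_lin.
Qed.

Lemma ci0 : ci (fun=> 0) = 0.
Proof.
rewrite -[RHS](mul0r (ci (fun=> 0))) -(ciZ 0 Cint0).
by apply: eq_ci => x; rewrite mul0r.
Qed.

Lemma ciJ f : Cint f -> ci (fun x => cj (f x)) = cj (ci f).
Proof.
move=> [f1 f2]; apply: complex_ext; rewrite ?cReJ ?cImJ /=.
- by [].
- under eq_Rintegral do rewrite -mulN1r.
  by rewrite RintegralZl // mulN1r.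
Qed.

Lemma Cint_sum (I : Type) (s : seq I) (F : I -> R -> R[i]) :
  (forall i, Cint (F i)) -> Cint (fun x => \sum_(i <- s) F i x).
Proof.
move=> mF; elim: s => [|i s IH].
  by under eq_fun do rewrite big_nil; exact: Cint0.
by under eq_fun do rewrite big_cons; exact: CintD.
Qed.

Lemma ci_sum (I : Type) (s : seq I) (F : I -> R -> R[i]) :
  (forall i, Cint (F i)) -> ci (fun x => \sum_(i <- s) F i x) = \sum_(i <- s) ci (F i).
Proof.
move=> mF; elim: s => [|i s IH].
  by under eq_ci do rewrite big_nil; rewrite big_nil ci0.
by under eq_ci do rewrite big_cons; rewrite big_cons ciD ?IH //; exact: Cint_sum.
Qed.

Lemma ci_affine (a b : R) f : 0 < a -> Cint f ->
  ci (fun x => f (a * x + b)) = (a^-1)%:C * ci f.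
Proof.
move=> a0 intf; have [m1 m2] := Cint_cm intf; case: intf => f1 f2.
apply: complex_ext; rewrite ?cReM ?cImM /= ?mul0r ?subr0 ?addr0.
  exact: (Rint_affine b a0 m1 f1).
exact: (Rint_affine b a0 m2 f2).
Qed.

Definition bm f : Prop := cm f /\ exists M : R, forall x, cnorm2 (f x) <= M.

(** One constant bounds both the squared modulus and the radius of the support. The class is stable
    under sums, products with [bm] functions and dilations, and lies in L^1 and L^2, which settles
    most integrability obligations. *)
Definition bc f : Prop := cm f /\
  exists M : R, forall x, cnorm2 (f x) <= M /\ (M < `|x| -> f x = 0).

Lemma bc_bm f : bc f -> bm f.
Proof. by move=> [mf [M fM]]; split => //; exists M => x; case: (fM x). Qed.

Lemma bm_cst (z : R[i]) : bm (fun=> z).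
Proof. by split; [exact: cm_cst|exists (cnorm2 z)]. Qed.

Lemma bmD f g : bm f -> bm g -> bm (fun x => f x + g x).
Proof.
move=> [mf [M fM]] [mg [N gN]]; split; first exact: cmD.
exists (2 * M + 2 * N) => x; apply: le_trans (cnorm2D_le _ _) _.
by apply: lerD; rewrite ler_pM2l.
Qed.

Lemma bmM f g : bm f -> bm g -> bm (fun x => f x * g x).
Proof.
move=> [mf [M fM]] [mg [N gN]]; split; first exact: cmM.
by exists (M * N) => x; rewrite cnorm2M ler_pM // cnorm2_ge0.
Qed.

Lemma bmJ f : bm f -> bm (fun x => cj (f x)).
Proof.
by move=> [mf [M fM]]; split; [exact: cmJ|exists M => x; rewrite cnorm2J].
Qed.

Lemma bm_expiM (a : R) : bm (fun x => expi (x * a)).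
Proof. by split; [exact: cm_expiM|exists 1 => x; rewrite cnorm2_expi]. Qed.

Lemma bm_sum (I : Type) (s : seq I) (F : I -> R -> R[i]) :
  (forall i, bm (F i)) -> bm (fun x => \sum_(i <- s) F i x).
Proof.
move=> mF; elim: s => [|i s IH].
  by under eq_fun do rewrite big_nil; exact: bm_cst.
by under eq_fun do rewrite big_cons; exact: bmD.
Qed.

Lemma bm_comp f (h : R -> R) : bm f -> measurable_fun setT h -> bm (fun x => f (h x)).
Proof.
by move=> [mf [M fM]] mh; split; [exact: cm_comp|exists M].
Qed.

Lemma bcM f g : bc f -> bm g -> bc (fun x => f x * g x).
Proof.
move=> [mf [M fM]] [mg [N gN]]; split; first exact: cmM.
have M0 : 0 <= M by apply: le_trans (fM 0).1; exact: cnorm2_ge0.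
have N0 : 0 <= N by apply: le_trans (gN 0); exact: cnorm2_ge0.
(* The constant must dominate the bound [M * N] of the product as well as the support radius [M]. *)
exists (M * N + M) => x; split.
  apply: (@le_trans _ _ (M * N)); last by rewrite lerDl.
  by rewrite cnorm2M ler_pM ?cnorm2_ge0 //; case: (fM x).
move=> hx; have [_ ->] := fM x; first by rewrite mul0r.
by apply: le_lt_trans hx; rewrite lerDr mulr_ge0.
Qed.

Lemma bcMl f g : bm f -> bc g -> bc (fun x => f x * g x).
Proof. by move=> mf mg; under eq_fun do rewrite mulrC; exact: bcM. Qed.

Lemma bcD f g : bc f -> bc g -> bc (fun x => f x + g x).
Proof.
move=> [mf [M fM]] [mg [N gN]]; split; first exact: cmD.
have M0 : 0 <= M by apply: le_trans (fM 0).1; exact: cnorm2_ge0.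
have N0 : 0 <= N by apply: le_trans (gN 0).1; exact: cnorm2_ge0.
exists (2 * M + 2 * N) => x; split.
  apply: le_trans (cnorm2D_le _ _) _.
  by apply: lerD; rewrite ler_pM2l //; [case: (fM x)|case: (gN x)].
move=> hx; rewrite (fM x).2 ?(gN x).2 ?addr0 //; apply: le_lt_trans hx; lra.
Qed.

Lemma bcJ f : bc f -> bc (fun x => cj (f x)).
Proof.
move=> [mf [M fM]]; split; first exact: cmJ.
exists M => x; rewrite cnorm2J; split; first by case: (fM x).
by move=> hx; rewrite (fM x).2 // cj0.
Qed.

Lemma bc0 : bc (fun=> 0).
Proof. by split; [exact: cm_cst|exists 0 => x; rewrite cnorm2_0]. Qed.

Lemma bcZ (z : R[i]) f : bc f -> bc (fun x => z * f x).
Proof. exact/bcMl/bm_cst. Qed.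

Lemma bcB f g : bc f -> bc g -> bc (fun x => f x - g x).
Proof.
move=> bf bg; apply: bcD => //.
by under eq_fun do rewrite -mulN1r; exact: bcZ.
Qed.

Lemma bc_sum (I : Type) (s : seq I) (F : I -> R -> R[i]) :
  (forall i, bc (F i)) -> bc (fun x => \sum_(i <- s) F i x).
Proof.
move=> mF; elim: s => [|i s IH].
  by under eq_fun do rewrite big_nil; exact: bc0.
by under eq_fun do rewrite big_cons; exact: bcD.
Qed.

Lemma bc_affine (a b : R) f : 0 < a -> bc f -> bc (fun x => f (a * x + b)).
Proof.
move=> a0 [mf [M fM]]; split.
  by apply: (cm_comp mf); exact: measurable_affine.
have M0 : 0 <= M by apply: le_trans (fM 0).1; exact: cnorm2_ge0.
(* Beyond [(M + |b|) / a] the argument [a x + b] has modulus above [M]; the summand [M] keeps the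
   bound on the values. *)
exists (M + (M + `|b|) / a) => x; split.
  apply: le_trans (fM _).1 _; rewrite lerDl divr_ge0 //; last exact: ltW.
  by rewrite addr_ge0.
move=> hx; apply: (fM _).2.
have : (M + `|b|) / a < `|x| by apply: le_lt_trans hx; rewrite lerDr.
rewrite ltr_pdivrMr // => h.
have : `|a * x| <= `|a * x + b| + `|b|.
  by rewrite -{1}(addrK b (a * x)); apply: ler_normB.
by rewrite normrM (gtr0_norm a0) mulrC; lra.
Qed.

Definition cI (A : set R) (x : R) : R[i] := (\1_A x)%:C.

Lemma cI_in (A : set R) x : A x -> cI A x = 1.
Proof. by move=> Ax; rewrite /cI indicE mem_set. Qed.

Lemma cI_out (A : set R) x : ~ A x -> cI A x = 0.
Proof. by move=> Ax; rewrite /cI indicE memNset. Qed.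

Lemma cI_bm (A : set R) : measurable A -> bm (cI A).
Proof.
move=> mA; split; first by apply: cm_real; exact: measurable_indic.
exists 1 => x; rewrite cnorm2_real indicE; case: (x \in A); rewrite ?expr1n //.
by rewrite expr0n /= ler01.
Qed.

Lemma bm_cI_bc f (A : set R) (M : R) : bm f -> measurable A -> A `<=` `[- M, M] ->
  bc (fun x => f x * cI A x).
Proof.
move=> [mf [N fN]] mA AM; split; first by apply: cmM => //; case: (cI_bm mA).
have N0 : 0 <= N by apply: le_trans (fN 0); exact: cnorm2_ge0.
exists (N + `|M|) => x; split.
  apply: (@le_trans _ _ N); last by rewrite lerDl.
  rewrite cnorm2M /cI cnorm2_real indicE; case: (x \in A).
    by rewrite expr1n mulr1.
  by rewrite expr0n /= mulr0.
move=> hx; rewrite cI_out ?mulr0 // => /AM /=; rewrite in_itv /= -ler_norml => xM.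
move: hx; apply/negP; rewrite -leNgt.
by apply: le_trans xM _; apply: le_trans (ler_norm M) _; rewrite lerDr.
Qed.

Lemma Rbc_int (f : R -> R) (M : R) : measurable_fun setT f ->
  (forall x, `|f x| <= M /\ (M < `|x| -> f x = 0)) -> mu.-integrable setT (EFin \o f).
Proof.
move=> mf fM.
have M0 : 0 <= M by apply: le_trans (fM 0).1.
have H : mu.-integrable setT (fun x => M%:E * (\1_`[- M, M] x)%:E)%E.
  by apply: integrableZl => //; exact: integrable_indic_itv.
apply: le_integrable H => //.
- exact/measurable_EFinP.
- move=> x _; rewrite -EFinM lee_fin indicE.
  have [xM|xM] := boolP (x \in `[-M, M]%classic).
    by rewrite mulr1 (ger0_norm M0); case: (fM x).
  rewrite mulr0 normr0 (fM x).2 ?normr0 // ltNge; apply: contra xM.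
  by rewrite inE /= in_itv /= -ler_norml.
Qed.

Lemma bc_Cint f : bc f -> Cint f.
Proof.
move=> [[m1 m2] [M fM]].
have M0 : 0 <= M by apply: le_trans (fM 0).1; exact: cnorm2_ge0.
have H (r : R) z : r ^+ 2 <= cnorm2 z -> cnorm2 z <= M -> `|r| <= 1 + M.
  move=> rz zM; have := le_trans rz zM; rewrite -real_normK ?num_real //.
  by have := normr_ge0 r; nra.
split; apply: (@Rbc_int _ (1 + M)) => // x; split.
- by apply: (H _ _ (sqr_Re_le _)); case: (fM x).
- by move=> hx; rewrite (fM x).2 //; lra.
- by apply: (H _ _ (sqr_Im_le _)); case: (fM x).
- by move=> hx; rewrite (fM x).2 //; lra.
Qed.

Lemma L2E f : L2 f <-> cm f /\ (sqn f < +oo)%E.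
Proof. by split => [[? []]|[[? ?] ?]]. Qed.

Lemma L2_cm f : L2 f -> cm f.
Proof. by move/L2E => []. Qed.

Lemma L2_fin f : L2 f -> sqn f = (fine (sqn f))%:E.
Proof. by move/L2E => [_ fo]; rewrite fineK // ge0_fin_numE // sqn_ge0. Qed.

Lemma L2_int f : L2 f -> mu.-integrable setT (EFin \o (fun x => cnorm2 (f x))).
Proof.
move/L2E => [mf fo]; apply/integrableP; split.
  by apply/measurable_EFinP; exact: measurable_cnorm2.
rewrite (_ : (\int[mu]_x _ = sqn f)%E) //; apply: eq_integral => x _ /=.
by rewrite ger0_norm // cnorm2_ge0.
Qed.

Lemma L2D f g : L2 f -> L2 g -> L2 (fun x => f x + g x).
Proof.
move/L2E => [mf fo] /L2E [mg go]; apply/L2E; split; first exact: cmD.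
apply: le_lt_trans (sqn_D mf mg) _.
by apply: lte_add_pinfty; rewrite lte_mul_pinfty // lee_fin.
Qed.

Lemma L2Z (z : R[i]) f : L2 f -> L2 (fun x => z * f x).
Proof.
move/L2E => [mf fo]; apply/L2E; split; first exact: cmM (cm_cst _) mf.
by rewrite sqn_Z // lte_mul_pinfty // lee_fin cnorm2_ge0.
Qed.

Lemma L2B f g : L2 f -> L2 g -> L2 (fun x => f x - g x).
Proof.
move=> bf bg; apply: L2D => //.
by under eq_fun do rewrite -mulN1r; exact: L2Z.
Qed.

Lemma L2_0 : L2 (fun=> 0 : R[i]).
Proof.
apply/L2E; split; first exact: cm_cst.
by rewrite /sqn; under eq_integral do rewrite cnorm2_0; rewrite integral0.
Qed.

Lemma L2_sum (I : Type) (s : seq I) (F : I -> R -> R[i]) :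
  (forall i, L2 (F i)) -> L2 (fun x => \sum_(i <- s) F i x).
Proof.
move=> mF; elim: s => [|i s IH].
  by under eq_fun do rewrite big_nil; exact: L2_0.
by under eq_fun do rewrite big_cons; exact: L2D.
Qed.

Lemma bc_L2 f : bc f -> L2 f.
Proof.
move=> bf; apply/L2E; split; first by case: bf.
have [/integrableP[_ h] _] := bc_Cint (bcM bf (bmJ (bc_bm bf))).
apply: le_lt_trans h; apply: ge0_le_integral => //=.
- by move=> x _; rewrite lee_fin cnorm2_ge0.
- by apply/measurable_EFinP; apply: measurable_cnorm2; case: bf.
- have [/integrableP[/measurable_EFinP mm _] _] := bc_Cint (bcM bf (bmJ (bc_bm bf))).
  by apply/measurable_EFinP; exact: measurableT_comp.
- by move=> x _; rewrite mulJ_cnorm2 /= lee_fin ler_norm.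
Qed.

Lemma L2_Cint f g : L2 f -> L2 g -> Cint (fun x => f x * cj (g x)).
Proof.
move=> Lf Lg; have mf := L2_cm Lf; have mg := L2_cm Lg.
have [m1 m2] := cmM mf (cmJ mg).
have H : mu.-integrable setT (EFin \o (fun x => 1 * cnorm2 (f x) + 1 * cnorm2 (g x))).
  by apply: integrable_lin; exact: L2_int.
split; apply: le_integrable H => //=; try exact/measurable_EFinP.
- move=> x _; rewrite lee_fin !mul1r [leRHS](ger0_norm (addr_ge0 (cnorm2_ge0 _) (cnorm2_ge0 _))).
  case: (f x) (g x) => a b [c d]; rewrite /cnorm2 /= ler_norml.
  have := sqr_ge0 (a - c); have := sqr_ge0 (b - d).
  have := sqr_ge0 (a + c); have := sqr_ge0 (b + d); rewrite !expr2; lra.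
- move=> x _; rewrite lee_fin !mul1r [leRHS](ger0_norm (addr_ge0 (cnorm2_ge0 _) (cnorm2_ge0 _))).
  case: (f x) (g x) => a b [c d]; rewrite /cnorm2 /= ler_norml.
  have := sqr_ge0 (a - d); have := sqr_ge0 (b - c).
  have := sqr_ge0 (a + d); have := sqr_ge0 (b + c); rewrite !expr2; lra.
Qed.

(** Passage from the conjugation in [inner] to the componentwise [cj], whose parts compute. *)
Lemma innerE f g : inner f g = ci (fun x => f x * cj (g x)).
Proof. rewrite -[LHS]/(ci (fun x => f x * (g x)^* )); apply: eq_ci => x.
by congr (_ * _); case: (g x). Qed.

Lemma innerDl f g h : L2 f -> L2 g -> L2 h ->
  inner (fun x => f x + g x) h = inner f h + inner g h.
Proof.
move=> Lf Lg Lh; rewrite !innerE -ciD; try exact: L2_Cint.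
by apply: eq_ci => x; rewrite mulrDl.
Qed.

Lemma innerZl (z : R[i]) f h : L2 f -> L2 h ->
  inner (fun x => z * f x) h = z * inner f h.
Proof.
move=> Lf Lh; rewrite !innerE -ciZ; try exact: L2_Cint.
by apply: eq_ci => x; rewrite mulrA.
Qed.

Lemma innerC f g : L2 f -> L2 g -> inner g f = cj (inner f g).
Proof.
move=> Lf Lg; rewrite !innerE -ciJ; last exact: L2_Cint.
by apply: eq_ci => x; rewrite cjM cjK mulrC.
Qed.

Lemma innerDr f g h : L2 f -> L2 g -> L2 h ->
  inner h (fun x => f x + g x) = inner h f + inner h g.
Proof.
move=> Lf Lg Lh; rewrite (innerC (L2D Lf Lg) Lh) innerDl // cjD.
by rewrite -!innerC.
Qed.

Lemma innerZr (z : R[i]) f h : L2 f -> L2 h ->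
  inner h (fun x => z * f x) = cj z * inner h f.
Proof.
move=> Lf Lh; rewrite (innerC (L2Z z Lf) Lh) innerZl // cjM.
by rewrite -!innerC.
Qed.

Lemma inner_suml (I : Type) (s : seq I) (F : I -> R -> R[i]) h :
  (forall i, L2 (F i)) -> L2 h ->
  inner (fun x => \sum_(i <- s) F i x) h = \sum_(i <- s) inner (F i) h.
Proof.
move=> LF Lh; rewrite innerE; transitivity (\sum_(i <- s) ci (fun x => F i x * cj (h x))).
  rewrite -ci_sum; last by move=> i; exact: L2_Cint.
  by apply: eq_ci => x; rewrite mulr_suml.
by apply: eq_bigr => i _; rewrite innerE.
Qed.

Lemma innerff f : L2 f -> inner f f = (fine (sqn f))%:C.
Proof.
move=> Lf; rewrite innerE; apply: complex_ext => /=.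
  by under eq_Rintegral do rewrite mulJ_cnorm2 /=.
under eq_Rintegral do rewrite mulJ_cnorm2 /=.
by rewrite Rintegral_cst //= mul0r.
Qed.

Lemma fine_sqn_ge0 f : 0 <= fine (sqn f).
Proof. by rewrite fine_ge0 // sqn_ge0. Qed.

Lemma sqnr_D f g : L2 f -> L2 g -> fine (sqn (fun x => f x + g x)) =
  fine (sqn f) + 2 * cRe (inner f g) + fine (sqn g).
Proof.
move=> Lf Lg; have := innerff (L2D Lf Lg).
rewrite innerDl ?innerDr //; try exact: L2D.
rewrite !innerff // (innerC Lf Lg) => /(congr1 cRe).
by rewrite !cReD cReJ !Re_real => <-; ring.
Qed.

Lemma sqnr_B f g : L2 f -> L2 g -> fine (sqn (fun x => f x - g x)) =
  fine (sqn f) - 2 * cRe (inner f g) + fine (sqn g).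
Proof.
move=> Lf Lg.
have -> : (fun x => f x - g x) = (fun x => f x + (-1) * g x).
  by apply/funext => x; rewrite mulN1r.
rewrite sqnr_D //; last exact: L2Z.
rewrite innerZr // sqn_Z; last exact: L2_cm.
have -> : cnorm2 (-1 : R[i]) = 1 by rewrite /cnorm2 /=; ring.
rewrite mul1e cjN cj1.
by rewrite mulN1r cReN; ring.
Qed.

(* AM-GM form of the Cauchy-Schwarz inequality. *)
Lemma Re_inner_le f g (t : R) : L2 f -> L2 g -> 0 < t ->
  `|cRe (inner f g)| <= t * fine (sqn f) + t^-1 * fine (sqn g).
Proof.
move=> Lf Lg t0.
have key (s : R) : 0 <= fine (sqn f) + 2 * (s * cRe (inner f g)) + s ^+ 2 * fine (sqn g).
  have := fine_sqn_ge0 (fun x => f x + s%:C * g x).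
  rewrite sqnr_D //; last exact: L2Z.
  rewrite innerZr // sqn_Z; last exact: L2_cm.
  rewrite cj_real cReM Re_real Im_real mul0r subr0 cnorm2_real.
  by rewrite [X in fine (_ * X)%E]L2_fin.
have := key t^-1; have := key (- t^-1).
set A := fine (sqn f); set B := fine (sqn g); set C := cRe _.
have A0 : 0 <= A := fine_sqn_ge0 f; have B0 : 0 <= B := fine_sqn_ge0 g.
have -> : (- t^-1) ^+ 2 = t^-1 ^+ 2 by rewrite sqrrN.
have st : t * t^-1 = 1 by rewrite divff // gt_eqF.
set s := t^-1 in st *; have s0 : 0 < s by rewrite invr_gt0.
move=> h1 h2.
have {}h1 : 0 <= t * (A + 2 * (- s * C) + s ^+ 2 * B) by rewrite mulr_ge0 // ltW.
have {}h2 : 0 <= t * (A + 2 * (s * C) + s ^+ 2 * B) by rewrite mulr_ge0 // ltW.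
have e1 : t * (A + 2 * (- s * C) + s ^+ 2 * B) = t * A - 2 * (t * s) * C + (t * s) * s * B by ring.
have e2 : t * (A + 2 * (s * C) + s ^+ 2 * B) = t * A + 2 * (t * s) * C + (t * s) * s * B by ring.
rewrite e1 st in h1; rewrite e2 st in h2.
have tA : 0 <= t * A by rewrite mulr_ge0 // ltW.
have sB : 0 <= s * B by rewrite mulr_ge0 // ltW.
by rewrite ler_norml; lra.
Qed.

(* Polarization. *)
Lemma inner_of_sqn (f1 g1 f2 g2 : R -> R[i]) (k : R) :
  L2 f1 -> L2 g1 -> L2 f2 -> L2 g2 ->
  (forall z : R[i], fine (sqn (fun x => f1 x + z * g1 x)) = k * fine (sqn (fun x => f2 x + z * g2 x))) ->
  inner f1 g1 = k%:C * inner f2 g2.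
Proof.
move=> Lf1 Lg1 Lf2 Lg2 H.
have K (f g : R -> R[i]) (z : R[i]) : L2 f -> L2 g ->
    fine (sqn (fun x => f x + z * g x)) =
    fine (sqn f) + 2 * cRe (cj z * inner f g) + cnorm2 z * fine (sqn g).
  move=> Lf Lg; rewrite sqnr_D //; last exact: L2Z.
  rewrite innerZr // sqn_Z; last exact: L2_cm.
  by rewrite [X in fine (_ * X)%E]L2_fin.
have {}H z := H z.
have {}H z : fine (sqn f1) + 2 * cRe (cj z * inner f1 g1) + cnorm2 z * fine (sqn g1) =
    k * (fine (sqn f2) + 2 * cRe (cj z * inner f2 g2) + cnorm2 z * fine (sqn g2)).
  by rewrite -(K f1 g1 z Lf1 Lg1) -(K f2 g2 z Lf2 Lg2).
have H0 := H 0; have H1 := H 1; have H2 := H (-1).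
have H3 := H 'i; have H4 := H (- 'i).
move: H0 H1 H2 H3 H4; rewrite /cj.
case: (inner f1 g1) (inner f2 g2) => a b [c d]; rewrite /cnorm2 /= => H0 H1 H2 H3 H4.
by apply: complex_ext => /=; lra.
Qed.

End L2Theory.

(** * Density of trigonometric polynomials in L^2 of a period *)

Section TrigDensity.
Variable R : realType.
Local Notation mu := (@lebesgue_measure R).
Implicit Types (f g h p : R -> R[i]).

(** What truncation arguments take from dominated convergence: the limit is 0, and only smallness
    from some index on is kept. *)
Lemma sqn_dct (F : nat -> R -> R[i]) (G : R -> R) :
  (forall n, cm (F n)) -> mu.-integrable setT (EFin \o G) ->
  (forall n x, cnorm2 (F n x) <= G x) ->
  (forall x, (fun n => cnorm2 (F n x)) @ \oo --> (0 : R)) ->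
  forall e : R, 0 < e -> \forall n \near \oo, (sqn (F n) < e%:E)%E.
Proof.
move=> mF iG FG F0 e e0.
have [|||||_ _ H] := @dominated_convergence _ _ _ mu setT measurableT
  (fun n x => (cnorm2 (F n x))%:E) (fun=> 0%E) (EFin \o G).
- by move=> n; apply/measurable_EFinP; exact: measurable_cnorm2.
- exact: measurable_cst.
- by apply: aeW => x _; apply: cvg_EFin; [exact: nearW|exact: F0].
- exact: iG.
- by apply: aeW => x n _ /=; rewrite lee_fin ger0_norm ?cnorm2_ge0.
move: H; rewrite integral0 => /fine_cvgP [fin /cvgrPdist_lt /(_ e e0) H].
near=> n.
have fn : sqn (F n) \is a fin_num by near: n.
rewrite -(fineK fn) lte_fin.
have : `|0 - fine (sqn (F n))| < e by near: n.
by rewrite sub0r normrN ger0_norm // fine_ge0 // sqn_ge0.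
Unshelve. all: by end_near.
Qed.

Lemma pow_bernoulli (y : R) M : 0 <= y <= 1 -> 1 - M%:R * y <= (1 - y) ^+ M.
Proof.
move=> /andP[y0 y1]; elim: M => [|M IH]; first by rewrite expr0 mul0r subr0.
have h0 : 0 <= M%:R :> R by rewrite ler0n.
rewrite exprSr -natr1; apply: le_trans (_ : (1 - M%:R * y) * (1 - y) <= _).
  by nra.
by rewrite ler_wpM2r // subr_ge0.
Qed.

Lemma pow_bernoulli_inv (y : R) M : 0 <= y <= 1 -> (1 - y) ^+ M * (1 + M%:R * y) <= 1.
Proof.
move=> /andP[y0 y1]; elim: M => [|M IH]; first by rewrite expr0 mul0r addr0 mulr1.
have h0 : 0 <= M%:R :> R by rewrite ler0n.
apply: le_trans IH; rewrite exprSr -mulrA ler_wpM2l //.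
  by rewrite exprn_ge0 // subr_ge0.
by rewrite -natr1; nra.
Qed.

(** [1 - s^N] is [1 - s] times the sum of the [s^i] for [i < N], and each of these [N] terms is at
    least [s^N]. *)
Lemma natmul_expr_le (s : R) N : 0 <= s <= 1 -> N%:R * (1 - s) * s ^+ N <= 1 - s ^+ N.
Proof.
move=> /andP[s0 s1]; elim: N => [|N IH]; first by rewrite expr0 !mul0r subrr.
have h0 : 0 <= s ^+ N by rewrite exprn_ge0.
have h1 : s ^+ N <= 1 by rewrite exprn_ile1.
rewrite -natr1 exprS.
have : s * (N%:R * (1 - s) * s ^+ N) <= s * (1 - s ^+ N) by rewrite ler_wpM2l.
have : 0 <= (1 - s) * (1 - s * s ^+ N).
  by rewrite mulr_ge0 ?subr_ge0 // mulr_ile1.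
by nra.
Qed.

Lemma cvg_natmul_expr (r : R) : 0 <= r < 1 -> (fun N => N%:R * r ^+ N) @ \oo --> (0 : R).
Proof.
(* With [s = sqrt r], one factor [s^N] absorbs [N] by [natmul_expr_le] and the other tends to 0. *)
move=> /andP[r0 r1]; set s := Num.sqrt r.
have s0 : 0 <= s by exact: sqrtr_ge0.
have s1 : s < 1 by rewrite -sqrtr1 ltr_sqrt.
have rs : r = s * s by rewrite -expr2 sqr_sqrtr.
apply: (@squeeze_cvgr _ _ _ _ (fun=> 0) (fun N => s ^+ N * (1 - s)^-1)).
- apply: nearW => N; apply/andP; split.
    by rewrite mulr_ge0 ?ler0n // exprn_ge0.
  rewrite ler_pdivlMr ?subr_gt0 // rs exprMn.
  have -> : N%:R * (s ^+ N * s ^+ N) * (1 - s) = s ^+ N * (N%:R * (1 - s) * s ^+ N) by ring.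
  rewrite -[leRHS]mulr1 ler_wpM2l ?exprn_ge0 //.
  apply: le_trans (natmul_expr_le N _) _; first by rewrite s0 ltW.
  by rewrite lerBlDr lerDl exprn_ge0.
- exact: cvg_cst.
- rewrite -[X in _ --> X](mul0r (1 - s)^-1); apply: cvgMr_tmp.
  by apply: cvg_expr; rewrite ger0_norm.
Qed.

(* The Brosowski--Deutsch polynomials: a uniformly bounded sequence of
   polynomials in q converging to the indicator function of [1/2, 1] on [0, 1] *)
Definition steppoly (N : nat) (q : R) : R := 1 - (1 - q ^+ N) ^+ (N * 2 ^ N).

Lemma steppoly_itv N q : 0 <= q <= 1 -> 0 <= steppoly N q <= 1.
Proof.
move=> /andP[q0 q1]; rewrite /steppoly subr_ge0 lerBlDr lerDl.
have h : 0 <= 1 - q ^+ N by rewrite subr_ge0 exprn_ile1.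
by rewrite exprn_ge0 // exprn_ile1 // lerBlDr lerDl exprn_ge0.
Qed.

(** The exponent [N 2^N] is tuned to the threshold 1/2. For [q >= 1/2] one has [q^N >= 2^-N], and
    the inverse Bernoulli bound leaves a distance of at most [1 / (N + 1)] to 1; for [q < 1/2]
    Bernoulli's inequality bounds the value by [N (2 q)^N]. *)
Lemma steppoly_cvg q : 0 <= q <= 1 -> (fun N => steppoly N q) @ \oo --> ((2^-1 <= q)%R%:R : R).
Proof.
move=> /andP[q0 q1].
have qN N : 0 <= q ^+ N <= 1 by rewrite exprn_ge0 // exprn_ile1.
case: (leP 2^-1 q) => hq.
  have -> : ((true)%:R : R) = 1 - 0 by rewrite subr0.
  apply: cvgB; first exact: cvg_cst.
  apply: (@squeeze_cvgr _ _ _ _ (fun=> 0) (fun N => N.+1%:R^-1)).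
  - apply: nearW => N; have /andP[qN0 qN1] := qN N.
    rewrite exprn_ge0 ?subr_ge0 //=.
    have P2 : 0 < (2 : R) ^+ N by rewrite exprn_gt0.
    have y01 : 0 <= ((2 : R) ^+ N)^-1 <= 1.
      by rewrite invr_ge0 ltW //= invf_le1 // exprn_ege1 // ler1n.
    have := pow_bernoulli_inv (N * 2 ^ N) y01.
    rewrite natrM natrX mulfK ?gt_eqF // -[1 + N%:R]addrC natr1 => h.
    rewrite -[leRHS]mul1r ler_pdivlMr ?ltr0n //; apply: le_trans h.
    rewrite ler_wpM2r ?ler0n //; apply: lerXn2r; rewrite ?nnegrE ?subr_ge0 //.
      by case/andP: y01.
    rewrite lerD2l lerN2 -exprVn; apply: lerXn2r => //; rewrite nnegrE //.
  - exact: cvg_cst.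
  - exact: cvg_harmonic.
have h2q : 0 <= 2 * q < 1 by lra.
apply: (@squeeze_cvgr _ _ _ _ (fun=> 0) (fun N => N%:R * (2 * q) ^+ N)).
- apply: nearW => N.
  have /andP[-> _] : 0 <= steppoly N q <= 1 by apply: steppoly_itv; rewrite q0.
  have := pow_bernoulli (N * 2 ^ N) (qN N).
  by rewrite /steppoly natrM natrX exprMn => /=; lra.
- exact: cvg_cst.
- exact: cvg_natmul_expr.
Qed.

Definition trigpoly (T : R) (s : seq (int * R[i])) (x : R) : R[i] :=
  \sum_(t <- s) t.2 * expi (x * (2 * pi * t.1%:~R / T)).

Definition trig (T : R) p : Prop := exists s, p = trigpoly T s.

Lemma trig_expi T (k : int) (z : R[i]) : trig T (fun x => z * expi (x * (2 * pi * k%:~R / T))).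
Proof.
by exists [:: (k, z)]; apply/funext => x; rewrite /trigpoly big_cons big_nil addr0.
Qed.

Lemma trig_cst T (z : R[i]) : trig T (fun=> z).
Proof.
have [s E] := trig_expi T 0 z; exists s; rewrite -E; apply/funext => x.
by rewrite mulr0 mul0r mulr0 expi0 mulr1.
Qed.

Lemma trigD T p1 p2 : trig T p1 -> trig T p2 -> trig T (fun x => p1 x + p2 x).
Proof.
move=> [s1 ->] [s2 ->]; exists (s1 ++ s2); apply/funext => x.
by rewrite /trigpoly big_cat.
Qed.

Lemma trigM T p1 p2 : trig T p1 -> trig T p2 -> trig T (fun x => p1 x * p2 x).
Proof.
move=> [s1 ->] [s2 ->].
exists [seq (a.1 + b.1, a.2 * b.2) | a <- s1, b <- s2]; apply/funext => x.
rewrite /trigpoly big_allpairs_dep /= big_distrl /=; apply: eq_bigr => a _.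
rewrite big_distrr /=; apply: eq_bigr => b _.
have -> : x * (2 * pi * (a.1 + b.1)%:~R / T) =
   x * (2 * pi * a.1%:~R / T) + x * (2 * pi * b.1%:~R / T) by rewrite intrD; ring.
by rewrite expiD; ring.
Qed.

Lemma trigB T p1 p2 : trig T p1 -> trig T p2 -> trig T (fun x => p1 x - p2 x).
Proof.
move=> h1 h2; have := trigD h1 (trigM (trig_cst T (-1)) h2).
by under eq_fun do rewrite mulN1r.
Qed.

Lemma trigX T p n : trig T p -> trig T (fun x => p x ^+ n).
Proof.
move=> h; elim: n => [|n IH]; first by under eq_fun do rewrite expr0; exact: trig_cst.
by under eq_fun do rewrite exprS; exact: trigM.
Qed.

Lemma trig_bm T p : trig T p -> bm p.
Proof.
move=> [s ->]; apply: bm_sum => t; apply: bmM; [exact: bm_cst|exact: bm_expiM].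
Qed.

Lemma trig_cos T (m : R) : trig T (fun x => (cos (2 * pi / T * (x - m)))%:C).
Proof.
set d := 2 * pi / T.
have h1 := trig_expi T 1 (2^-1%:C * expi (- (d * m))).
have h2 := trig_expi T (-1) (2^-1%:C * expi (d * m)).
have [s E] := trigD h1 h2; exists s; rewrite -E; apply/funext => x.
have -> : (2^-1)%:C * expi (- (d * m)) * expi (x * (2 * pi * 1%:~R / T)) =
    (2^-1)%:C * expi (d * (x - m)).
  by rewrite -mulrA -expiD; congr (_ * expi _); rewrite /d mulr1z; ring.
have -> : (2^-1)%:C * expi (d * m) * expi (x * (2 * pi * (-1)%:~R / T)) =
    (2^-1)%:C * expi (- (d * (x - m))).
  by rewrite -mulrA -expiD; congr (_ * expi _); rewrite /d mulrN1z; ring.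
rewrite /expi cosN sinN; apply: complex_ext; rewrite ?cReD ?cImD ?cReM ?cImM /=; lra.
Qed.

Variables (T c : R).
Hypothesis T0 : 0 < T.

(** The approximation is tested on one period only; [g] lives on the whole line and may be far from
    periodic. *)
Definition apx g : Prop := cm g /\ forall e : R, 0 < e ->
  exists p, trig T p /\ (sqn (fun x => (g x - p x) * cI `[c, (c + T)%R[ x)%R < e%:E)%E.

Let mI : measurable `[c, (c + T)[%classic := measurable_itv `[c, (c + T)[.
Let cmI : cm (cI `[c, (c + T)[%classic) := (cI_bm mI).1.

Lemma apx_lim g : cm g -> (forall e : R, 0 < e ->
  exists h, apx h /\ (sqn (fun x => (g x - h x) * cI `[c, (c + T)%R[ x)%R < e%:E)%E) -> apx g.
Proof.
move=> mg H; split => // e e0; have e4 : 0 < e / 4 by rewrite divr_gt0.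
have [h [[mh hp] gh]] := H _ e4; have [p [trigpoly hp']] := hp _ e4.
exists p; split => //.
have mp := (trig_bm trigpoly).1.
rewrite (_ : (fun x => _) = (fun x => (g x - h x) * cI `[c, (c + T)%R[ x +
   (h x - p x) * cI `[c, (c + T)%R[ x)); last by apply/funext => x; ring.
by apply: sqn_lt_D => //; apply: cmM => //; exact: cmB.
Qed.

Lemma apx_trig p : trig T p -> apx p.
Proof.
move=> trigpoly; split; first by case: (trig_bm trigpoly).
move=> e e0; exists p; split => //.
rewrite /sqn; under eq_integral do rewrite subrr mul0r cnorm2_0.
by rewrite integral0 lte_fin.
Qed.

Lemma apxD g h : apx g -> apx h -> apx (fun x => g x + h x).
Proof.
move=> [mg G] [mh H]; split; first exact: cmD.
move=> e e0; have e4 : 0 < e / 4 by rewrite divr_gt0.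
have [p [trigpoly gp]] := G _ e4; have [q [tq hq]] := H _ e4.
exists (fun x => p x + q x); split; first exact: trigD.
have mp := (trig_bm trigpoly).1; have mq := (trig_bm tq).1.
rewrite (_ : (fun x => _) = (fun x => (g x - p x) * cI `[c, (c + T)%R[ x +
   (h x - q x) * cI `[c, (c + T)%R[ x)); last by apply/funext => x; ring.
by apply: sqn_lt_D => //; apply: cmM => //; exact: cmB.
Qed.

Lemma apxZ (z : R[i]) g : apx g -> apx (fun x => z * g x).
Proof.
move=> [mg G]; split; first exact: cmM (cm_cst _) mg.
move=> e e0; have z0 : 0 < 1 + cnorm2 z by rewrite ltr_wpDr // cnorm2_ge0.
have [p [trigpoly gp]] := G (e / (1 + cnorm2 z)) (divr_gt0 e0 z0).
exists (fun x => z * p x); split; first exact: trigM (trig_cst _ _) trigpoly.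
have mp := (trig_bm trigpoly).1.
rewrite (_ : (fun x => _) = (fun x => z * ((g x - p x) * cI `[c, (c + T)%R[ x)));
  last by apply/funext => x; ring.
rewrite sqn_Z; last by apply: cmM => //; exact: cmB.
apply: (@le_lt_trans _ _ ((cnorm2 z)%:E * (e / (1 + cnorm2 z))%:E)%E).
  by rewrite lee_wpmul2l ?lee_fin ?cnorm2_ge0 // ltW.
rewrite -EFinM lte_fin mulrA ltr_pdivrMr // mulrC ltr_pM2l //; lra.
Qed.

(** Dominated convergence on a finite interval turns bounded pointwise limits into L^2 limits. This
    closure property leads from rays to Borel sets and from Borel sets to bounded functions. *)
Lemma apx_bdlim (F : nat -> R -> R[i]) g (M : R) : cm g -> (forall n, apx (F n)) ->
  (forall n x, x \in `[c, c + T[ -> cnorm2 (g x - F n x) <= M) ->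
  (forall x, x \in `[c, c + T[ -> (fun n => cnorm2 (g x - F n x)) @ \oo --> (0 : R)) ->
  apx g.
Proof.
move=> mg aF FM F0; apply: apx_lim => // e e0.
have mF n : cm (F n) by case: (aF n).
have [|||| N _ /(_ N (leqnn N)) HN] := @sqn_dct (fun n x => (g x - F n x) * cI `[c, (c + T)%R[ x)
   (fun x => M * \1_(`[c, c + T[%classic) x) _ _ _ _ e e0.
- by move=> n; apply: cmM => //; exact: cmB.
- have := integrableZl measurableT M (@integrable_indic_itv R c (c + T) true true).
  by apply: eq_integrable => //= x _; rewrite -EFinM.
- move=> n x; rewrite cnorm2M /cI cnorm2_real indicE mem_setE.
  have [xI|xI] := boolP (x \in `[c, c + T[).
    by rewrite expr1n !mulr1 FM.
  by rewrite expr0n /= !mulr0.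
- move=> x; under eq_fun do rewrite cnorm2M /cI cnorm2_real indicE mem_setE.
  have [xI|xI] := boolP (x \in `[c, c + T[).
    by under eq_fun do rewrite expr1n mulr1; exact: F0.
  by under eq_fun do rewrite expr0n /= mulr0; exact: cvg_cst.
by exists (F N); split.
Qed.

Lemma apx_eqI g h : cm g -> apx h -> (forall x, x \in `[c, c + T[ -> g x = h x) -> apx g.
Proof.
move=> mg ah gh; apply: (@apx_bdlim (fun=> h) g 0) => //.
  by move=> n x xI; rewrite gh // subrr cnorm2_0.
by move=> x xI; rewrite gh // subrr cnorm2_0; exact: cvg_cst.
Qed.

Lemma le_cos_itv (x y : R) : x \in `[0, pi] -> y \in `[0, pi] -> (cos x <= cos y) = (y <= x).
Proof. by move=> x0 y0; rewrite !leNgt ltr_cos. Qed.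

(** The cosine of period [T] centred at the midpoint of [[c, v]] decreases with the circular
    distance to the centre, so within one period it is at least its value at [v] exactly on
    [[c, v]]. A ray cut to the period thus becomes a superlevel set of a trigonometric
    polynomial. *)
Lemma cos_arc (v x : R) : c <= v < c + T -> c <= x < c + T ->
  (cos (2 * pi / T * ((v - c) / 2)) <= cos (2 * pi / T * (x - (c + v) / 2))) = (x <= v).
Proof.
move=> /andP[cv vT] /andP[cx xT].
have pi0 : 0 < pi :> R by exact: pi_gt0.
set d := 2 * pi / T.
have d0 : 0 < d by rewrite divr_gt0 // mulr_gt0.
have dT : d * T = 2 * pi by rewrite /d divfK // gt_eqF.
have dT2 : d * (T / 2) = pi by rewrite mulrA dT; field.
have hh : d * ((v - c) / 2) \in `[0, pi].
  rewrite in_itv /=; apply/andP; split; first by rewrite mulr_ge0 ?(ltW d0) //; lra.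
  have : d * ((v - c) / 2) <= d * (T / 2) by rewrite ler_pM2l //; lra.
  by rewrite dT2; lra.
rewrite -[cos (d * (x - _))]cos_norm normrM (gtr0_norm d0).
set w := `|x - (c + v) / 2|.
have w0 : 0 <= w by exact: normr_ge0.
case: (leP w (T / 2)) => hw.
  rewrite le_cos_itv //; last first.
    rewrite in_itv /= mulr_ge0 ?(ltW d0) //=.
    have : d * w <= d * (T / 2) by rewrite ler_pM2l.
    by rewrite dT2; lra.
  rewrite ler_pM2l // /w; apply/idP/idP; last by rewrite ler_norml; lra.
  by rewrite ler_norml; lra.
(* Past half a period the cosine rises again; folding [w] to [T - w] brings the angle back into
   [[0, pi]], where cosine is decreasing. *)
have -> : cos (d * w) = cos (d * (T - w)).
  rewrite -cosN -cosD2pi; congr cos.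
  by rewrite mulrBr dT; ring.
have xv : v < x.
  move: hw; rewrite /w; case: (ler0P (x - (c + v) / 2)); lra.
have wE : w = x - (c + v) / 2 by rewrite /w ger0_norm //; lra.
rewrite le_cos_itv //; last first.
  rewrite in_itv /= mulr_ge0 ?(ltW d0) //=; last by rewrite wE; lra.
  have : d * (T - w) <= d * (T / 2) by rewrite ler_pM2l //; lra.
  by rewrite dT2; lra.
rewrite ler_pM2l // wE; apply/idP/idP; lra.
Qed.

Lemma apx_ray v : apx (cI `]v, +oo[%classic).
Proof.
have mv : measurable (`]v, +oo[%classic : set R) by exact: measurable_itv.
have m1 : cm (cI `]v, +oo[%classic) by case: (cI_bm mv).
case: (ltP v c) => vc.
  apply: apx_eqI (apx_trig (trig_cst T 1)) _ => // x; rewrite in_itv /= => /andP[cx _].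
  by rewrite cI_in //= in_itv /= andbT (lt_le_trans vc).
case: (leP (c + T) v) => vT.
  apply: apx_eqI (apx_trig (trig_cst T 0)) _ => // x; rewrite in_itv /= => /andP[_ xT].
  rewrite cI_out //= in_itv /= andbT; apply/negP; rewrite -leNgt.
  exact: le_trans (ltW xT) vT.
(* A difference of two cosines lies in [[-2, 2]]; dividing by 4 and adding 1/2 maps it into
   [[0, 1]], with difference 0 at the threshold of [steppoly]. *)
pose q x := 2^-1 + (cos (2 * pi / T * (x - (c + v) / 2)) - cos (2 * pi / T * ((v - c) / 2))) / 4.
have q01 x : 0 <= q x <= 1.
  rewrite /q; have := cos_le1 (2 * pi / T * (x - (c + v) / 2)).
  have := cos_geN1 (2 * pi / T * (x - (c + v) / 2)).
  have := cos_le1 (2 * pi / T * ((v - c) / 2)).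
  by have := cos_geN1 (2 * pi / T * ((v - c) / 2)); lra.
have tq : trig T (fun x => (q x)%:C).
  rewrite (_ : (fun x => _) = (fun x => (2^-1 - cos (2 * pi / T * ((v - c) / 2)) / 4)%:C +
     (4^-1)%:C * (cos (2 * pi / T * (x - (c + v) / 2)))%:C)).
    by apply: trigD; [exact: trig_cst|apply: trigM; [exact: trig_cst|exact: trig_cos]].
  apply/funext => x; rewrite /q -rmorphM -rmorphD /=; congr (_%:C); ring.
have tF N : trig T (fun x => 1 - (steppoly N (q x))%:C).
  rewrite (_ : (fun x => _) = (fun x => (1 - ((q x)%:C) ^+ N) ^+ (N * 2 ^ N))).
    by apply: trigX; apply: trigB; [exact: trig_cst|exact: trigX].
  apply/funext => x; rewrite /steppoly -!rmorphXn /=.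
  by rewrite -(rmorph1 (real_complex R)) -!rmorphB -rmorphXn /=; congr (_%:C); ring.
apply: (@apx_bdlim (fun N x => 1 - (steppoly N (q x))%:C) _ 1) => //.
- by move=> n; exact: apx_trig.
- move=> n x xI; rewrite /cI -(rmorph1 (real_complex R)) -!rmorphB cnorm2_real.
  have := steppoly_itv n (q01 x); rewrite indicE; case: (_ \in _) => /=; nra.
move=> x xI; rewrite (_ : (fun n => _) = (fun n => (steppoly n (q x) - (2^-1 <= q x)%R%:R) ^+ 2)).
  have h : (fun n => steppoly n (q x) - (2^-1 <= q x)%R%:R) @ \oo --> (0 : R).
    rewrite -(subrr ((2^-1 <= q x)%R%:R : R)).
    by apply: cvgB; [exact: steppoly_cvg|exact: cvg_cst].
  have E : (fun n => (steppoly n (q x) - (2^-1 <= q x)%R%:R) ^+ 2) =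
     (fun n => steppoly n (q x) - (2^-1 <= q x)%R%:R) \*
     (fun n => steppoly n (q x) - (2^-1 <= q x)%R%:R).
    by apply/funext => n; rewrite expr2.
  by rewrite E; have := cvgM h h; rewrite mulr0; apply.
apply/funext => n; rewrite /cI -(rmorph1 (real_complex R)) -!rmorphB cnorm2_real.
have -> : (2^-1 <= q x) = (x <= v).
  have xI' : c <= x < c + T by move: xI; rewrite in_itv.
  have vI : c <= v < c + T by rewrite vc.
  by rewrite -(cos_arc vI xI') /q lerDl pmulr_lge0 ?subr_ge0 // invr_gt0.
rewrite indicE mem_setE in_itv /= andbT ltNge.
by case: (x <= v) => /=; ring.
Qed.

Lemma cIC (A : set R) x : cI (~` A) x = 1 - cI A x.
Proof.
have [Ax|Ax] := pselect (A x).
  by rewrite (cI_in Ax) cI_out ?subrr.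
by rewrite (cI_out Ax) cI_in ?subr0.
Qed.

(** Writing the error of a partial sum as a single indicator gives at once its bound 1 and its
    eventual vanishing at each point. *)
Lemma cI_bigcup_tail (F : (set R)^nat) x n : trivIset [set: nat] F ->
  cI (\bigcup_k F k) x - \sum_(k < n) cI (F k) x =
  cI [set y | exists k, (n <= k)%N /\ F k y] x.
Proof.
move=> tF; have [[k _ Fkx]|nF] := pselect ((\bigcup_k F k) x); last first.
  rewrite cI_out // big1 ?subr0.
    by rewrite cI_out // => -[k [_ Fk]]; apply: nF; exists k.
  by move=> k _; rewrite cI_out // => Fk; apply: nF; exists k.
have ift j : F j x -> j = k by move=> Fjx; apply: (tF j k) => //; exists x.
rewrite cI_in; last by exists k.
have [kn|kn] := ltnP k n.
  rewrite (bigD1 (Ordinal kn)) //= cI_in // big1.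
    rewrite addr0 subrr cI_out // => -[j [nj /ift jk]].
    by rewrite jk leqNgt kn in nj.
  by move=> j jk; rewrite cI_out // => /ift jk'; case/eqP: jk; apply: val_inj.
rewrite big1.
  by rewrite subr0 cI_in //; exists k.
move=> j _; rewrite cI_out // => /ift jk'.
by have := ltn_ord j; rewrite jk' ltnNge kn.
Qed.

(** Open rays are stable under intersection and generate the Borel sets, while the sets with
    approximable indicator form a Dynkin system. *)
Lemma apx_measurable (A : set R) : measurable A -> apx (cI A).
Proof.
move=> mA.
have ME := @measurable_realfun.RGenOInfty.measurableE R.
apply: (@dynkin_induction _ (measurableTypeR R) (@measurable_realfun.RGenOInfty.G R)
  (fun A => apx (cI A))) => //.
- move=> _ _ [x ->] [y ->]; exists (Order.max x y).
  by apply/seteqP; split => z /=; rewrite !in_itv /= !andbT gt_max;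
    [move=> [-> ->]|move=> /andP[]].
- rewrite (_ : cI _ = fun=> 1); first exact: apx_trig (trig_cst T 1).
  by apply/funext => x; rewrite cI_in.
- by move=> _ [x ->]; exact: apx_ray.
- move=> S mS aS; rewrite (_ : cI _ = (fun x => 1 + (-1) * cI S x)).
    by apply: apxD; [exact: apx_trig (trig_cst T 1)|exact: apxZ].
  by apply/funext => x; rewrite cIC mulN1r.
- move=> F mF tF aF.
  have mU : measurable (\bigcup_k F k) by apply: bigcupT_measurable.
  apply: (@apx_bdlim (fun n x => \sum_(k < n) cI (F k) x) _ 1).
  + by case: (cI_bm mU).
  + move=> n; elim: n => [|n IH].
      by under eq_fun do rewrite big_ord0; exact: apx_trig (trig_cst T 0).
    by under eq_fun do rewrite big_ord_recr; exact: apxD.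
  + move=> n x _; rewrite cI_bigcup_tail // /cI cnorm2_real indicE; case: (_ \in _) => /=; lra.
  + move=> x _; under eq_fun do rewrite cI_bigcup_tail //.
    apply: cvg_near_cst.
    have [[k _ Fkx]|nF] := pselect ((\bigcup_k F k) x).
      exists k.+1 => // n /= kn; rewrite cI_out ?cnorm2_0 //.
      move=> [j [nj Fj]]; have jk : j = k by apply: (tF j k) => //; exists x.
      by move: nj; rewrite jk leqNgt kn.
    apply: nearW => n; rewrite cI_out ?cnorm2_0 // => -[j [_ Fj]].
    by apply: nF; exists j.
- suff : (@measurable_realfun.RGenOInfty.G R).-sigma.-measurable A by [].
  by rewrite -ME.
Qed.

Lemma apx_unit (r : R -> R) : measurable_fun setT r -> (forall x, 0 <= r x <= 1) ->
  apx (fun x => (r x)%:C).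
Proof.
move=> mr r01.
have H n : exists h : R -> R, [/\ measurable_fun setT h, apx (fun x => (h x)%:C) &
   forall x, 0 <= r x - h x <= 2^-1 ^+ n].
  elim: n => [|n [h [mh ah rh]]].
    exists (fun=> 0); split; [exact: measurable_cst|exact: apx_trig (trig_cst T 0)|].
    by move=> x; rewrite subr0 expr0.
  (* Greedy binary expansion: on [A] the remainder still has room for the digit [2^-(n+1)]. *)
  pose A := [set x | 2^-1 ^+ n.+1 <= r x - h x].
  have mA : measurable A.
    rewrite -[A]setTI; apply: (measurable_fun_ler (f := fun=> 2^-1 ^+ n.+1) (g := fun x => r x - h x)) => //.
    exact: measurable_funB.
  exists (fun x => h x + 2^-1 ^+ n.+1 * \1_A x); split.
  - by apply: measurable_funD => //; apply: measurable_funM => //; exact: measurable_indic.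
  - rewrite (_ : (fun x => _) = (fun x => (h x)%:C + (2^-1 ^+ n.+1)%:C * cI A x)).
      by apply: apxD => //; apply: apxZ; exact: apx_measurable.
    by apply/funext => x; rewrite /cI rmorphD rmorphM.
  - move=> x; have := rh x; rewrite indicE.
    have E : 2^-1 ^+ n = 2 * 2^-1 ^+ n.+1 :> R by rewrite exprS mulrA divff ?mul1r.
    have [xA|xA] := boolP (x \in A).
      have : 2^-1 ^+ n.+1 <= r x - h x by move: xA; rewrite inE.
      by rewrite /= mulr1; lra.
    have : r x - h x < 2^-1 ^+ n.+1 by rewrite ltNge; apply: contra xA; rewrite inE.
    by rewrite /= mulr0; lra.
have [h Hh] := choice H.
apply: (@apx_bdlim (fun n x => (h n x)%:C) _ 1).
- exact: cm_real.
- by move=> n; case: (Hh n).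
- move=> n x _; rewrite -rmorphB cnorm2_real; have [_ _ /(_ x)] := Hh n.
  have : 2^-1 ^+ n <= 1 :> R by rewrite exprn_ile1 //; lra.
  by nra.
- move=> x _; apply: (@squeeze_cvgr _ _ _ _ (fun=> 0) (fun n => 2^-1 ^+ n)).
  + apply: nearW => n; rewrite cnorm2_ge0 /= -rmorphB cnorm2_real.
    have [_ _ /(_ x)] := Hh n.
    have : 2^-1 ^+ n <= 1 :> R by rewrite exprn_ile1 //; lra.
    by nra.
  + exact: cvg_cst.
  + by apply: cvg_expr; rewrite ger0_norm //; lra.
Qed.

Lemma apx_real (r : R -> R) (M : R) : measurable_fun setT r -> (forall x, `|r x| <= M) ->
  apx (fun x => (r x)%:C).
Proof.
move=> mr rM; have M0 : 0 <= M := le_trans (normr_ge0 _) (rM 0).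
(* Dividing [r + M] by [2 M + 1] rather than [2 M] lands in [[0, 1]] and stays legitimate when
   [M = 0]. *)
have K : 0 < 2 * M + 1 by lra.
rewrite (_ : (fun x => _) = (fun x => (2 * M + 1)%:C * ((r x + M) / (2 * M + 1))%:C + (- M)%:C)).
  apply: apxD; last exact: apx_trig (trig_cst T _).
  apply: apxZ; apply: apx_unit.
    by apply: measurable_funM => //; exact: measurable_funD.
  move=> x; have := rM x; rewrite ler_norml => h.
  by rewrite divr_ge0 ?ler_pdivrMr //=; lra.
apply/funext => x; rewrite -rmorphM -rmorphD /=; congr (_%:C).
by rewrite mulrCA divff ?gt_eqF //; ring.
Qed.

Lemma trig_dense g (e : R) : bm g -> 0 < e ->
  exists s, (sqn (fun x => (g x - trigpoly T s x) * cI `[c, (c + T)%R[ x)%R < e%:E)%E.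
Proof.
move=> [[m1 m2] [M gM]] e0.
have H (r : R) z : r ^+ 2 <= cnorm2 z -> cnorm2 z <= M -> `|r| <= 1 + M.
  move=> rz zM; have := le_trans rz zM; rewrite -real_normK ?num_real //.
  by have := normr_ge0 r; nra.
have a1 := apx_real m1 (fun x => H _ _ (sqr_Re_le (g x)) (gM x)).
have a2 := apx_real m2 (fun x => H _ _ (sqr_Im_le (g x)) (gM x)).
have [_ /(_ e e0) [p [[s ->] h]]] := apxD a1 (apxZ 'i a2).
exists s; move: h; congr (sqn _ < _)%E; apply/funext => x; congr ((_ - _) * _).
by case: (g x) => a b; apply/eqP; rewrite eq_complex /=; apply/andP; split; apply/eqP; ring.
Qed.

End TrigDensity.

(** * Fourier series on an interval: Bessel's inequality and Parseval's identity *)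

Section Parseval.
Variable R : realType.
Local Notation mu := (@lebesgue_measure R).
Local Notation cRe := (@complex.Re R).
Implicit Types (f g h p : R -> R[i]).

Lemma Rint_ftc (f F : R -> R) (a b : R) : a < b -> continuous f ->
  (forall x : R, is_derive x 1 F (f x)) ->
  Rintegral mu setT (fun x => f x * \1_(`[a, b[%classic) x) = F b - F a.
Proof.
move=> ab cf dF.
have cF : continuous F.
  by move=> x; apply: differentiable_continuous; apply/derivable1_diffP; case: (dF x).
have mf : measurable_fun setT f by exact: continuous_measurable_fun.
transitivity (Rintegral mu `[a, b[ f).
  rewrite [RHS]Rintegral_mkcond; apply: eq_Rintegral => x _.
  by rewrite patch_indic.
have -> : Rintegral mu `[a, b[ f = Rintegral mu `[a, b] f.
  rewrite /Rintegral integral_itv_bndo_bndc //.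
  by apply/measurable_EFinP; exact: measurable_funS mf.
rewrite /Rintegral (@continuous_FTC2 _ f F a b ab) //.
- by apply: continuous_subspaceT.
- split => //.
  + by apply: cvg_at_right_filter; exact: cF.
  + by apply: cvg_at_left_filter; exact: cF.
- by move=> x _; rewrite derive1E; case: (dF x).
Qed.

Lemma ci_cI (a b : R) : a < b -> ci (cI `[a, b[%classic) = (b - a)%:C.
Proof.
move=> ab; apply: complex_ext => /=.
  transitivity (Rintegral mu setT (fun x => (fun=> 1) x * \1_(`[a, b[%classic) x)).
    by apply: eq_Rintegral => x _; rewrite mul1r.
  rewrite (@Rint_ftc (fun=> 1) id) //; first by move=> x; exact: cvg_cst.
by rewrite Rintegral_cst // mul0r.
Qed.

(** The antiderivatives [sin (x w) / w] and [- cos (x w) / w] take equal values at both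
    endpoints. *)
Lemma ci_expi_itv (w a b : R) : w != 0 -> a < b -> expi (b * w) = expi (a * w) ->
  ci (fun x => expi (x * w) * cI `[a, b[%classic x) = 0.
Proof.
move=> w0 ab; rewrite /expi => -[E1 E2].
have dw (x : R) : is_derive x 1 (fun x : R => x * w) w.
  have -> : (fun x : R => x * w) = w *: (id : R -> R).
    by apply/funext => y; rewrite /GRing.scale /= mulrC.
  apply: is_derive_eq; by rewrite /GRing.scale /= mulr1.
have mw : continuous (fun x : R => x * w).
  by move=> x; apply: cvgMr_tmp; exact: cvg_id.
apply: complex_ext.
- transitivity (Rintegral mu setT (fun x => cos (x * w) * \1_(`[a, b[%classic) x)).
    by apply: eq_Rintegral => x _; rewrite /cI cReM /= mulr0 subr0.
  have cc : continuous (fun x : R => cos (x * w)).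
    by move=> x; apply: continuous_comp; [exact: mw|exact: continuous_cos].
  have dd (x : R) : is_derive x 1 (fun x : R => w^-1 * sin (x * w)) (cos (x * w)).
    have d1 : is_derive x 1 (sin \o (fun x : R => x * w)) (cos (x * w) * w).
      by apply: is_derive1_comp.
    have -> : (fun x => w^-1 * sin (x * w)) = w^-1 *: (sin \o (fun x : R => x * w)).
      by apply/funext => y.
    apply: is_derive_eq; rewrite /GRing.scale /=; by rewrite mulrCA mulVf // mulr1.
  by rewrite (Rint_ftc ab cc dd) E2 subrr.
- transitivity (Rintegral mu setT (fun x => sin (x * w) * \1_(`[a, b[%classic) x)).
    by apply: eq_Rintegral => x _; rewrite /cI cImM /= mulr0 add0r.
  have cc : continuous (fun x : R => sin (x * w)).
    by move=> x; apply: continuous_comp; [exact: mw|exact: continuous_sin].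
  have dd (x : R) : is_derive x 1 (fun x : R => - w^-1 * cos (x * w)) (sin (x * w)).
    have d1 : is_derive x 1 (cos \o (fun x : R => x * w)) (- sin (x * w) * w).
      by apply: is_derive1_comp.
    have -> : (fun x => - w^-1 * cos (x * w)) = (- w^-1) *: (cos \o (fun x : R => x * w)).
      by apply/funext => y.
    apply: is_derive_eq; rewrite /GRing.scale /=.
    by rewrite mulrCA mulNr mulNr mulrN opprK mulVf // mulr1.
  by rewrite (Rint_ftc ab cc dd) E1 subrr.
Qed.

Variables (T c : R).
Hypothesis T0 : 0 < T.

Lemma ci_expi_period (k : int) :
  ci (fun x => expi (x * (2 * pi * k%:~R / T)) * cI `[c, (c + T)%R[%classic x) =
  if k == 0 then T%:C else 0.
Proof.
have cT : c < c + T by rewrite ltrDl.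
have pi0 : pi != 0 :> R by rewrite gt_eqF // pi_gt0.
case: eqP => [->|/eqP k0].
  transitivity (ci (cI `[c, (c + T)%R[%classic)).
    by apply: eq_ci => x; rewrite mulr0 mul0r mulr0 expi0 mul1r.
  by rewrite ci_cI // addrC addKr.
apply: ci_expi_itv => //.
  by rewrite !mulf_neq0 // ?invr_neq0 ?intr_eq0 // gt_eqF.
have -> : (c + T) * (2 * pi * k%:~R / T) = c * (2 * pi * k%:~R / T) + 2 * pi * k%:~R.
  by field; rewrite gt_eqF.
by rewrite expi_period.
Qed.

(** The orthogonal exponentials of the window [[c, c + T[], extended by 0 and left unnormalised:
    each has squared norm [T]. *)
Definition ek (k : int) (x : R) : R[i] :=
  expi (x * (2 * pi * k%:~R / T)) * cI `[c, (c + T)%R[%classic x.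

Lemma ek_bc k : bc (ek k).
Proof.
apply: (@bm_cI_bc _ _ _ (`|c| + `|c + T|)); first exact: bm_expiM.
  exact: measurable_itv.
move=> x /=; rewrite !in_itv /= => /andP[cx xT].
have := ler_norm c; have := ler_norm (c + T); have := ler_norm (- c).
have := ler_norm (- (c + T)); rewrite !normrN => *.
by have := normr_ge0 c; have := normr_ge0 (c + T); lra.
Qed.

Lemma cI_sqr (A : set R) x : cI A x * cI A x = cI A x.
Proof.
have [Ax|Ax] := pselect (A x); first by rewrite cI_in // mulr1.
by rewrite cI_out // mulr0.
Qed.

Lemma cj_cI (A : set R) x : cj (cI A x) = cI A x.
Proof. by rewrite /cI cj_real. Qed.

Lemma inner_ek k l : inner (ek k) (ek l) = if k == l then T%:C else 0.
Proof.
rewrite innerE -(subr_eq0 k l) -ci_expi_period; apply: eq_ci => x.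
rewrite /ek cjM cj_cI expiJ.
have -> : x * (2 * pi * (k - l)%:~R / T) =
   x * (2 * pi * k%:~R / T) + - (x * (2 * pi * l%:~R / T)) by rewrite intrB; ring.
by rewrite expiD -[in RHS]cI_sqr; ring.
Qed.

Definition fourier_sum (s : seq int) h (x : R) : R[i] :=
  \sum_(k <- s) ((T^-1)%:C * inner h (ek k)) * ek k x.

Lemma fourier_sum_bc s h : bc (fourier_sum s h).
Proof. by apply: bc_sum => k; apply: bcZ; exact: ek_bc. Qed.

Let Lek k : L2 (ek k) := bc_L2 (ek_bc k).

Lemma inner_fourier_sum s h (l : int) : uniq s -> l \in s ->
  inner (fourier_sum s h) (ek l) = inner h (ek l).
Proof.
move=> us ls; rewrite /fourier_sum inner_suml //; last by move=> k; exact: L2Z.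
rewrite (bigD1_seq l) //= innerZl // inner_ek eqxx big1 ?addr0.
  by rewrite mulrAC -rmorphM mulVf ?gt_eqF //= mul1r.
by move=> k kl; rewrite innerZl // inner_ek (negbTE kl) mulr0.
Qed.

Lemma inner_fourier_sum_h s h : L2 h ->
  inner h (fourier_sum s h) = (T^-1 * \sum_(k <- s) cnorm2 (inner h (ek k)))%:C.
Proof.
move=> Lh; have LS : L2 (fourier_sum s h) by apply: bc_L2; exact: fourier_sum_bc.
rewrite (innerC LS Lh) /fourier_sum inner_suml //; last by move=> k; exact: L2Z.
rewrite mulr_sumr rmorph_sum /=.
rewrite (big_morph (@cj R) (@cjD R) (@cj0 R)).
apply: eq_bigr => k _; rewrite innerZl // cjM cjM cj_real -(innerC (Lek k) Lh).
by rewrite -mulrA [cj _ * _]mulrC mulJ_cnorm2 rmorphM.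
Qed.

Lemma fourier_sum_orth s h p : uniq s -> L2 h ->
  (exists2 q : seq (int * R[i]), (forall t, t \in q -> t.1 \in s) &
     p = fun x => \sum_(t <- q) t.2 * ek t.1 x) ->
  inner (fun x => h x - fourier_sum s h x) p = 0.
Proof.
move=> us Lh [q qs ->].
have LS : L2 (fourier_sum s h) by apply: bc_L2; exact: fourier_sum_bc.
have Lp : L2 (fun x => \sum_(t <- q) t.2 * ek t.1 x).
  by apply: L2_sum => t; exact: L2Z.
rewrite (innerC Lp (L2B Lh LS)) inner_suml; last exact: L2B.
  rewrite big_seq big1 ?cj0 // => t tq.
  rewrite innerZl //; last exact: L2B.
  rewrite (innerC (L2B Lh LS) (Lek t.1)).
  have -> : inner (fun x => h x - fourier_sum s h x) (ek t.1) = 0.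
    have -> : (fun x => h x - fourier_sum s h x) = (fun x => h x + (-1) * fourier_sum s h x).
      by apply/funext => x; rewrite mulN1r.
    rewrite innerDl //; last exact: L2Z.
    by rewrite innerZl // inner_fourier_sum ?qs // mulN1r subrr.
  by rewrite cj0 mulr0.
by move=> t; exact: L2Z.
Qed.

Lemma sqnr_fourier_sum s h : uniq s -> L2 h ->
  fine (sqn (fun x => h x - fourier_sum s h x)) =
  fine (sqn h) - T^-1 * \sum_(k <- s) cnorm2 (inner h (ek k)).
Proof.
move=> us Lh; have LS : L2 (fourier_sum s h) by apply: bc_L2; exact: fourier_sum_bc.
have E : inner (fun x => h x - fourier_sum s h x) (fourier_sum s h) = 0.
  apply: fourier_sum_orth => //.
  exists [seq (k, (T^-1)%:C * inner h (ek k)) | k <- s].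
    by move=> t /mapP[k ks ->].
  by apply/funext => x; rewrite big_map.
have : inner h (fourier_sum s h) = inner (fourier_sum s h) (fourier_sum s h).
  move: E; have -> : (fun x => h x - fourier_sum s h x) = (fun x => h x + (-1) * fourier_sum s h x).
    by apply/funext => x; rewrite mulN1r.
  rewrite innerDl //; last exact: L2Z.
  by rewrite innerZl // mulN1r => /eqP; rewrite subr_eq0 => /eqP.
rewrite inner_fourier_sum_h // innerff // => /(congr1 cRe) /= E2.
by rewrite sqnr_B // inner_fourier_sum_h // Re_real -E2; ring.
Qed.

Lemma bessel s h : uniq s -> L2 h ->
  \sum_(k <- s) cnorm2 (inner h (ek k)) <= T * fine (sqn h).
Proof.
move=> us Lh; have := fine_sqn_ge0 (fun x => h x - fourier_sum s h x).
rewrite sqnr_fourier_sum // subr_ge0.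
by rewrite ler_pdivrMl.
Qed.

(** Pythagoras: [fourier_sum s h - p] lies in the span of the [ek] with index in [s], to which
    [h - fourier_sum s h] is orthogonal. *)
Lemma best_approx s h (q : seq (int * R[i])) : uniq s -> L2 h ->
  (forall t, t \in q -> t.1 \in s) ->
  fine (sqn (fun x => h x - fourier_sum s h x)) <=
  fine (sqn (fun x => h x - \sum_(t <- q) t.2 * ek t.1 x)).
Proof.
move=> us Lh qs.
set p := fun x => \sum_(t <- q) t.2 * ek t.1 x.
have Lp : L2 p by apply: L2_sum => t; exact: L2Z.
have LS : L2 (fourier_sum s h) by apply: bc_L2; exact: fourier_sum_bc.
have -> : (fun x => h x - p x) = (fun x => (h x - fourier_sum s h x) + (fourier_sum s h x - p x)).
  by apply/funext => x; ring.
rewrite (sqnr_D (L2B Lh LS) (L2B LS Lp)).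
rewrite fourier_sum_orth //; last first.
  exists ([seq (k, (T^-1)%:C * inner h (ek k)) | k <- s] ++ [seq (t.1, - t.2) | t <- q]).
    move=> t; rewrite mem_cat => /orP[/mapP[k ks ->]//|/mapP[u uq ->]]; exact: (qs _ uq).
  apply/funext => x; rewrite big_cat !big_map /= /p /fourier_sum; congr (_ + _).
  by rewrite -sumrN; apply: eq_bigr => t _; rewrite mulNr.
by rewrite Re_real mulr0 addr0 lerDl fine_sqn_ge0.
Qed.

(** The frequencies from [K] down to [- K + 1], in the order in which [ift_sample_sum] runs through
    the sampling grid. *)
Definition symfreq (K : nat) : seq int := [seq K%:Z - i%:Z | i <- iota 0 (2 * K)].

Lemma symfreq_uniq K : uniq (symfreq K).
Proof.
rewrite map_inj_uniq ?iota_uniq // => i j.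
by move/addrI/oppr_inj => -[].
Qed.

Lemma mem_symfreq (k : int) K : (`|k| < K)%N -> k \in symfreq K.
Proof.
move=> kK; apply/mapP; exists `|K%:Z - k|%N.
  rewrite mem_iota add0n /=; lia.
by lia.
Qed.

(** Bessel's inequality is the upper bound; this lower bound comes from density, since a Fourier sum
    approximates at least as well as any trigonometric polynomial whose frequencies it contains. *)
Lemma parseval_symfreq h (e : R) : bc h ->
  (forall x, h x = h x * cI `[c, (c + T)%R[%classic x) -> 0 < e ->
  \forall K \near \oo, T * fine (sqn h) - e < \sum_(k <- symfreq K) cnorm2 (inner h (ek k)).
Proof.
move=> bh hI e0; have Lh := bc_L2 bh.
have [q hq] := @trig_dense R T c T0 h (e / T) (bc_bm bh) (divr_gt0 e0 T0).
(* From this index on, [symfreq K] contains all frequencies of [q]. *)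
exists (\max_(t <- q) `|t.1|%N).+1 => // K /= qK.
have qs t : t \in q -> t.1 \in symfreq K.
  move=> tq; apply: mem_symfreq; apply: leq_trans qK; rewrite ltnS.
  by rewrite (big_rem t) //= leq_maxl.
have := best_approx (symfreq_uniq K) Lh qs.
rewrite sqnr_fourier_sum ?symfreq_uniq // => H.
have E : (fun x => h x - \sum_(t <- q) t.2 * ek t.1 x) =
    (fun x => (h x - trigpoly T q x) * cI `[c, (c + T)%R[%classic x).
  apply/funext => x; rewrite mulrBl -hI; congr (_ - _).
  by rewrite /trigpoly mulr_suml; apply: eq_bigr => t _; rewrite /ek mulrA.
have Lp : L2 (fun x => h x - \sum_(t <- q) t.2 * ek t.1 x).
  by apply: L2B => //; apply: L2_sum => t; exact: L2Z.
rewrite E in H Lp.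
have : fine (sqn (fun x => (h x - trigpoly T q x) * cI `[c, (c + T)%R[%classic x)) < e / T.
  by rewrite -lte_fin -L2_fin.
move=> /(le_lt_trans H); rewrite ltr_pdivlMr // mulrBl mulrAC mulVf ?gt_eqF // mul1r.
by rewrite mulrC; lra.
Qed.

End Parseval.

(** * Parameter integrals, the inverse Fourier transform and sampling on a grid *)

Section Plancherel.
Variable R : realType.
Local Notation mu := (@lebesgue_measure R).
Local Notation cRe := (@complex.Re R).
Local Notation cIm := (@complex.Im R).
Implicit Types (f g h p : R -> R[i]).

(** Tonelli's theorem provides measurability for nonnegative kernels; a signed kernel is split into
    its positive and negative parts. *)
Lemma measurable_param_Rint (k : R -> R -> R) :
  measurable_fun setT (fun z : measurableTypeR R * measurableTypeR R => k z.1 z.2) ->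
  measurable_fun setT (fun x => Rintegral mu setT (fun y => k x y)).
Proof.
move=> mk.
pose K : measurableTypeR R * measurableTypeR R -> \bar R := fun z => (k z.1 z.2)%:E.
have mK : measurable_fun setT K by exact/measurable_EFinP.
have m1 : measurable_fun setT (fubini_F mu K^\+%E).
  by apply: measurable_fun_fubini_tonelli_F => //; exact: measurable_funepos.
have m2 : measurable_fun setT (fubini_F mu K^\-%E).
  by apply: measurable_fun_fubini_tonelli_F => //; exact: measurable_funeneg.
have E : (fun x => Rintegral mu setT (fun y => k x y)) =
    fine \o (fun x => fubini_F mu K^\+ x - fubini_F mu K^\- x)%E.
  apply/funext => x; rewrite /Rintegral /= integralE /fubini_F.
  by congr fine; congr (_ - _)%E; apply: eq_integral => y _; rewrite ?funeposE ?funenegE.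
rewrite E; apply: measurableT_comp; first exact: fine_measurable.
exact: emeasurable_funB.
Qed.

Lemma Rfubini (k : R -> R -> R) (M : R) :
  measurable_fun setT (fun z : measurableTypeR R * measurableTypeR R => k z.1 z.2) ->
  (forall x y, `|k x y| <= M) ->
  (forall x y, M < `|x| -> k x y = 0) -> (forall x y, M < `|y| -> k x y = 0) ->
  Rintegral mu setT (fun x => Rintegral mu setT (fun y => k x y)) =
  Rintegral mu setT (fun y => Rintegral mu setT (fun x => k x y)).
Proof.
move=> mk kM k1 k2.
have M0 : 0 <= M := le_trans (normr_ge0 _) (kM 0 0).
pose K : measurableTypeR R * measurableTypeR R -> \bar R := fun z => (k z.1 z.2)%:E.
have mK : measurable_fun setT K by exact/measurable_EFinP.
have mI : measurable (`[- M, M]%classic : set (measurableTypeR R)) by exact: measurable_itv.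
pose A := (`[- M, M]%classic : set (measurableTypeR R)) `*` (`[- M, M]%classic : set (measurableTypeR R)).
have mA : measurable A by exact: measurableX.
have iA : (mu \x mu)%E.-integrable setT (fun z => (\1_A z)%:E).
  apply/integrableP; split; first by apply/measurable_EFinP; exact: measurable_indic.
  under eq_integral do rewrite /= ger0_norm //.
  rewrite integral_indic // setIT.
  have E := product_measure1E mu mu mI mI.
  have fin : (mu `[(- M)%R, M]%classic * mu `[(- M)%R, M]%classic < +oo)%E.
    rewrite lebesgue_measure_itv /= lte_fin; case: ifP => _; last by rewrite mule0 ltry.
    by rewrite -EFinD -EFinM ltry.
  by rewrite -E in fin; exact: fin.
have iK : (mu \x mu)%E.-integrable setT K.
  have := integrableZl measurableT M iA.
  apply: le_integrable => // -[x y] _ /=; rewrite /K /= lee_fin normrM (ger0_norm M0).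
  have [hx|hx] := ltP M `|x|; first by rewrite k1 // normr0 mulr_ge0.
  have [hy|hy] := ltP M `|y|; first by rewrite k2 // normr0 mulr_ge0.
  rewrite indicE mem_set ?normr1 ?mulr1 //.
  by rewrite /A /=; split; rewrite in_itv /= -ler_norml.
have F := @Fubini _ _ _ _ R mu mu K iK.
have ix x : mu.-integrable setT (EFin \o (fun y => k x y)).
  apply: (@Rbc_int _ _ M).
    have mx : measurable_fun setT (fun y : measurableTypeR R => ((x : measurableTypeR R), y)).
      by apply: measurable_fun_pair; [exact: measurable_cst|exact: measurable_id].
    exact: (measurableT_comp mk mx).
  by move=> y; split => //; exact: k2.
have iy y : mu.-integrable setT (EFin \o (fun x => k x y)).
  apply: (@Rbc_int _ _ M).
    have my : measurable_fun setT (fun x : measurableTypeR R => (x, (y : measurableTypeR R))).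
      by apply: measurable_fun_pair; [exact: measurable_id|exact: measurable_cst].
    exact: (measurableT_comp mk my).
  by move=> x; split => //; exact: k1.
rewrite /Rintegral.
have -> : (\int[mu]_x (fine (\int[mu]_y (k x y)%:E))%:E = \int[mu]_x \int[mu]_y K (x, y))%E.
  by apply: eq_integral => x _; rewrite fineK //; exact: (integrable_fin_num measurableT (ix x)).
rewrite F; congr fine.
by apply: eq_integral => y _; rewrite fineK //; exact: (integrable_fin_num measurableT (iy y)).
Qed.

Definition ift g (x : R) : R[i] := ((2 * pi)^-1)%:C * ci (fun y => g y * expi (y * x)).

Lemma bc_expi g (x : R) : bc g -> bc (fun y => g y * expi (y * x)).
Proof. by move=> bg; apply: bcM => //; exact: bm_expiM. Qed.

Lemma iftD f g x : bc f -> bc g -> ift (fun y => f y + g y) x = ift f x + ift g x.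
Proof.
move=> bf bg; rewrite /ift -mulrDr -ciD; try by apply: bc_Cint; exact: bc_expi.
by congr (_ * _); apply: eq_ci => y; rewrite mulrDl.
Qed.

Lemma iftZ (z : R[i]) f x : bc f -> ift (fun y => z * f y) x = z * ift f x.
Proof.
move=> bf; rewrite /ift mulrCA -(ciZ z (bc_Cint (bc_expi x bf))).
by congr (_ * _); apply: eq_ci => y; rewrite mulrA.
Qed.

Lemma iftB f g x : bc f -> bc g -> ift (fun y => f y - g y) x = ift f x - ift g x.
Proof.
move=> bf bg; have -> : (fun y => f y - g y) = (fun y => f y + (-1) * g y).
  by apply/funext => y; rewrite mulN1r.
by rewrite iftD ?iftZ ?mulN1r //; exact: bcZ.
Qed.

Lemma ift_sum (I : Type) (s : seq I) (F : I -> R -> R[i]) x : (forall i, bc (F i)) ->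
  ift (fun y => \sum_(i <- s) F i y) x = \sum_(i <- s) ift (F i) x.
Proof.
move=> bF; elim: s => [|i s IH].
  rewrite big_nil; under eq_fun do rewrite big_nil.
  rewrite -[RHS](mul0r (ift (fun=> 0) x)) -iftZ; last exact: bc0.
  by congr (ift _ x); apply/funext => y; rewrite mul0r.
rewrite big_cons -IH -iftD //; last exact: bc_sum.
by congr (ift _ x); apply/funext => y; rewrite big_cons.
Qed.

Lemma measurable_ci_param (k : R -> R -> R[i]) :
  measurable_fun setT (fun z : measurableTypeR R * measurableTypeR R => cRe (k z.1 z.2)) ->
  measurable_fun setT (fun z : measurableTypeR R * measurableTypeR R => cIm (k z.1 z.2)) ->
  cm (fun x => ci (fun y => k x y)).
Proof.
move=> m1 m2; split.
  exact: (measurable_param_Rint (k := fun x y => cRe (k x y))).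
exact: (measurable_param_Rint (k := fun x y => cIm (k x y))).
Qed.

Definition cm2 (k : R -> R -> R[i]) : Prop :=
  measurable_fun setT (fun z : measurableTypeR R * measurableTypeR R => cRe (k z.1 z.2)) /\
  measurable_fun setT (fun z : measurableTypeR R * measurableTypeR R => cIm (k z.1 z.2)).

Lemma cm2M k l : cm2 k -> cm2 l -> cm2 (fun x y => k x y * l x y).
Proof.
move=> [f1 f2] [g1 g2]; split.
- rewrite (_ : (fun z => _) = (fun z : measurableTypeR R * measurableTypeR R =>
     cRe (k z.1 z.2) * cRe (l z.1 z.2) - cIm (k z.1 z.2) * cIm (l z.1 z.2))).
    by apply: measurable_funB; exact: measurable_funM.
  by apply/funext => z; rewrite cReM.
- rewrite (_ : (fun z => _) = (fun z : measurableTypeR R * measurableTypeR R =>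
     cRe (k z.1 z.2) * cIm (l z.1 z.2) + cIm (k z.1 z.2) * cRe (l z.1 z.2))).
    by apply: measurable_funD; exact: measurable_funM.
  by apply/funext => z; rewrite cImM.
Qed.

Lemma cm2_fst f : cm f -> cm2 (fun x _ => f x).
Proof.
by move=> [m1 m2]; split;
  [exact: (measurableT_comp m1 measurable_fst)|exact: (measurableT_comp m2 measurable_fst)].
Qed.

Lemma cm2_snd f : cm f -> cm2 (fun _ y => f y).
Proof.
by move=> [m1 m2]; split;
  [exact: (measurableT_comp m1 measurable_snd)|exact: (measurableT_comp m2 measurable_snd)].
Qed.

Lemma cm2_expi : cm2 (fun x y => expi (y * x)).
Proof.
have mm : measurable_fun setT (fun z : measurableTypeR R * measurableTypeR R => (z.2 * z.1 : R)).
  by apply: (@measurable_funM _ _ _ _ (fun z => z.2) (fun z => z.1)); [exact: measurable_snd|exact: measurable_fst].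
by split; [exact: (measurableT_comp (@measurable_cos R) mm)|
   exact: (measurableT_comp (@measurable_sin R) mm)].
Qed.

Lemma ift_cm g : bc g -> cm (ift g).
Proof.
move=> [mg _]; apply: cmM; first exact: cm_cst.
have [m1 m2] := cm2M (cm2_snd mg) cm2_expi.
exact: (@measurable_ci_param (fun x y => g y * expi (y * x))).
Qed.

Lemma cifubini (k : R -> R -> R[i]) (M : R) : cm2 k ->
  (forall x y, cnorm2 (k x y) <= M) ->
  (forall x y, M < `|x| -> k x y = 0) -> (forall x y, M < `|y| -> k x y = 0) ->
  ci (fun x => ci (fun y => k x y)) = ci (fun y => ci (fun x => k x y)).
Proof.
move=> [m1 m2] kM k1 k2.
have M0 : 0 <= M := le_trans (cnorm2_ge0 _) (kM 0 0).
have H (r : R) z : r ^+ 2 <= cnorm2 z -> cnorm2 z <= M -> `|r| <= 1 + M.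
  move=> rz zM; have := le_trans rz zM; rewrite -real_normK ?num_real //.
  by have := normr_ge0 r; nra.
apply: complex_ext => /=.
- apply: (@Rfubini (fun x y => cRe (k x y)) (1 + M)) => //.
  + by move=> x y; exact: H (sqr_Re_le _) (kM _ _).
  + by move=> x y h; rewrite k1 //; lra.
  + by move=> x y h; rewrite k2 //; lra.
- apply: (@Rfubini (fun x y => cIm (k x y)) (1 + M)) => //.
  + by move=> x y; exact: H (sqr_Im_le _) (kM _ _).
  + by move=> x y h; rewrite k1 //; lra.
  + by move=> x y h; rewrite k2 //; lra.
Qed.

Lemma ift_bm g : bc g -> bm (ift g).
Proof.
move=> bg; split; first exact: ift_cm.
have [mg [M gM]] := bg.
have M0 : 0 <= M by apply: le_trans (gM 0).1; exact: cnorm2_ge0.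
have H (r : R) z : r ^+ 2 <= cnorm2 z -> cnorm2 z <= M -> `|r| <= 1 + M.
  move=> rz zM; have := le_trans rz zM; rewrite -real_normK ?num_real //.
  by have := normr_ge0 r; nra.
(* The majorant is independent of [x], since the exponential has modulus 1. *)
pose B := Rintegral mu setT (fun y => (1 + M) * \1_(`[- M, M]%classic) y).
have iB : mu.-integrable setT (EFin \o (fun y => (1 + M) * \1_(`[- M, M]%classic) y)).
  have := integrableZl measurableT (1 + M) (@integrable_indic_itv R (- M) M true false).
  by apply: eq_integrable => // y _; rewrite /= -EFinM.
have key (u : R -> R) (x : R) : mu.-integrable setT (EFin \o u) ->
    (forall y, (u y) ^+ 2 <= cnorm2 (g y * expi (y * x))) -> (Rintegral mu setT u) ^+ 2 <= B ^+ 2.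
  move=> iu ug; rewrite -[leLHS]real_normK ?num_real //; apply: lerXn2r; rewrite ?nnegrE //.
    by apply: Rintegral_ge0 => y _; rewrite mulr_ge0 // addr_ge0.
  apply: le_trans (le_normr_Rintegral measurableT iu) _.
  apply: le_Rintegral => //.
    by have := integrable_norm iu.
  move=> y _; have := ug y; rewrite cnorm2M cnorm2_expi mulr1 => h.
  rewrite indicE; have [hy|hy] := boolP (y \in `[- M, M]%classic).
    by rewrite mulr1; apply: H h (gM y).1.
  have g0 : g y = 0.
    apply: (gM y).2; rewrite ltNge; apply: contra hy.
    by rewrite inE /= in_itv /= -ler_norml.
  move: h; rewrite g0 cnorm2_0 mulr0 => h.
  have : u y ^+ 2 = 0 by apply/eqP; rewrite eq_le h sqr_ge0.
  by move/eqP; rewrite sqrf_eq0 => /eqP ->; rewrite normr0.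
exists (((2 * pi)^-1) ^+ 2 * (B ^+ 2 + B ^+ 2)) => x.
rewrite /ift cnorm2M cnorm2_real; apply: ler_wpM2l; first exact: sqr_ge0.
have [i1 i2] := bc_Cint (bc_expi x bg).
rewrite /cnorm2 /=; apply: lerD.
  by apply: (key _ x i1) => y; exact: sqr_Re_le.
by apply: (key _ x i2) => y; exact: sqr_Im_le.
Qed.

Lemma indic_itv_sum (u d x : R) (N : nat) : 0 < d ->
  \1_(`[u, u + N%:R * d[%classic) x = \sum_(i < N) \1_(`[0, d[%classic) (x - u - i%:R * d) :> R.
Proof.
move=> d0; elim: N => [|N IH].
  rewrite big_ord0 mul0r addr0 indicE mem_setE in_itv /=.
  by case: (leP u x) => // ux; rewrite ltNge ux.
rewrite big_ord_recr /= -IH !indicE !mem_setE !in_itv /= -natr1.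
have h0 : 0 <= N%:R * d by rewrite mulr_ge0 // ltW.
have -> : u + (N%:R + 1) * d = u + N%:R * d + d by ring.
set w := N%:R * d in h0 *.
case: (leP u x) => h1; case: (ltP x (u + w + d)) => h2;
  case: (ltP x (u + w)) => h3; case: (leP 0 (x - u - w)) => h4;
  case: (ltP (x - u - w) d) => h5 /=; rewrite ?addr0 ?add0r //; exfalso; lra.
Qed.

(** The interval is cut into [N] cells of length [d], each translated to [[0, d[]: an integral over
    a long interval becomes an integral, over the offset [s] of a grid, of sums over the grid
    points. *)
Lemma int_sample (F : R -> R) (u d : R) (N : nat) : 0 < d ->
  measurable_fun setT F -> (forall x, 0 <= F x) ->
  (\int[mu]_x (F x * \1_(`[u, u + N%:R * d[%classic) x)%:E =
   \int[mu]_s ((\sum_(i < N) F (s + (u + i%:R * d))) * \1_(`[0, d[%classic) s)%:E)%E.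
Proof.
move=> d0 mF F0.
have m1 (v : R) : measurable_fun setT (fun x : R => x + v).
  by apply: measurable_funD.
have mI : measurable_fun setT (\1_(`[0, d[%classic) : R -> R).
  by apply: measurable_indic; exact: measurable_itv.
transitivity (\sum_(i < N) \int[mu]_x (F x * \1_(`[0, d[%classic) (x - u - i%:R * d))%:E)%E.
  rewrite -ge0_integral_sum //.
  - by apply: eq_integral => x _; rewrite indic_itv_sum // mulr_sumr sumEFin.
  - move=> i; apply/measurable_EFinP; apply: measurable_funM => //.
    apply: (measurableT_comp mI).
    by apply: measurable_funB => //; apply: measurable_funB.
  - by move=> i x _; rewrite lee_fin mulr_ge0.
transitivity (\sum_(i < N) \int[mu]_s (F (s + (u + i%:R * d)) * \1_(`[0, d[%classic) s)%:E)%E.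
  apply: eq_bigr => i _.
  pose G x : \bar R := (F (x + (u + i%:R * d)) * \1_(`[0, d[%classic) x)%:E.
  have -> : (\int[mu]_s (F (s + (u + i%:R * d)) * \1_(`[0, d[%classic) s)%:E = \int[mu]_s G s)%E by [].
  have mG : measurable_fun setT G.
    apply/measurable_EFinP; apply: measurable_funM => //.
    exact: (measurableT_comp mF (m1 _)).
  have G0 x : (0 <= G x)%E by rewrite lee_fin mulr_ge0.
  have := @ge0_int_affine R 1 (- (u + i%:R * d)) G ltr01 mG G0.
  rewrite invr1 mul1e => <-; apply: eq_integral => x _.
  by rewrite /G mul1r subrK opprD addrA.
rewrite -ge0_integral_sum //.
- by apply: eq_integral => x _; rewrite mulr_suml sumEFin.
- move=> i; apply/measurable_EFinP; apply: measurable_funM => //.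
  exact: (measurableT_comp mF (m1 _)).
- by move=> i x _; rewrite lee_fin mulr_ge0.
Qed.

End Plancherel.

(** * Plancherel's theorem and density of inverse transforms *)

Section PlancherelTheorem.
Variable R : realType.
Local Notation mu := (@lebesgue_measure R).
Implicit Types (f g h p : R -> R[i]).

Let pi0 : 0 < pi :> R := pi_gt0 R.
Let pi20 : 0 < 2 * pi :> R.
Proof. by rewrite mulr_gt0. Qed.

Lemma bc_mod g s : bc g -> bc (fun y => g y * expi (y * s)).
Proof. exact: bc_expi. Qed.

Lemma sqn_mod g s : sqn (fun y => g y * expi (y * s)) = sqn g.
Proof. by apply: eq_sqn => x; rewrite cnorm2M cnorm2_expi mulr1. Qed.

(** On a grid of step [2 pi / T] the values of [ift g] are Fourier coefficients: the offset [s]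
    modulates [g], the grid index selects the frequency. *)
Lemma ift_sample g (T c s : R) (k : int) : T != 0 ->
  (forall x, g x = g x * cI `[c, (c + T)%R[%classic x) ->
  ift g (s - 2 * pi * k%:~R / T) =
  ((2 * pi)^-1)%:C * inner (fun y => g y * expi (y * s)) (ek T c k).
Proof.
move=> T0 gI; rewrite /ift innerE; congr (_ * _); apply: eq_ci => y.
rewrite /ek cjM cj_cI expiJ mulrBr expiD [in LHS]gI; ring.
Qed.

Lemma ift_sample_sum g (T c s : R) (K : nat) : T != 0 ->
  (forall x, g x = g x * cI `[c, (c + T)%R[%classic x) ->
  \sum_(i < 2 * K) cnorm2 (ift g (s + (- (K%:R * (2 * pi / T)) + i%:R * (2 * pi / T)))) =
  (2 * pi)^-1 ^+ 2 * \sum_(k <- symfreq K) cnorm2 (inner (fun y => g y * expi (y * s)) (ek T c k)).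
Proof.
move=> T0 gI; rewrite /symfreq big_map -[in RHS](subn0 (2 * K)%N) big_mkord mulr_sumr.
apply: eq_bigr => i _; rewrite -cnorm2_real -cnorm2M -(ift_sample s _ T0 gI).
by congr (cnorm2 (ift g _)); rewrite intrB !pmulrn; ring.
Qed.

(** For every offset the grid sums of [|ift g|^2] tend to the same constant [C], since modulation
    preserves the norm of [g]. Integrated over one cell of offsets, the limit is [C d]; the same
    integrals exhaust the integral of [|ift g|^2] over the line. *)
Theorem plancherel g : bc g -> sqn (ift g) = ((2 * pi)^-1 * fine (sqn g))%:E.
Proof.
move=> bg; have [mg [M gM]] := bg.
have M0 : 0 <= M by apply: le_trans (gM 0).1; exact: cnorm2_ge0.
(* The window [[- (M + 1), M + 1[] contains the support of [g], its open right end included, and [d]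
   is the grid step dual to its length. *)
pose T := 2 * (M + 1); pose c := - (M + 1); pose d := 2 * pi / T.
have T0 : 0 < T by rewrite /T; lra.
have Tn0 : T != 0 by rewrite gt_eqF.
have d0 : 0 < d by rewrite divr_gt0.
have gI x : g x = g x * cI `[c, (c + T)%R[%classic x.
  have [xI|xI] := pselect (`[c, (c + T)%R[%classic x); first by rewrite cI_in // mulr1.
  rewrite cI_out // mulr0; apply: (gM x).2; rewrite ltNge; apply/negP => h; apply: xI.
  by move: h; rewrite /= in_itv /= ler_norml /c /T; lra.
pose F x := cnorm2 (ift g x).
have mF : measurable_fun setT F by apply: measurable_cnorm2; exact: ift_cm.
have F0 x : 0 <= F x by exact: cnorm2_ge0.
pose u (K : nat) := - (K%:R * d).
pose A K s := \sum_(i < 2 * K) F (s + (u K + i%:R * d)).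
pose C := (2 * pi)^-1 ^+ 2 * (T * fine (sqn g)).
have pp : 0 < (2 * pi)^-1 ^+ 2 :> R by rewrite exprn_gt0 // invr_gt0.
have C0 : 0 <= C.
  by rewrite /C mulr_ge0 ?(ltW pp) // mulr_ge0 ?fine_sqn_ge0 // ltW.
(* Bessel's inequality bounds the grid sums uniformly in [K] and [s], which is the majorant for
   dominated convergence in [lim1]. *)
have AC K s : 0 <= A K s <= C.
  rewrite /A; apply/andP; split; first by apply: sumr_ge0 => i _; exact: F0.
  rewrite (ift_sample_sum s K Tn0 gI) /C ler_pM2l // -(sqn_mod g s).
  by apply: bessel; [exact: T0|exact: symfreq_uniq|apply: bc_L2; exact: bc_mod].
have Acvg s : (fun K => A K s) @ \oo --> C.
  apply/cvgrPdist_lt => e e0.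
  have e1 : 0 < e / (2 * pi)^-1 ^+ 2 by rewrite divr_gt0.
  have bgs := bc_mod s bg.
  have gsI x : g x * expi (x * s) = g x * expi (x * s) * cI `[c, (c + T)%R[%classic x.
    by rewrite [in LHS]gI; ring.
  have := parseval_symfreq T0 bgs gsI e1; rewrite sqn_mod.
  apply: filterS => K HK; have /andP[_ h2] := AC K s.
  rewrite ger0_norm ?subr_ge0 //.
  have : (2 * pi)^-1 ^+ 2 * (T * fine (sqn g) - e / (2 * pi)^-1 ^+ 2) < A K s.
    by rewrite /A (ift_sample_sum s K Tn0 gI) ltr_pM2l.
  rewrite mulrBr -/C [X in _ - X]mulrC divfK ?gt_eqF //; lra.
have mI : measurable (`[0, d[%classic : set R) by exact: measurable_itv.
have mI1 : measurable_fun setT (\1_(`[0, d[%classic) : R -> R) by exact: measurable_indic.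
have mA K : measurable_fun setT (A K).
  apply: measurable_sum => i; apply: (measurableT_comp mF).
  by apply: measurable_funD.
have intE K : (\int[mu]_x (F x * \1_(`[u K, u K + (2 * K)%:R * d[%classic) x)%:E =
    \int[mu]_s (A K s * \1_(`[0, d[%classic) s)%:E)%E.
  exact: int_sample.
have lim1 : (\int[mu]_s (A K s * \1_(`[0, d[%classic) s)%:E)%E @[K --> \oo] --> (C * d)%:E.
  have iI : mu.-integrable setT (fun s => (C * \1_(`[0, d[%classic) s)%:E).
    have := integrableZl measurableT C (@integrable_indic_itv R 0 d true true).
    by apply: eq_integrable => // y _; rewrite /= -EFinM.
  have [|||||_ _ H] := @dominated_convergence _ _ _ mu setT measurableT
    (fun K s => (A K s * \1_(`[0, d[%classic) s)%:E)
    (fun s => (C * \1_(`[0, d[%classic) s)%:E) (fun s => (C * \1_(`[0, d[%classic) s)%:E).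
  - by move=> K; apply/measurable_EFinP; apply: measurable_funM; [exact: mA|exact: mI1].
  - by apply/measurable_EFinP; apply: measurable_funM; [exact: measurable_cst|exact: mI1].
  - apply: aeW => s _; apply: cvg_EFin; first exact: nearW.
    by apply: cvgMr_tmp; exact: Acvg.
  - exact: iI.
  - apply: aeW => s K _ /=; have /andP[h1 h2] := AC K s.
    by rewrite lee_fin ger0_norm ?mulr_ge0 // ler_wpM2r.
  move: H; rewrite [X in _ --> X](_ : _ = (C * d)%:E) //.
  under eq_integral do rewrite EFinM.
  rewrite ge0_integralZl_EFin //; last by apply/measurable_EFinP; exact: mI1.
  have mu0d : mu (`[0, d[%classic) = d%:E.
    by rewrite lebesgue_measure_itv /= lte_fin d0 sube0.
  rewrite (EFinM C d); congr (_ * _)%E.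
  apply: eq_trans (integral_indic mu measurableT mI) _.
  by rewrite setIT; exact: mu0d.
(* The intervals are [[- K d, K d[] and increase to the whole line, so monotone convergence
   applies. *)
have lim2 : (\int[mu]_x (F x * \1_(`[u K, u K + (2 * K)%:R * d[%classic) x)%:E)%E @[K --> \oo]
    --> sqn (ift g).
  have uE K : u K + (2 * K)%:R * d = K%:R * d by rewrite /u natrM; ring.
  have mIK K : measurable_fun setT (\1_(`[u K, u K + (2 * K)%:R * d[%classic) : R -> R).
    by apply: measurable_indic; exact: measurable_itv.
  have in_uK K x : (x \in `[u K, u K + (2 * K)%:R * d[%classic) = (- (K%:R * d) <= x < K%:R * d).
    by rewrite mem_setE in_itv /= uE.
  have := @cvg_monotone_convergence _ _ R mu setT measurableT
    (fun K x => (F x * \1_(`[u K, u K + (2 * K)%:R * d[%classic) x)%:E).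
  rewrite [X in _ --> X](_ : _ = sqn (ift g)); last first.
    apply: eq_integral => x _; apply/cvg_lim => //.
    apply: cvg_near_cst; have := nbhs_infty_gtr (`|x| / d); apply: filterS => K.
    rewrite ltr_pdivrMr // ltr_norml => /andP[h1 h2].
    by rewrite indicE in_uK (ltW h1) h2 mulr1.
  apply.
  - by move=> K; apply/measurable_EFinP; apply: measurable_funM; [exact: mF|exact: mIK].
  - by move=> K x _; rewrite lee_fin mulr_ge0.
  - move=> x _ K L KL; rewrite lee_fin ler_wpM2l // !indicE !in_uK.
    have KLd : K%:R * d <= L%:R * d by rewrite ler_pM2r // ler_nat.
    case: (boolP (_ <= x < _)) => //= /andP[h1 h2].
    rewrite (_ : (- (L%:R * d) <= x < L%:R * d) = true) //; lra.
have -> : sqn (ift g) = (C * d)%:E.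
  have EE : (fun K => \int[mu]_x (F x * \1_(`[u K, u K + (2 * K)%:R * d[%classic) x)%:E)%E =
      (fun K => \int[mu]_s (A K s * \1_(`[0, d[%classic) s)%:E)%E.
    by apply/funext => K; exact: intE.
  rewrite EE in lim2.
  by rewrite -(cvg_lim (@ereal_hausdorff R) lim2) -(cvg_lim (@ereal_hausdorff R) lim1).
congr EFin; rewrite /C /d expr2.
have pin : (2 * pi)^-1 * (2 * pi) = 1 :> R by rewrite mulVf // gt_eqF.
have Tin : T * T^-1 = 1 by rewrite mulfV.
set a := 2 * pi in pin *.
have -> : a^-1 * a^-1 * (T * fine (sqn g)) * (a / T) =
  (a^-1 * a) * (T * T^-1) * (a^-1 * fine (sqn g)) by ring.
by rewrite pin Tin !mul1r.
Qed.

Lemma ift_L2 g : bc g -> L2 (ift g).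
Proof.
move=> bg; apply/L2E; split; first exact: ift_cm.
by rewrite plancherel // ltry.
Qed.

Lemma sqn_ift g : bc g -> sqn (ift g) = (((2 * pi)^-1)%:E * sqn g)%E.
Proof. by move=> bg; rewrite plancherel // EFinM -L2_fin //; exact: bc_L2. Qed.

Lemma inner_ift f g : bc f -> bc g -> inner (ift f) (ift g) = ((2 * pi)^-1)%:C * inner f g.
Proof.
move=> bf bg; apply: inner_of_sqn; try exact: ift_L2; try exact: bc_L2.
move=> z; have bz : bc (fun x => f x + z * g x) by apply: bcD => //; exact: bcZ.
have -> : (fun x => ift f x + z * ift g x) = ift (fun x => f x + z * g x).
  by apply/funext => x; rewrite iftD ?iftZ //; exact: bcZ.
by rewrite plancherel.
Qed.

Lemma L2_bc_dense f (e : R) : L2 f -> 0 < e ->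
  exists h, bc h /\ (sqn (fun x => f x - h x)%R < e%:E)%E.
Proof.
move=> Lf e0; have mf := L2_cm Lf; have mf2 := measurable_cnorm2 mf.
pose A (n : nat) := (`[- n%:R, n%:R]%classic `&` [set x | cnorm2 (f x) <= n%:R]) : set R.
have mA n : measurable (A n).
  apply: measurableI; first exact: measurable_itv.
  rewrite -[X in measurable X]setTI.
  by apply: (measurable_fun_ler (f := fun x => cnorm2 (f x)) (g := fun=> n%:R)).
have [||||N _ /(_ N (leqnn N)) HN] := @sqn_dct R (fun n x => f x - f x * cI (A n) x)
  (fun x => cnorm2 (f x)) _ _ _ _ e e0.
- by move=> n; apply: cmB => //; apply: cmM => //; case: (cI_bm (mA n)).
- exact: L2_int.
- move=> n x; have [xA|xA] := pselect (A n x).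
    by rewrite cI_in // mulr1 subrr cnorm2_0 cnorm2_ge0.
  by rewrite cI_out // mulr0 subr0.
- move=> x; apply: cvg_near_cst.
  have := nbhs_infty_ger (`|x| + cnorm2 (f x)); apply: filterS => n h.
  rewrite cI_in ?mulr1 ?subrr ?cnorm2_0 //.
  have := normr_ge0 x; have := cnorm2_ge0 (f x) => h1 h2.
  split; rewrite /= ?in_itv /= -?ler_norml; lra.
exists (fun x => f x * cI (A N) x); split => //.
split; first by apply: cmM => //; case: (cI_bm (mA N)).
exists N%:R => x; split.
  have [xA|xA] := pselect (A N x); first by rewrite cI_in // mulr1; case: xA.
  by rewrite cI_out // mulr0 cnorm2_0.
move=> h; rewrite cI_out ?mulr0 // => -[/=]; rewrite in_itv /= -ler_norml => hx _.
by move: h; rewrite ltNge hx.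
Qed.

(** The forward transform, the integral of [f x * expi (- (x * y))], expressed through [ift] by
    conjugation so that boundedness and Plancherel carry over. *)
Definition ft f (y : R) : R[i] := (2 * pi)%:C * cj (ift (fun x => cj (f x)) y).

Lemma cj_ft f y : cj (ft f y) = ci (fun x => cj (f x) * expi (x * y)).
Proof.
rewrite /ft cjM cj_real cjK /ift mulrA -rmorphM mulfV ?gt_eqF //=.
by rewrite mul1r.
Qed.

Lemma ft_bm f : bc f -> bm (ft f).
Proof.
move=> bf; apply: bmM; first exact: bm_cst.
by apply: bmJ; apply: ift_bm; exact: bcJ.
Qed.

Lemma ft_L2 f : bc f -> L2 (ft f).
Proof.
move=> bf; apply: L2Z; apply/L2E.
have /L2E[mU QU] := ift_L2 (bcJ bf); split; first exact: cmJ.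
by rewrite (_ : sqn _ = sqn (ift (fun x => cj (f x)))) //; apply: eq_sqn => x; rewrite cnorm2J.
Qed.

Lemma sqnr_ft f : bc f -> fine (sqn (ft f)) = 2 * pi * fine (sqn f).
Proof.
move=> bf; have /L2E[mU QU] := ift_L2 (bcJ bf).
rewrite /ft sqn_Z; last exact: cmJ.
rewrite (eq_sqn (g := ift (fun x => cj (f x)))); last by move=> x; rewrite cnorm2J.
rewrite plancherel; last exact: bcJ.
rewrite (eq_sqn (f := fun x => cj (f x)) (g := f)); last by move=> x; rewrite cnorm2J.
rewrite -EFinM /= cnorm2_real expr2.
have pin : 2 * pi * (2 * pi)^-1 = 1 :> R by rewrite mulfV // gt_eqF.
set a := 2 * pi in pin *.
have -> : a * a * (a^-1 * fine (sqn f)) = (a * a^-1) * (a * fine (sqn f)) by ring.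
by rewrite pin mul1r.
Qed.

(** Fubini for the kernel [k], bounded and of bounded support because both functions are. Up to the
    factor [2 pi], this makes [ft] the adjoint of [ift]. *)
Lemma inner_ift_ft g f : bc g -> bc f -> inner (ift g) f = ((2 * pi)^-1)%:C * inner g (ft f).
Proof.
move=> bg bf; rewrite !innerE.
have [mg [M gM]] := bg; have [mf [N fN]] := bf.
have M0 : 0 <= M by apply: le_trans (gM 0).1; exact: cnorm2_ge0.
have N0 : 0 <= N by apply: le_trans (fN 0).1; exact: cnorm2_ge0.
have bJ : bc (fun x => cj (f x)) := bcJ bf.
pose k (x y : R) : R[i] := cj (f x) * (g y * expi (y * x)).
have kE : ci (fun x => ci (fun y => k x y)) = ci (fun y => ci (fun x => k x y)).
  apply: (@cifubini _ k (N * M + N + M)).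
  - apply: cm2M; first by apply: cm2_fst; exact: cmJ.
    by apply: cm2M; [exact: cm2_snd|exact: cm2_expi].
  - move=> x y; rewrite /k !cnorm2M cnorm2_expi mulr1 cnorm2J.
    have h1 := (fN x).1; have h2 := (gM y).1.
    have : cnorm2 (f x) * cnorm2 (g y) <= N * M by rewrite ler_pM ?cnorm2_ge0.
    lra.
  - move=> x y h; rewrite /k (fN x).2 ?cj0 ?mul0r //.
    have : 0 <= N * M by rewrite mulr_ge0.
    lra.
  - move=> x y h; rewrite /k (gM y).2 ?mul0r ?mulr0 //.
    have : 0 <= N * M by rewrite mulr_ge0.
    lra.
transitivity (((2 * pi)^-1)%:C * ci (fun x => ci (fun y => k x y))).
  rewrite -ciZ.
    apply: eq_ci => x; rewrite /k ciZ; last by apply: bc_Cint; exact: bc_expi.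
    by rewrite /ift; ring.
  have -> : (fun x => ci (fun y => k x y)) =
     (fun x => (2 * pi)%:C * (ift g x * cj (f x))).
    apply/funext => x; rewrite /k ciZ; last by apply: bc_Cint; exact: bc_expi.
    have pin : (2 * pi)%:C * ((2 * pi)^-1)%:C = 1 :> R[i].
      by rewrite -rmorphM mulfV ?gt_eqF.
    by rewrite /ift -[LHS]mul1r -pin; ring.
  exact: (CintZ _ (bc_Cint (bcMl (ift_bm bg) bJ))).
congr (_ * _); rewrite kE; apply: eq_ci => y.
rewrite cj_ft -ciZ; last by apply: bc_Cint; exact: bc_expi.
by apply: eq_ci => x; rewrite /k [y * x]mulrC; ring.
Qed.

(** For a truncation [G] of [ft h], adjointness and Plancherel give
    [2 pi |h - ift G|^2 = |ft h - G|^2] for the L^2 norms, and the right side is small by dominated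
    convergence. *)
Lemma ift_dense f (e : R) : L2 f -> 0 < e ->
  exists g, bc g /\ (sqn (fun x => f x - ift g x)%R < e%:E)%E.
Proof.
move=> Lf e0.
have e4 : 0 < e / 4 by rewrite divr_gt0.
have [h [bh fh]] := L2_bc_dense Lf e4.
have Lh := bc_L2 bh; have LV := ft_L2 bh; have mV := L2_cm LV.
pose A (n : nat) := (`[- n%:R, n%:R]%classic : set R).
have mA n : measurable (A n) by exact: measurable_itv.
pose G n x := ft h x * cI (A n) x.
have bG n : bc (G n).
  by apply: (@bm_cI_bc _ _ _ n%:R); [exact: ft_bm|exact: mA|].
have e2 : 0 < 2 * pi * (e / 4) by rewrite mulr_gt0.
have [||||N _ /(_ N (leqnn N)) HN] := @sqn_dct R (fun n x => ft h x - G n x)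
  (fun x => cnorm2 (ft h x)) _ _ _ _ _ e2.
- by move=> n; apply: cmB => //; case: (bG n).
- exact: L2_int.
- move=> n x; rewrite /G; have [xA|xA] := pselect (A n x).
    by rewrite cI_in // mulr1 subrr cnorm2_0 cnorm2_ge0.
  by rewrite cI_out // mulr0 subr0.
- move=> x; apply: cvg_near_cst.
  have := nbhs_infty_ger `|x|; apply: filterS => n hn.
  rewrite /G cI_in; first by rewrite mulr1 subrr cnorm2_0.
  by rewrite /A /= in_itv /= -ler_norml.
exists (G N); split; first exact: bG.
have LG := bc_L2 (bG N); have LUG := ift_L2 (bG N).
have -> : (fun x => f x - ift (G N) x) = (fun x => (f x - h x) + (h x - ift (G N) x)).
  by apply/funext => x; ring.
apply: sqn_lt_D => //; [by apply: L2_cm; exact: L2B|by apply: L2_cm; exact: L2B|].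
have LhU := L2B Lh LUG; have LVG := L2B LV LG.
rewrite (L2_fin LhU) lte_fin.
rewrite (L2_fin LVG) lte_fin in HN.
have inGV : inner (G N) (ft h) = inner (G N) (G N).
  rewrite !innerE; apply: eq_ci => x.
  rewrite /G cjM cj_cI -[in LHS]cI_sqr; ring.
have orth : inner (ft h) (G N) = (fine (sqn (G N)))%:C.
  by rewrite (innerC LG LV) inGV innerff // cj_real.
rewrite sqnr_B // orth Re_real sqnr_ft // in HN.
rewrite sqnr_B // (innerC LUG Lh) cReJ inner_ift_ft // inGV innerff // -rmorphM Re_real.
rewrite plancherel //=.
have pin : 2 * pi * (2 * pi)^-1 = 1 :> R by rewrite mulfV // gt_eqF.
rewrite -(ltr_pM2l pi20); apply: le_lt_trans HN.
set a := fine (sqn (G N)); set b := fine (sqn h).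
have -> : 2 * pi * (b - 2 * ((2 * pi)^-1 * a) + (2 * pi)^-1 * a) =
   2 * pi * b - (2 * pi * (2 * pi)^-1) * a by ring.
by rewrite pin mul1r; lra.
Qed.

End PlancherelTheorem.

(** * Closed spans of the wavelet system *)

Section ClosedSpan.
Variable R : realType.
Local Notation cRe := (@complex.Re R).
Implicit Types (f g h p : R -> R[i]) (S : int -> int -> Prop).

Lemma norm2E f : norm2 f = Num.sqrt (fine (sqn f)).
Proof. by []. Qed.

Variable psi : R -> R[i].
Hypothesis Lpsi : forall j k, L2 (dil_trans psi j k).

Lemma lincomb_L2 s : L2 (lincomb psi s).
Proof. by apply: L2_sum => t; exact: L2Z. Qed.

(** The closed span with tolerances on the squared norm, the quantity that [sqn_lt_D] and Plancherel
    handle. *)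
Definition cspan S f : Prop := L2 f /\ forall e : R, 0 < e ->
  exists s, (forall t, t \in s -> S t.1.1 t.1.2) /\
    (sqn (fun x => f x - lincomb psi s x)%R < e%:E)%E.

Lemma cspanP S f : in_closed_span S psi f <-> cspan S f.
Proof.
split=> -[Lf H]; split => // e e0.
- have s0 : 0 < Num.sqrt e by rewrite sqrtr_gt0.
  have [s [Ss h]] := H _ s0; exists s; split => //.
  have LL := L2B Lf (lincomb_L2 s).
  rewrite (L2_fin LL) lte_fin; move: h; rewrite norm2E ltr_sqrt //.
- have e2 : 0 < e ^+ 2 by rewrite exprn_gt0.
  have [s [Ss h]] := H _ e2; exists s; split => //.
  have LL := L2B Lf (lincomb_L2 s).
  move: h; rewrite (L2_fin LL) lte_fin => h.
  by rewrite norm2E -(ger0_norm (ltW e0)) -sqrtr_sqr ltr_sqrt.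
Qed.

Lemma cspan_gen S j k : S j k -> cspan S (dil_trans psi j k).
Proof.
move=> Sjk; split => // e e0; exists [:: ((j, k), 1)]; split.
  by move=> t; rewrite inE => /eqP ->.
rewrite (_ : sqn _ = 0%E) ?lte_fin //.
rewrite /sqn; under eq_integral do
  rewrite /lincomb big_cons big_nil mul1r addr0 subrr cnorm2_0.
by rewrite integral0.
Qed.

Lemma cspan_sub S S' f : (forall j k, S j k -> S' j k) -> cspan S f -> cspan S' f.
Proof.
move=> SS' [Lf H]; split => // e e0; have [s [Ss h]] := H e e0; exists s; split => //.
by move=> t /Ss; exact: SS'.
Qed.

Lemma cspan_lim S f : L2 f -> (forall e : R, 0 < e ->
  exists h, cspan S h /\ (sqn (fun x => f x - h x)%R < e%:E)%E) -> cspan S f.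
Proof.
move=> Lf H; split => // e e0; have e4 : 0 < e / 4 by rewrite divr_gt0.
have [h [[Lh Hh] fh]] := H _ e4; have [s [Ss hs]] := Hh _ e4.
exists s; split => //.
rewrite (_ : (fun x => _) = (fun x => (f x - h x) + (h x - lincomb psi s x))); last first.
  by apply/funext => x; ring.
by apply: sqn_lt_D => //; apply: L2_cm; apply: L2B => //; exact: lincomb_L2.
Qed.

Lemma cspanD S f g : cspan S f -> cspan S g -> cspan S (fun x => f x + g x).
Proof.
move=> [Lf Hf] [Lg Hg]; split; first exact: L2D.
move=> e e0; have e4 : 0 < e / 4 by rewrite divr_gt0.
have [s [Ss fs]] := Hf _ e4; have [r [Sr gr]] := Hg _ e4.
exists (s ++ r); split.
  by move=> t; rewrite mem_cat => /orP[/Ss|/Sr].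
rewrite (_ : (fun x => _) = (fun x => (f x - lincomb psi s x) + (g x - lincomb psi r x))); last first.
  by apply/funext => x; rewrite /lincomb big_cat /=; ring.
by apply: sqn_lt_D => //; apply: L2_cm; apply: L2B => //; exact: lincomb_L2.
Qed.

Lemma cspanZ S (z : R[i]) f : cspan S f -> cspan S (fun x => z * f x).
Proof.
move=> [Lf Hf]; split; first exact: L2Z.
move=> e e0; have z0 : 0 < 1 + cnorm2 z by rewrite ltr_wpDr // cnorm2_ge0.
have [s [Ss fs]] := Hf _ (divr_gt0 e0 z0).
exists [seq (t.1, z * t.2) | t <- s]; split.
  by move=> t /mapP[u us ->]; exact: (Ss u us).
have LL := L2B Lf (lincomb_L2 s).
rewrite (_ : (fun x => _) = (fun x => z * (f x - lincomb psi s x))); last first.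
  apply/funext => x; rewrite /lincomb big_map mulrBr mulr_sumr; congr (_ - _).
  by apply: eq_bigr => t _; rewrite -[LHS]/(z * t.2 * dil_trans psi t.1.1 t.1.2 x) -mulrA.
rewrite sqn_Z; last exact: L2_cm.
move: fs; rewrite (L2_fin LL) -EFinM !lte_fin ltr_pdivlMr // => h.
apply: le_lt_trans h; rewrite mulrC ler_wpM2l ?fine_sqn_ge0 //; lra.
Qed.

Lemma cspan0 S : cspan S (fun=> 0).
Proof.
split; first exact: L2_0.
move=> e e0; exists [::]; split => //.
rewrite /sqn; under eq_integral do rewrite /lincomb big_nil subrr cnorm2_0.
by rewrite integral0 lte_fin.
Qed.

Lemma cspan_sum S (I : Type) (s : seq I) (F : I -> R -> R[i]) :
  (forall i, cspan S (F i)) -> cspan S (fun x => \sum_(i <- s) F i x).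
Proof.
move=> mF; elim: s => [|i s IH].
  by under eq_fun do rewrite big_nil; exact: cspan0.
by under eq_fun do rewrite big_cons; exact: cspanD.
Qed.

(** Continuity of the inner product. Only real parts are estimated; the imaginary part is, up to
    sign, the real part for ['i * h]. *)
Lemma cspan_orth S h f : L2 h -> (forall j k, S j k -> inner h (dil_trans psi j k) = 0) ->
  cspan S f -> inner h f = 0.
Proof.
move=> Lh hS [Lf Hf].
have key h' : L2 h' -> (forall j k, S j k -> inner h' (dil_trans psi j k) = 0) -> cRe (inner h' f) = 0.
  move=> Lh' hS'; apply/eqP; rewrite -normr_le0; apply/ler_addgt0Pl => e e0; rewrite addr0.
  set A := fine (sqn h'); have A0 : 0 <= A := fine_sqn_ge0 h'.
  (* This weight makes [t * A] at most [e / 2]; approximating [f] within [t * (e / 2)] bounds the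
     other term of [Re_inner_le] by [e / 2] as well. *)
  pose t := e / (2 * (1 + A)).
  have A1 : 0 < 2 * (1 + A) by lra.
  have t0 : 0 < t by rewrite divr_gt0.
  have d0 : 0 < t * (e / 2) by rewrite mulr_gt0 // divr_gt0.
  have [s [Ss fs]] := Hf _ d0.
  have Ls := lincomb_L2 s; have LL := L2B Lf Ls.
  have hs : inner h' (lincomb psi s) = 0.
    rewrite (innerC Ls Lh') /lincomb inner_suml //; last by move=> u; exact: L2Z.
    rewrite big_seq big1 ?cj0 // => u us; rewrite innerZl // (innerC Lh' (Lpsi _ _)).
    by rewrite hS' ?cj0 ?mulr0 //; exact: Ss.
  have E : inner h' f = inner h' (fun x => f x - lincomb psi s x).
    have -> : (fun x => f x - lincomb psi s x) = (fun x => f x + (-1) * lincomb psi s x).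
      by apply/funext => x; rewrite mulN1r.
    rewrite innerDr //; last exact: L2Z.
    by rewrite innerZr // hs mulr0 addr0.
  rewrite E; apply: le_trans (Re_inner_le Lh' LL t0) _; rewrite -/A.
  have : fine (sqn (fun x => f x - lincomb psi s x)) < t * (e / 2).
    by rewrite -lte_fin -L2_fin.
  set B := fine (sqn (fun x => f x - lincomb psi s x)) => hB.
  have h1 : t * A <= e / 2.
    have : t * (2 * (1 + A)) = e by rewrite /t divfK // gt_eqF.
    by nra.
  have h2 : t^-1 * B <= e / 2 by rewrite ler_pdivrMl // ltW.
  lra.
have h1 := key h Lh hS.
have h2 : cRe (inner (fun x => 'i * h x) f) = 0.
  apply: key; first exact: L2Z.
  by move=> j k Sjk; rewrite innerZl // hS // mulr0.
move: h2; rewrite innerZl // cReM /= mul0r mul1r sub0r => /eqP; rewrite oppr_eq0 => /eqP h2.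
exact: complex_ext.
Qed.

Lemma transl_L2 (t : R) f : L2 f -> L2 (transl t f).
Proof.
move=> /L2E[mf Qf]; apply/L2E.
have E : transl t f = fun x => f (1 * x + - t) by apply/funext => x; rewrite mul1r.
rewrite E; split; first by apply: (cm_comp mf); exact: measurable_affine.
by rewrite sqn_affine // invr1 mul1e.
Qed.

Lemma sqn_transl (t : R) f : cm f -> sqn (transl t f) = sqn f.
Proof.
move=> mf; have E : transl t f = fun x => f (1 * x + - t) by apply/funext => x; rewrite mul1r.
by rewrite E sqn_affine // invr1 mul1e.
Qed.

Lemma cspan_transl S (t : R) f :
  (forall j k, S j k -> cspan S (transl t (dil_trans psi j k))) -> cspan S f -> cspan S (transl t f).
Proof.
move=> H [Lf Hf]; apply: cspan_lim; first exact: transl_L2.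
move=> e e0; have [s [Ss fs]] := Hf e e0.
exists (transl t (lincomb psi s)); split; last first.
  rewrite (_ : (fun x => _) = transl t (fun x => f x - lincomb psi s x)); last exact: erefl.
  by rewrite sqn_transl; [exact: fs|exact: (L2_cm (L2B Lf (lincomb_L2 s)))].
elim: s Ss {fs} => [|u s IH] Ss.
  rewrite (_ : transl _ _ = fun=> 0); first exact: cspan0.
  by apply/funext => x; rewrite /transl /lincomb !big_nil.
rewrite (_ : transl _ _ = fun x => u.2 * transl t (dil_trans psi u.1.1 u.1.2) x + transl t (lincomb psi s) x).
  apply: cspanD; last by apply: IH => v vs; apply: Ss; rewrite inE vs orbT.
  by apply: cspanZ; apply: H; apply: Ss; rewrite inE eqxx.
by apply/funext => x; rewrite /transl /lincomb big_cons.
Qed.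

End ClosedSpan.

(** * Closed spans seen on the frequency side *)

Section FrequencySide.
Variable R : realType.
Local Notation mu := (@lebesgue_measure R).
Implicit Types (f g h p : R -> R[i]) (S : int -> int -> Prop).

Let pi0 : 0 < pi :> R := pi_gt0 R.
Let pi20 : 0 < 2 * pi :> R.
Proof. by rewrite mulr_gt0. Qed.

Variable w : R -> R[i].
Hypothesis bw : bc w.

(** The Fourier transform of [dil_trans (ift w) j k], as [dil_transE] confirms. *)
Definition psi_ft (j k : int) (y : R) : R[i] :=
  ((Num.sqrt ((2 : R) ^ j))^-1)%:C * w (((2 : R) ^ j)^-1 * y) * expi (- (((2 : R) ^ j)^-1 * y * k%:~R)).

Lemma pow2_gt0 (j : int) : 0 < (2 : R) ^ j.
Proof. by rewrite exprz_gt0. Qed.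

Lemma bc_scale (a : R) f : 0 < a -> bc f -> bc (fun x => f (a * x)).
Proof.
move=> a0 bf; have := bc_affine 0 a0 bf.
by under eq_fun do rewrite addr0.
Qed.

Lemma sqn_scale (a : R) f : 0 < a -> cm f -> sqn (fun x => f (a * x)) = (a^-1%:E * sqn f)%E.
Proof.
move=> a0 mf; rewrite -(sqn_affine 0 a0 mf); apply: eq_sqn => x; by rewrite addr0.
Qed.

Lemma ci_scale (a : R) f : 0 < a -> Cint f -> ci (fun x => f (a * x)) = (a^-1)%:C * ci f.
Proof.
move=> a0 mf; rewrite -(ci_affine 0 a0 mf); apply: eq_ci => x; by rewrite addr0.
Qed.

Lemma psi_ft_bc j k : bc (psi_ft j k).
Proof.
have j0 : 0 < ((2 : R) ^ j)^-1 by rewrite invr_gt0 pow2_gt0.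
apply: bcM; first by apply: bcZ; exact: bc_scale.
rewrite (_ : (fun x => _) = fun y => expi (y * - (((2 : R) ^ j)^-1 * k%:~R))); first exact: bm_expiM.
by apply/funext => y; congr expi; ring.
Qed.

Lemma dil_transE j k : dil_trans (ift w) j k = ift (psi_ft j k).
Proof.
apply/funext => x; rewrite /dil_trans /ift.
have s0 := pow2_gt0 j; set s := (2 : R) ^ j in s0 *.
pose G (y : R) : R[i] := w y * expi (y * (s * x - k%:~R)).
have bG : bc G by exact: bc_expi.
have -> : ci (fun y => psi_ft j k y * expi (y * x)) = ((Num.sqrt s)^-1)%:C * (s%:C * ci G).
  have := ci_scale (a := s^-1) (f := G); rewrite invrK invr_gt0 => <- //; last exact: bc_Cint.
  rewrite -ciZ; last first.
    by apply: bc_Cint; apply: bc_scale => //; rewrite invr_gt0.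
  apply: eq_ci => y; rewrite /psi_ft /G -/s -!mulrA; congr (_ * (_ * _)).
  rewrite -expiD; congr expi; field; exact: lt0r_neq0.
have -> : ((Num.sqrt s)^-1)%:C * (s%:C * ci G) = (Num.sqrt s)%:C * ci G.
  rewrite mulrA -rmorphM /=; congr (_%:C * _).
  rewrite -{2}[s]sqr_sqrtr ?(ltW s0) // expr2 mulrA mulVf ?mul1r //.
  by rewrite gt_eqF // sqrtr_gt0.
by rewrite mulrCA.
Qed.

Lemma Lpsi j k : L2 (dil_trans (ift w) j k).
Proof. by rewrite dil_transE; apply: ift_L2; exact: psi_ft_bc. Qed.

Lemma transl_ift (t : R) g : transl t (ift g) = ift (fun y => g y * expi (y * - t)).
Proof.
apply/funext => x; rewrite /transl /ift; congr (_ * _); apply: eq_ci => y.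
by rewrite -mulrA -expiD; congr (_ * expi _); ring.
Qed.

(** Membership of the inverse transform in the closed span. On [bc] functions [ift] is linear and
    multiplies squared norms by [1 / (2 pi)], so limits may be taken on either side. *)
Definition fspan S g : Prop := bc g /\ cspan (ift w) S (ift g).

Lemma fspanD S f g : fspan S f -> fspan S g -> fspan S (fun x => f x + g x).
Proof.
move=> [bf cf] [bg cg]; split; first exact: bcD.
have -> : ift (fun y => f y + g y) = fun x => ift f x + ift g x.
  by apply/funext => x; rewrite iftD.
exact: cspanD Lpsi _ _ _ cf cg.
Qed.

Lemma fspanZ S (z : R[i]) f : fspan S f -> fspan S (fun x => z * f x).
Proof.
move=> [bf cf]; split; first exact: bcZ.
have -> : ift (fun y => z * f y) = fun x => z * ift f x.
  by apply/funext => x; rewrite iftZ.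
exact: cspanZ Lpsi _ _ _ cf.
Qed.

Lemma fspan_sub S S' f : (forall j k, S j k -> S' j k) -> fspan S f -> fspan S' f.
Proof. by move=> H [bf cf]; split => //; exact: cspan_sub cf. Qed.

Lemma fspan_gen S j k : S j k -> fspan S (psi_ft j k).
Proof. by move=> Sjk; split; [exact: psi_ft_bc|rewrite -dil_transE; exact: cspan_gen Lpsi _ _ _ Sjk]. Qed.

Lemma fspan_lim S g : bc g -> (forall e : R, 0 < e ->
  exists h, fspan S h /\ (sqn (fun x => g x - h x)%R < e%:E)%E) -> fspan S g.
Proof.
move=> bg H; split => //; apply: (cspan_lim Lpsi); first exact: ift_L2.
move=> e e0; have e1 : 0 < e * (2 * pi) by rewrite mulr_gt0.
have [h [[bh ch] gh]] := H _ e1; exists (ift h); split => //.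
have bgh := bcB bg bh.
rewrite (_ : (fun x => _) = ift (fun x => g x - h x)); last by apply/funext => x; rewrite iftB.
rewrite sqn_ift //.
move: gh; rewrite (L2_fin (bc_L2 bgh)) -EFinM !lte_fin => gh.
by rewrite mulrC ltr_pdivrMr.
Qed.

Lemma fspan0 S : fspan S (fun=> 0).
Proof.
split; first exact: bc0.
have -> : ift (fun=> 0) = fun=> 0 :> R[i]; last exact: cspan0.
apply/funext => x; rewrite /ift (_ : ci _ = 0) ?mulr0 //.
by rewrite -[RHS](@ci0 R); apply: eq_ci => y; rewrite mul0r.
Qed.

Lemma fspan_sum S (I : Type) (s : seq I) (F : I -> R -> R[i]) :
  (forall i, fspan S (F i)) -> fspan S (fun x => \sum_(i <- s) F i x).
Proof.
move=> bF; split; first by apply: bc_sum => i; case: (bF i).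
have -> : ift (fun y => \sum_(i <- s) F i y) = fun x => \sum_(i <- s) ift (F i) x.
  by apply/funext => x; rewrite ift_sum // => i; case: (bF i).
by apply: (cspan_sum Lpsi) => i; case: (bF i).
Qed.

(** Every [bc] function, cut down to [A], belongs to the span. Such sets are stable under countable
    unions, so completeness reduces to covering the line up to a null set. *)
Definition fullset S (A : set R) : Prop :=
  measurable A /\ forall g, bc g -> fspan S (fun x => g x * cI A x).

Lemma cI_bc g (A : set R) : measurable A -> bc g -> bc (fun x => g x * cI A x).
Proof. by move=> mA bg; apply: bcM => //; exact: cI_bm. Qed.

Lemma fullset0 S : fullset S set0.
Proof.
split; [exact: measurable0|move=> g bg].
rewrite (_ : (fun x => _) = fun=> 0); first exact: fspan0.
by apply/funext => x; rewrite cI_out // mulr0.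
Qed.

Lemma fullsetU S (A B : set R) : fullset S A -> fullset S B -> fullset S (A `|` B).
Proof.
move=> [mA HA] [mB HB]; split; first exact: measurableU.
move=> g bg.
(* [A] and [B] may overlap, so the second summand is first cut down to the complement of [A]. *)
have h1 := HA g bg; have h2 := HB _ (cI_bc (measurableC mA) bg).
have := fspanD h1 h2; rewrite (_ : (fun x => _) = (fun x => g x * cI (A `|` B) x)) //.
apply/funext => x; rewrite cIC.
have [a|a] := pselect (A x).
  have ab : (A `|` B) x by left.
  by rewrite (cI_in a) (cI_in ab) subrr mulr0 mul0r addr0.
rewrite (cI_out a); have [b|b] := pselect (B x).
  have ab : (A `|` B) x by right.
  by rewrite (cI_in b) (cI_in ab) subr0 mulr0 !mulr1 add0r.
by rewrite (cI_out b) cI_out ?mulr0 ?addr0 // => -[].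
Qed.

Lemma fullset_bigcup S (F : nat -> set R) : (forall n, fullset S (F n)) -> fullset S (\bigcup_n F n).
Proof.
move=> DF.
have mU : measurable (\bigcup_n F n) by apply: bigcupT_measurable => n; case: (DF n).
pose B n := \big[setU/set0]_(i < n) F i.
have DB n : fullset S (B n).
  rewrite /B; elim: n => [|n IH]; first by rewrite big_ord0; exact: fullset0.
  by rewrite big_ord_recr /=; exact: fullsetU IH (DF n).
have BU n : B n `<=` \bigcup_n F n.
  by move=> x; rewrite /B -bigcup_mkord => -[k _ Fk]; exists k.
split => // g bg; apply: fspan_lim; first exact: cI_bc.
move=> e e0.
have [||||N _ /(_ N (leqnn N)) HN] := @sqn_dct R
  (fun n x => g x * cI (\bigcup_n F n) x - g x * cI (B n) x) (fun x => cnorm2 (g x)) _ _ _ _ e e0.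
- move=> n; apply: cmB; first by case: (cI_bc mU bg).
  by case: (DB n) => mB _; case: (cI_bc mB bg).
- exact: L2_int (bc_L2 bg).
- move=> n x; rewrite -mulrBr cnorm2M -[leRHS]mulr1 ler_wpM2l ?cnorm2_ge0 //.
  have [u|u] := pselect ((\bigcup_n F n) x).
    have [b|b] := pselect (B n x).
      by rewrite !cI_in // subrr cnorm2_0.
    by rewrite (cI_in u) (cI_out b) subr0 -[1]/(1%:C) cnorm2_real expr1n.
  by rewrite (cI_out u) cI_out ?subrr ?cnorm2_0 // => /BU.
- move=> x; apply: cvg_near_cst.
  have [[k _ Fk]|u] := pselect ((\bigcup_n F n) x).
    exists k.+1 => // n /= kn.
    have Bn : B n x by rewrite /B -bigcup_mkord; exists k.
    by rewrite (cI_in Bn) cI_in ?subrr ?cnorm2_0 //; exists k.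
  apply: nearW => n.
  by rewrite (cI_out u) cI_out ?subrr ?cnorm2_0 // => /BU.
exists (fun x => g x * cI (B N) x); split => //.
by case: (DB N) => _; apply.
Qed.

Lemma sqn_point f (r : R) : (forall x, x != r -> f x = 0) -> sqn f = 0%E.
Proof.
move=> f0; rewrite /sqn.
transitivity (\int[mu]_(x in [set r]) (cnorm2 (f x))%:E)%E; last exact: integral_set1.
rewrite [RHS]integral_mkcond; apply: eq_integral => x _; rewrite patchE.
case: ifPn => // xr; rewrite f0 ?cnorm2_0 //.
by apply: contra xr => /eqP ->; rewrite inE.
Qed.

(** The origin is exempt because dyadic dilates of a set that avoids 0 never contain it. *)
Lemma fullset_full S (A : set R) g : fullset S A -> (forall x, x != 0 -> A x) -> bc g -> fspan S g.
Proof.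
move=> [mA HA] A0 bg; apply: fspan_lim => // e e0.
exists (fun x => g x * cI A x); split; first exact: HA.
rewrite (@sqn_point _ 0) ?lte_fin // => x x0.
by rewrite cI_in ?mulr1 ?subrr //; exact: A0.
Qed.

Lemma fspan_complete : (forall g, bc g -> fspan (fun _ _ => True) g) ->
  forall f, L2 f -> in_closed_span (fun _ _ => True) (ift w) f.
Proof.
move=> H f Lf; apply/(cspanP Lpsi); apply: (cspan_lim Lpsi) => // e e0.
have [g [bg fg]] := ift_dense Lf e0; exists (ift g); split => //.
by case: (H g bg).
Qed.

(* Up to dilation by [2 ^ l], the Fourier transforms of the closed span of the
   level [l] wavelets: limits of [p * w] with [p] a trigonometric polynomial. *)
Definition level0 f : Prop := bc f /\ forall e : R, 0 < e ->
  exists s : seq (int * R[i]),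
    (sqn (fun x => f x - (\sum_(t <- s) t.2 * expi (- (x * t.1%:~R))) * w x)%R < e%:E)%E.

Lemma level0_fspan f (l : int) : level0 f -> fspan (fun j _ => j = l) (fun y => f (((2 : R) ^ l)^-1 * y)).
Proof.
move=> [bf H]; have l0 := pow2_gt0 l; set a := (2 : R) ^ l in l0 *.
have a0 : 0 < a^-1 by rewrite invr_gt0.
apply: fspan_lim; first exact: bc_scale.
move=> e e0; have e1 : 0 < e / a by rewrite divr_gt0.
have [s hs] := H _ e1.
(* The factor [sqrt a] cancels the normalisation in [psi_ft]. *)
exists (fun y => \sum_(t <- s) (t.2 * (Num.sqrt a)%:C) * psi_ft l t.1 y); split.
  by apply: fspan_sum => t; apply: fspanZ; exact: fspan_gen.
pose F0 x := f x - (\sum_(t <- s) t.2 * expi (- (x * t.1%:~R))) * w x.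
have bt : bc F0.
  apply: bcB => //; apply: bcMl => //; apply: bm_sum => t; apply: bmM; first exact: bm_cst.
  have := bm_expiM (- (t.1%:~R : R)); by under eq_fun do rewrite mulrN.
rewrite (_ : (fun y => _) = (fun y => F0 (a^-1 * y))); last first.
  apply/funext => y; congr (_ - _); rewrite mulr_suml; apply: eq_bigr => t _.
  have sq : (Num.sqrt a)%:C * ((Num.sqrt a)^-1)%:C = 1 :> R[i].
    by rewrite -rmorphM mulfV // gt_eqF // sqrtr_gt0.
  transitivity ((Num.sqrt a)%:C * ((Num.sqrt a)^-1)%:C * (t.2 * expi (- (a^-1 * y * t.1%:~R)) * w (a^-1 * y))).
    by rewrite /psi_ft -/a; ring.
  by rewrite sq mul1r.
rewrite (sqn_scale a0 bt.1).
move: hs; rewrite -/F0 (L2_fin (bc_L2 bt)) invrK -EFinM !lte_fin => hs.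
by rewrite mulrC -ltr_pdivlMr.
Qed.

End FrequencySide.

(** * Geometry of the support and a criterion for level 0 *)

Section Pieces.
Variable R : realType.
Implicit Types (f g h p : R -> R[i]).

Let pi0 : 0 < pi :> R := pi_gt0 R.

Variable n : nat.
Hypothesis n3 : (3 <= n)%N.

Let a : R := a_n R n.
Let e : R := e_n R n.
Let P : R := 2 ^+ n.-1 * pi.
Let r : R := 1 / Num.sqrt 2.

Let M_ge4 : 4 <= (2 : R) ^+ n.-1.
Proof.
have -> : 4 = 2 ^+ 2 :> R by rewrite expr2; ring.
rewrite ler_eXn2l ?ltr1n //; lia.
Qed.

Let twoM : (2 : R) ^+ n = 2 * 2 ^+ n.-1.
Proof. by rewrite -exprS prednK //; lia. Qed.

Let Mden : 2 * (2 : R) ^+ n.-1 - 1 != 0.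
Proof. by rewrite gt_eqF //; have := M_ge4; lra. Qed.

(** The relation that determines [a]; with it every endpoint of the support becomes linear in [a],
    [P] and [pi], within reach of [lra]. *)
Lemma a_nE : (2 * 2 ^+ n.-1 - 1) * a = P.
Proof. rewrite /a /a_n /P twoM; field; exact: Mden. Qed.

Lemma b_nE : b_n R n = 2 * a.
Proof. rewrite /a /a_n /b_n twoM; field; exact: Mden. Qed.

Lemma e_nE : e = 2 * pi - 2 * a.
Proof. rewrite /a /a_n /e /e_n twoM; field; exact: Mden. Qed.

Lemma c_nE : c_n R n = P - a.
Proof. rewrite /a /a_n /c_n /P twoM; field; exact: Mden. Qed.

Lemma d_nE : d_n R n = P + a.
Proof.
have E : (2 : R) ^+ (2 * n).-1 = 2 * 2 ^+ n.-1 * 2 ^+ n.-1.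
  by rewrite -twoM -exprD; congr (_ ^+ _); lia.
rewrite /a /a_n /d_n /P E twoM; field; exact: Mden.
Qed.

(** Left end of the identity [P - a, P + a) = 2^(n-1) [e, 2 a), with [d_dyadic] the right end. The
    vanishing of w(y) w(2^q y) for q >= 2 and the dyadic cover of the positive half line both rest
    on it. *)
Lemma c_dyadic : P - a = 2 ^+ n.-1 * e.
Proof. by rewrite e_nE mulrBr /P; have := a_nE; rewrite /P; lra. Qed.

Lemma d_dyadic : P + a = 2 ^+ n.-1 * (2 * a).
Proof. by have := a_nE; rewrite /P; lra. Qed.

(** Equivalent to [e < 2 a]. *)
Lemma a_gt : pi / 2 < a.
Proof.
have p0 : 0 < pi :> R := pi_gt0 R.
have := a_nE; have := M_ge4; rewrite /P; set M := 2 ^+ n.-1 => M4 H.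
rewrite ltNge; apply/negP => h.
have h2 : (2 * M - 1) * a <= (2 * M - 1) * (pi / 2) by rewrite ler_wpM2l //; lra.
by rewrite H in h2; lra.
Qed.

(** The constant is the value of [a] at [n = 3], the largest one; it yields [a < e]. *)
Lemma a_le : a <= 4 / 7 * pi.
Proof.
have p0 : 0 < pi :> R := pi_gt0 R.
have := a_nE; have := M_ge4; rewrite /P; set M := 2 ^+ n.-1 => M4 H.
rewrite leNgt; apply/negP => h.
have h2 : (2 * M - 1) * (4 / 7 * pi) < (2 * M - 1) * a by rewrite ltr_pM2l //; lra.
have h3 : 4 * pi <= M * pi by rewrite ler_pM2r.
by rewrite H in h2; lra.
Qed.

Lemma P_ge : 4 * pi <= P.
Proof. by rewrite /P ler_pM2r // M_ge4. Qed.

(** This is why a shift by [P] leaves exponentials of integer frequency unchanged. *)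
Lemma P_2piz : P = 2 * pi * ((2 ^ n.-2)%N%:Z)%:~R.
Proof.
rewrite -[X in _ * X]/((2 ^ n.-2)%N%:R) natrX /P.
have -> : n.-1 = (n.-2).+1 by lia.
by rewrite exprS; ring.
Qed.

Lemma r_sqr : r ^+ 2 = 2^-1.
Proof. by rewrite /r expr_div_n expr1n sqr_sqrtr // mul1r. Qed.

Lemma r_gt0 : 0 < r.
Proof. by rewrite /r divr_gt0 // sqrtr_gt0. Qed.

(* A piece (lo, hi, tau, v): on [lo + tau, hi + tau) the function equals v;
   tau is a multiple of 2 pi. The intervals [lo, hi) cover [- a, 2 pi - a) with the
   squares of the values v adding up to 1 at each point. *)
Definition piece := (R * R * R * R)%type.

(** Listed from left to right on the support, that is by [lo + tau], so that disjointness is read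
    off from inequalities between entries. Two pieces lie over each of the cells [a/2, e/2) and [a,
    e). *)
Definition pieces : seq piece :=
  [:: (e, e + a, - (2 * pi), 1); (a / 2, e / 2, 0, r); (a, e, 0, r);
      (- a, a / 2, P, 1); (a / 2, e / 2, P, r); (e / 2, a, P, 1); (a, e, 2 * P, - r)].

Definition in_piece (t : piece) (y : R) : bool := t.1.1.1 <= y < t.1.1.2.

Definition piece_ind (t : piece) (y : R) : R[i] := (in_piece t y)%:R.

(** Half-open version of [psihat]; the two can differ only at the finitely many endpoints. *)
Definition psihatC (y : R) : R[i] := \sum_(t <- pieces) (t.2)%:C * piece_ind t (y - t.1.2).

Lemma piece_indE t y : piece_ind t y = cI `[t.1.1.1, t.1.1.2[%classic y.
Proof.
rewrite /piece_ind /in_piece /cI indicE mem_setE in_itv /=.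
by case: (_ && _); rewrite ?rmorph1 ?rmorph0.
Qed.

Lemma piece_ind_bm t : bm (piece_ind t).
Proof.
rewrite (_ : piece_ind t = cI `[t.1.1.1, t.1.1.2[%classic).
  by apply: cI_bm; exact: measurable_itv.
by apply/funext => y; rewrite piece_indE.
Qed.

Let consts : [/\ 0 < pi :> R, pi / 2 < a, a <= 4 / 7 * pi, e = 2 * pi - 2 * a & 4 * pi <= P].
Proof. by split; [exact: pi0|exact: a_gt|exact: a_le|exact: e_nE|exact: P_ge]. Qed.

Lemma disj_sum (T : eqType) (s : seq T) (lo hi : T -> R) (y : R) (t0 : T) (F : T -> R[i]) :
  pairwise (fun t t' => hi t <= lo t') s -> t0 \in s -> lo t0 <= y < hi t0 ->
  \sum_(t <- s) F t * (lo t <= y < hi t)%R%:R = F t0.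
Proof.
elim: s => // t s IH /= /andP[/allP ts ps]; rewrite inE big_cons => /orP[/eqP ->|t0s] yt.
  rewrite yt mulr1 big_seq big1 ?addr0 // => u us.
  have h := ts _ us; case/andP: yt => _ yt.
  by rewrite leNgt (lt_le_trans yt h) /= mulr0.
rewrite IH // (_ : (_ <= y < _) = false) ?mulr0 ?add0r //.
apply/negbTE/negP => /andP[_ yt']; case/andP: yt => yt _.
by have := lt_le_trans yt' (le_trans (ts _ t0s) yt); rewrite ltxx.
Qed.

Lemma piece_ind_shiftE t y : piece_ind t (y - t.1.2) = (t.1.1.1 + t.1.2 <= y < t.1.1.2 + t.1.2)%R%:R.
Proof. by rewrite /piece_ind /in_piece lerBrDr ltrBlDr. Qed.

Lemma pieces_disjoint : pairwise (fun t t' : piece => t.1.1.2 + t.1.2 <= t'.1.1.1 + t'.1.2) pieces.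
Proof.
have [p0 ha1 ha2 he hP] := consts.
by rewrite /pieces /= !andbT; do !(apply/andP; split); lra.
Qed.

Lemma pieces_sum (y : R) (t0 : piece) (F : piece -> R[i]) : t0 \in pieces -> in_piece t0 (y - t0.1.2) ->
  \sum_(t <- pieces) F t * piece_ind t (y - t.1.2) = F t0.
Proof.
move=> trigpoly ty; under eq_bigr do rewrite piece_ind_shiftE.
apply: (@disj_sum _ pieces (fun t => t.1.1.1 + t.1.2) (fun t => t.1.1.2 + t.1.2)) => //.
  exact: pieces_disjoint.
by move: ty; rewrite /in_piece lerBrDr ltrBlDr.
Qed.

(** The quantifier over [F] inside the first case lets one case distinction serve [psihatC], [chi]
    and sums of squares alike. *)
Lemma piecesP (y : R) : (forall F : piece -> R[i], \sum_(t <- pieces) F t * piece_ind t (y - t.1.2) = 0) \/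
  exists2 t0, t0 \in pieces & in_piece t0 (y - t0.1.2).
Proof.
have [|/hasPn h] := boolP (has (fun t => in_piece t (y - t.1.2)) pieces).
  by move=> /hasP[t0 t0p ty]; right; exists t0.
left => F; rewrite big_seq big1 // => t trigpoly.
by rewrite /piece_ind (negbTE (h t trigpoly)) mulr0.
Qed.

(** Indicator of the support of [psihatC], written over the same pieces so that the two sums can be
    merged termwise. *)
Definition chi (y : R) : R[i] := \sum_(t <- pieces) 1 * piece_ind t (y - t.1.2).

Lemma chi_in (y : R) t0 : t0 \in pieces -> in_piece t0 (y - t0.1.2) -> chi y = 1.
Proof. by move=> h1 h2; rewrite /chi (pieces_sum (fun=> 1) h1 h2). Qed.

Lemma psihatC_in (y : R) t0 : t0 \in pieces -> in_piece t0 (y - t0.1.2) -> psihatC y = (t0.2)%:C.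
Proof. by move=> h1 h2; rewrite /psihatC (pieces_sum (fun t => (t.2)%:C) h1 h2). Qed.

Lemma bm_itv_bc f (u v : R) : bm f -> bc (fun y => f y * cI `[u, v[%classic y).
Proof.
move=> bf; apply: (@bm_cI_bc _ _ _ (`|u| + `|v|) bf (measurable_itv _)).
move=> x /=; rewrite !in_itv /= => /andP[cx xT].
have := ler_norm u; have := ler_norm v; have := ler_norm (- u).
have := ler_norm (- v); rewrite !normrN => *.
by have := normr_ge0 u; have := normr_ge0 v; lra.
Qed.

Lemma psihatC_bc : bc psihatC.
Proof.
apply: bc_sum => t; apply: bcZ.
rewrite (_ : (fun y => _) = fun y => 1 * cI `[t.1.1.1 + t.1.2, t.1.1.2 + t.1.2[%classic y).
  exact: bm_itv_bc (bm_cst _).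
apply/funext => y; rewrite mul1r piece_ind_shiftE /cI indicE mem_setE in_itv /=.
by case: (_ && _); rewrite ?rmorph1 ?rmorph0.
Qed.

Lemma sqn_sum_lt (T : eqType) (s : seq T) (F : T -> R -> R[i]) (d : R) : 0 < d ->
  (forall t, cm (F t)) -> (forall t, t \in s -> (sqn (F t) < d%:E)%E) ->
  (sqn (fun y => \sum_(t <- s) F t y)%R < (4 ^+ size s * d)%:E)%E.
Proof.
move=> d0 mF; elim: s => [|t s IH] Fd.
  rewrite /sqn; under eq_integral do rewrite big_nil cnorm2_0.
  by rewrite integral0 mul1r lte_fin.
under eq_fun do rewrite big_cons.
apply: sqn_lt_D; [exact: mF|exact: cm_sum| |].
  apply: lt_le_trans (Fd t _) _; first by rewrite inE eqxx.
  have -> : 4 ^+ (size (t :: s)) * d / 4 = 4 ^+ size s * d by rewrite /= exprS; field.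
  by rewrite lee_fin ler_peMl ?(ltW d0) // exprn_ege1 // ler1n.
have -> : 4 ^+ (size (t :: s)) * d / 4 = 4 ^+ size s * d by rewrite /= exprS; field.
apply: IH => u us.
by apply: Fd; rewrite inE us orbT.
Qed.

(** One piece for each cell of the base period, ordered by [lo]. Over the two doubly covered cells
    the piece with [tau = 0] is chosen. *)
Definition tiles : seq piece :=
  [:: (- a, a / 2, P, 1); (a / 2, e / 2, 0, r); (e / 2, a, P, 1); (a, e, 0, r);
      (e, e + a, - (2 * pi), 1)].

Lemma tiles_disjoint : pairwise (fun t t' : piece => t.1.1.2 <= t'.1.1.1) tiles.
Proof.
have [p0 ha1 ha2 he hP] := consts.
by rewrite /tiles /= !andbT; do !(apply/andP; split); lra.
Qed.

Lemma tiles_sum (y : R) (t0 : piece) (F : piece -> R[i]) : t0 \in tiles -> in_piece t0 y ->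
  \sum_(t <- tiles) F t * piece_ind t y = F t0.
Proof.
move=> trigpoly ty.
exact: (@disj_sum _ tiles (fun t => t.1.1.1) (fun t => t.1.1.2) y t0 F tiles_disjoint trigpoly ty).
Qed.

Lemma expi_P (k : int) (y : R) : expi ((y + P) * k%:~R) = expi (y * k%:~R).
Proof.
rewrite mulrDl P_2piz -mulrA -intrM; exact: expi_period.
Qed.

Lemma expi_tau t (k : int) (y : R) : t \in pieces ->
  expi ((y + t.1.2) * k%:~R) = expi (y * k%:~R).
Proof.
have E2 : expi ((y + 2 * P) * k%:~R) = expi (y * k%:~R).
  rewrite (_ : y + 2 * P = y + P + P); last by ring.
  by rewrite !expi_P.
have E1 : expi ((y + - (2 * pi)) * k%:~R) = expi (y * k%:~R).
  rewrite mulrDl (_ : - (2 * pi) * k%:~R = 2 * pi * (- k)%:~R); first exact: expi_period.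
  by rewrite intrN; ring.
have E0 : expi ((y + 0) * k%:~R) = expi (y * k%:~R) by rewrite addr0.
rewrite /pieces !inE => /orP[/eqP ->|/orP[/eqP ->|/orP[/eqP ->|/orP[/eqP ->|/orP[/eqP ->|/orP[/eqP ->|/eqP ->]]]]]] //=;
  exact: expi_P.
Qed.

Lemma piece_tile t y : t \in pieces -> in_piece t y -> y \in `[(- a), (- a + 2 * pi)[.
Proof.
have [p0 ha1 ha2 he hP] := consts.
rewrite in_itv /= /pieces /in_piece !inE => /orP[/eqP ->|/orP[/eqP ->|/orP[/eqP ->|/orP[/eqP ->|/orP[/eqP ->|/orP[/eqP ->|/eqP ->]]]]]] /= /andP[h1 h2];
  apply/andP; split; lra.
Qed.

Lemma piece_val t : t \in pieces -> t.2 ^+ 2 <= 1.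
Proof.
have := r_sqr => rr.
rewrite /pieces !inE => /orP[/eqP ->|/orP[/eqP ->|/orP[/eqP ->|/orP[/eqP ->|/orP[/eqP ->|/orP[/eqP ->|/eqP ->]]]]]] /=;
  rewrite ?sqrrN ?expr1n ?rr //; lra.
Qed.

(** The quotient of [f] by [psihatC], moved to the base period, is a bounded function [M]: the two
    relations say that both pieces over a doubly covered cell give the same quotient. A
    trigonometric polynomial close to [M] on that period is unchanged by the shifts [tau], so its
    product with [psihatC] is close to [f]. *)
Lemma level0_intro f : bc f -> (forall y, f y = f y * chi y) ->
  (forall y, a / 2 <= y < e / 2 -> f (y + P) = f y) ->
  (forall y, a <= y < e -> f (y + 2 * P) = - f y) -> level0 psihatC f.
Proof.
move=> bf fchi f1 f2; split => // d d0.
have [p0 ha1 ha2 he hP] := consts.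
pose M y : R[i] := \sum_(t <- tiles) ((t.2^-1)%:C * f (y + t.1.2)) * piece_ind t y.
have bM : bm M.
  apply: bm_sum => t; apply: bmM; last exact: piece_ind_bm.
  apply: bmM; first exact: bm_cst.
  by apply: (bm_comp (bc_bm bf)); exact: measurable_funD.
have r0 : r != 0 by rewrite gt_eqF // r_gt0.
have rr : (r%:C * (r^-1)%:C = 1 :> R[i])%R by rewrite -rmorphM mulfV.
(* This covers all seven pieces. The two that [tiles] omits are the places where [f1] and [f2]
   enter. *)
have HM t y : t \in pieces -> in_piece t y -> (t.2)%:C * M y = f (y + t.1.2).
  rewrite /pieces !inE => /orP[/eqP ->|/orP[/eqP ->|/orP[/eqP ->|/orP[/eqP ->|/orP[/eqP ->|/orP[/eqP ->|/eqP ->]]]]]] /= hy.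
  - rewrite /M (@tiles_sum y (e, e + a, - (2 * pi), 1)) ?inE ?eqxx ?orbT //=.
    by rewrite invr1 !mul1r.
  - rewrite /M (@tiles_sum y (a / 2, e / 2, 0, r)) ?inE ?eqxx ?orbT //=.
    by rewrite mulrA rr mul1r.
  - rewrite /M (@tiles_sum y (a, e, 0, r)) ?inE ?eqxx ?orbT //=.
    by rewrite mulrA rr mul1r.
  - rewrite /M (@tiles_sum y (- a, a / 2, P, 1)) ?inE ?eqxx ?orbT //=.
    by rewrite invr1 !mul1r.
  - rewrite /M (@tiles_sum y (a / 2, e / 2, 0, r)) ?inE ?eqxx ?orbT //=.
    by rewrite mulrA rr mul1r addr0 f1.
  - rewrite /M (@tiles_sum y (e / 2, a, P, 1)) ?inE ?eqxx ?orbT //=.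
    by rewrite invr1 !mul1r.
  - rewrite /M (@tiles_sum y (a, e, 0, r)) ?inE ?eqxx ?orbT //=.
    by rewrite rmorphN mulNr mulrA rr mul1r addr0 f2.
have pi2 : 0 < 2 * pi :> R by rewrite mulr_gt0.
(* Seven pieces, each addition costing a factor 4 in [sqn_sum_lt]. *)
have d1 : 0 < d / 4 ^+ 7 by rewrite divr_gt0 // exprn_gt0.
have [s hs] := @trig_dense R (2 * pi) (- a) pi2 M _ bM d1.
(* Integer translates carry [expi (- (x * k))] and trigonometric polynomials [expi (x * k)], hence
   the sign. *)
exists [seq (- t.1, t.2) | t <- s].
pose p x := \sum_(t <- s) t.2 * expi (x * t.1%:~R).
have pE x : \sum_(t <- [seq (- t.1, t.2) | t <- s]) t.2 * expi (- (x * t.1%:~R)) = p x.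
  rewrite big_map; apply: eq_bigr => t _ /=.
  by rewrite intrN mulrN opprK.
have ptE x : trigpoly (2 * pi) s x = p x.
  apply: eq_bigr => t _; congr (_ * expi (_ * _)).
  by rewrite mulrAC divff ?mul1r // gt_eqF.
have bp : bm p.
  by apply: bm_sum => t; apply: bmM; [exact: bm_cst|exact: bm_expiM].
have ptau t x : t \in pieces -> p (x + t.1.2) = p x.
  by move=> tin; apply: eq_bigr => u _; rewrite expi_tau.
pose H t y := (M y - p y) * piece_ind t y.
have mH t : cm (H t).
  by apply: cmM; [apply: cmB; [case: bM|case: bp]|case: (piece_ind_bm t)].
have -> : (fun x => f x - (\sum_(t <- [seq (- t.1, t.2) | t <- s]) t.2 * expi (- (x * t.1%:~R))) * psihatC x) =
    (fun x => \sum_(t <- pieces) (t.2)%:C * H t (x - t.1.2)).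
  apply/funext => x; rewrite pE.
  have -> : f x - p x * psihatC x = \sum_(t <- pieces) (f x - p x * (t.2)%:C) * piece_ind t (x - t.1.2).
    rewrite [in LHS]fchi /chi /psihatC !mulr_sumr -sumrB; apply: eq_bigr => t _; ring.
  rewrite big_seq [RHS]big_seq; apply: eq_bigr => t tin; rewrite /H.
  have [h|h] := boolP (in_piece t (x - t.1.2)); last by rewrite /piece_ind (negbTE h) !mulr0.
  rewrite mulrA mulrBr HM // subrK; congr (_ * _); congr (_ - _).
  by rewrite -(ptau t (x - t.1.2) tin) subrK mulrC.
rewrite (_ : d = 4 ^+ size pieces * (d / 4 ^+ 7)); last first.
  by rewrite /= mulrC divfK // expf_neq0.
apply: (sqn_sum_lt d1).
  move=> t; apply: cmM; first exact: cm_cst.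
  by apply: (cm_comp (mH t)); exact: measurable_funB.
move=> t tin.
have mHt : cm (fun y => H t (y - t.1.2)).
  by apply: (cm_comp (mH t)); exact: measurable_funB.
rewrite sqn_Z // cnorm2_real.
apply: (@le_lt_trans _ _ (1%:E * sqn (fun y => H t (y - t.1.2)%R))%E).
  by apply: lee_wpmul2r; [exact: sqn_ge0|rewrite lee_fin piece_val].
rewrite mul1e.
have -> : sqn (fun y => H t (y - t.1.2)) = sqn (H t).
  rewrite (_ : (fun y => _) = fun y => H t (1 * y + - t.1.2)).
    by rewrite sqn_affine // invr1 mul1e.
  by apply/funext => y; rewrite mul1r.
apply: le_lt_trans hs; apply: sqn_le1 => //.
  apply: cmM; last by case: (cI_bm (measurable_itv `[- a, (- a + 2 * pi)%R[)).
  apply: cmB; first by case: bM.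
  rewrite (_ : trigpoly (2 * pi) s = p); first by case: bp.
  exact/funext.
move=> y; rewrite /H ptE !cnorm2M ler_wpM2l ?cnorm2_ge0 //.
have [h|h] := boolP (in_piece t y); last first.
  by rewrite /piece_ind (negbTE h) cnorm2_0 cnorm2_ge0.
rewrite cI_in; last exact: piece_tile tin h.
by rewrite /piece_ind h.
Qed.

End Pieces.

(** * Inner products across levels *)

Section InnerEf.
Variable R : realType.
Variable w : R -> R[i].
Hypothesis bw : bc w.

(** Substituting [2^(j + q) y] for [y] shows that orthonormality depends only on the products
    [w y * w (2^q y)]. *)
Lemma inner_psi_ft (j k k' : int) (q : nat) : (forall y, cj (w y) = w y) ->
  inner (psi_ft w (j + q%:Z) k) (psi_ft w j k') =
  ((Num.sqrt ((2 : R) ^ (j + q%:Z)))^-1 * (Num.sqrt ((2 : R) ^ j))^-1 * (2 : R) ^ (j + q%:Z))%:C *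
  ci (fun y => w y * w (2 ^+ q * y) * expi (y * ((2 ^ q)%N%:Z * k' - k)%:~R)).
Proof.
move=> rw; rewrite innerE /psi_ft.
have s'0 : (2 : R) ^ j = (2 ^ (j + q%:Z)) / 2 ^+ q.
  by rewrite expfzDr ?pnatr_eq0 // mulfK // expf_neq0 ?pnatr_eq0.
have s0 := pow2_gt0 R (j + q%:Z).
move: s0 s'0; set s := (2 : R) ^ (j + q%:Z); set s' := (2 : R) ^ j => s0 s'E.
have q0 : (2 : R) ^+ q != 0 by rewrite expf_neq0 ?pnatr_eq0.
have s'V : s'^-1 = 2 ^+ q * s^-1 by rewrite s'E invf_div.
pose H y := w y * w (2 ^+ q * y) * expi (y * ((2 ^ q)%N%:Z * k' - k)%:~R).
have bH : bc H.
  apply: bcM; last exact: bm_expiM.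
  by apply: bcM => //; apply: bc_bm; apply: bc_scale => //; rewrite exprn_gt0.
have sV0 : 0 < s^-1 by rewrite invr_gt0.
have := ci_scale sV0 (bc_Cint bH); rewrite invrK -/H => E.
rewrite rmorphM /= -mulrA -E -ciZ; last exact/bc_Cint/bc_scale.
apply: eq_ci => y; rewrite !cjM cj_real rw expiJ opprK s'V /H.
have -> : expi (s^-1 * y * ((2 ^ q)%N%:Z * k' - k)%:~R) =
    expi (- (s^-1 * y * k%:~R)) * expi (2 ^+ q * s^-1 * y * k'%:~R).
  rewrite -expiD; congr expi; rewrite intrB intrM -[X in X * _%:~R]/((2 ^ q)%N%:R) natrX; ring.
rewrite (_ : 2 ^+ q * (s^-1 * y) = 2 ^+ q * s^-1 * y); last by rewrite mulrA.
by rewrite rmorphM /=; ring.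
Qed.

End InnerEf.

(** * Orthonormality of the wavelet system *)

Section Wavelet.
Variable R : realType.
Local Notation mu := (@lebesgue_measure R).
Implicit Types (f g h p : R -> R[i]).

Variable n : nat.
Hypothesis n3 : (3 <= n)%N.

Let a : R := a_n R n.
Let e : R := e_n R n.
Let P : R := 2 ^+ n.-1 * pi.
Let r : R := 1 / Num.sqrt 2.
Local Notation psihatC := (@psihatC R n).
Local Notation pieces := (@pieces R n).

Let consts : [/\ 0 < pi :> R, pi / 2 < a, a <= 4 / 7 * pi, e = 2 * pi - 2 * a & 4 * pi <= P].
Proof.
by split; [exact: pi_gt0|exact: a_gt|exact: a_le|exact: e_nE|exact: P_ge].
Qed.

Lemma pieces_case (Pr : piece R -> Prop) :
  Pr (e, e + a, - (2 * pi), 1) -> Pr (a / 2, e / 2, 0, r) -> Pr (a, e, 0, r) ->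
  Pr (- a, a / 2, P, 1) -> Pr (a / 2, e / 2, P, r) -> Pr (e / 2, a, P, 1) ->
  Pr (a, e, 2 * P, - r) -> forall t, t \in pieces -> Pr t.
Proof.
move=> h1 h2 h3 h4 h5 h6 h7 t; rewrite !inE.
by do ![move=> /orP[/eqP ->|] //]; move=> /eqP ->.
Qed.

Lemma piece1_mem : (e, e + a, - (2 * pi), 1) \in pieces. Proof. by rewrite !inE eqxx ?orbT. Qed.
Lemma piece2_mem : (a / 2, e / 2, 0, r) \in pieces. Proof. by rewrite !inE eqxx ?orbT. Qed.
Lemma piece3_mem : (a, e, 0, r) \in pieces. Proof. by rewrite !inE eqxx ?orbT. Qed.
Lemma piece4_mem : (- a, a / 2, P, 1) \in pieces. Proof. by rewrite !inE eqxx ?orbT. Qed.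
Lemma piece5_mem : (a / 2, e / 2, P, r) \in pieces. Proof. by rewrite !inE eqxx ?orbT. Qed.
Lemma piece6_mem : (e / 2, a, P, 1) \in pieces. Proof. by rewrite !inE eqxx ?orbT. Qed.
Lemma piece7_mem : (a, e, 2 * P, - r) \in pieces. Proof. by rewrite !inE eqxx ?orbT. Qed.

Lemma psihatC_out y : (forall t, t \in pieces -> ~~ in_piece t (y - t.1.2)) -> psihatC y = 0.
Proof.
move=> H; rewrite /psihatC big_seq big1 // => t trigpoly.
by rewrite /piece_ind (negbTE (H t trigpoly)) mulr0.
Qed.

Definition endpoints : set R :=
  [set` [seq t.1.1.1 + t.1.2 | t <- pieces] ++ [seq t.1.1.2 + t.1.2 | t <- pieces]].

Lemma psihat_psihatC y : ~ endpoints y -> psihatC y = (psihat n y)%:C.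
Proof.
have [p0 ha1 ha2 he hP] := consts.
move=> Ny; have N (t : piece R) : t \in pieces -> (y != t.1.1.1 + t.1.2) /\ (y != t.1.1.2 + t.1.2).
  move=> tin; split; apply/eqP => yE; apply: Ny; rewrite /endpoints /mkset mem_cat yE.
    by apply/orP; left; apply: (map_f (fun t : piece R => t.1.1.1 + t.1.2)).
  by apply/orP; right; apply: (map_f (fun t : piece R => t.1.1.2 + t.1.2)).
have K (t : piece R) u v : t \in pieces -> u = t.1.1.1 + t.1.2 -> v = t.1.1.2 + t.1.2 ->
    (y \in `[u, v]) = in_piece t (y - t.1.2).
  move=> /N[h1 h2] -> ->; rewrite in_itv /= /in_piece lerBrDr ltrBlDr.
  by rewrite [_ < _]lt_neqAle h2.
have twoM : (2 : R) ^+ n = 2 * 2 ^+ n.-1 by rewrite -exprS prednK //; lia.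
rewrite /psihat (b_nE R n3) (c_nE R n3) (d_nE R n3) -/a -/e -/P -/r.
have -> := K _ (- (2 * a)) (- a) piece1_mem; [|rewrite /=; lra|rewrite /=; lra].
have -> := K _ (P - a) (a / 2 + P) piece4_mem; [|rewrite /=; lra|rewrite /=; lra].
have -> := K _ (e / 2 + P) (P + a) piece6_mem; [|rewrite /=; lra|rewrite /=; lra].
have -> := K _ (a / 2) (e / 2) piece2_mem; [|rewrite /=; lra|rewrite /=; lra].
have -> := K _ a e piece3_mem; [|rewrite /=; lra|rewrite /=; lra].
have -> := K _ (a / 2 + P) (e / 2 + P) piece5_mem; [|rewrite /=; lra|rewrite /=; lra].
have -> := K _ (a + 2 ^+ n * pi) (e + 2 ^+ n * pi) piece7_mem; [|rewrite /= twoM /P; ring|rewrite /= twoM /P; ring].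
case: ifPn => [/orP[/orP[]|] h|].
- by rewrite (psihatC_in n3 piece1_mem h).
- by rewrite (psihatC_in n3 piece4_mem h).
- by rewrite (psihatC_in n3 piece6_mem h).
rewrite !negb_or => /andP[/andP[h1 h4] h6].
case: ifPn => [/orP[/orP[]|] h|].
- by rewrite (psihatC_in n3 piece2_mem h).
- by rewrite (psihatC_in n3 piece3_mem h).
- by rewrite (psihatC_in n3 piece5_mem h).
rewrite !negb_or => /andP[/andP[h2 h3] h5].
case: ifPn => [h|h7].
  by rewrite (psihatC_in n3 piece7_mem h).
by rewrite psihatC_out //; apply: pieces_case.
Qed.

Lemma measurable_psihat : measurable_fun setT (@psihat R n).
Proof.
have mI (u v : R) : measurable_fun setT (fun y : R => y \in `[u, v]).
  apply: (measurable_fun_bool true); rewrite setTI.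
  rewrite (_ : _ @^-1` _ = `[u, v]%classic); first exact: measurable_itv.
  by apply/seteqP; split => y.
apply: measurable_fun_ifT => //; first by apply: measurable_or => //; exact: measurable_or.
apply: measurable_fun_ifT => //; first by apply: measurable_or => //; exact: measurable_or.
exact: measurable_fun_ifT.
Qed.

Lemma Rint_psihat (c : R -> R) (g : R -> R) : measurable_fun setT c -> measurable_fun setT g ->
  (forall y, ~ endpoints y -> psihat n y * c y = g y) ->
  Rintegral mu setT (fun y => psihat n y * c y) = Rintegral mu setT g.
Proof.
move=> mc mg H; rewrite /Rintegral; congr fine; apply: ae_eq_integral => //.
- by apply/measurable_EFinP; apply: measurable_funM => //; exact: measurable_psihat.
- exact/measurable_EFinP.
have fE : finite_set endpoints by exact: finite_seq.
exists endpoints; split.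
- by apply: countable_measurable => //; exact: finite_set_countable.
- by apply: countable_lebesgue_measure0; exact: finite_set_countable.
move=> y /= h; apply: contrapT => Ny; apply: h => _; congr EFin; exact: H.
Qed.

Lemma psi_nE : @psi_n R n = ift psihatC.
Proof.
apply/funext => x; rewrite /ift.
have [[m1 m2] _] := bc_expi x (psihatC_bc R n).
have mx : measurable_fun setT (fun y : R => y * x) by apply: measurable_funM.
apply: complex_ext; rewrite ?cReM ?cImM /= mul0r ?subr0 ?addr0 mulrC; congr (_ * _).
- apply: (Rint_psihat (measurableT_comp (@measurable_cos R) mx) m1).
  by move=> y /psihat_psihatC ->; rewrite cReM /= mul0r subr0.
- apply: (Rint_psihat (measurableT_comp (@measurable_sin R) mx) m2).
  by move=> y /psihat_psihatC ->; rewrite cImM /= mul0r addr0.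
Qed.

Lemma cj_psihatC y : cj (psihatC y) = psihatC y.
Proof.
have [h|[t tin h]] := piecesP n y; last by rewrite (psihatC_in n3 tin h) cj_real.
by rewrite /psihatC h cj0.
Qed.

Lemma psihatC_sqr y : psihatC y * psihatC y = \sum_(t <- pieces) (t.2 ^+ 2)%:C * piece_ind t (y - t.1.2).
Proof.
have [h|[t tin h]] := piecesP n y.
  by rewrite h /psihatC h mul0r.
by rewrite (pieces_sum n3 (fun t => (t.2 ^+ 2)%:C) tin h) (psihatC_in n3 tin h) -rmorphM -expr2.
Qed.

(** In this form sums of indicators of adjacent pieces telescope. *)
Lemma piece_ind_diff (lo hi tau v y : R) : lo <= hi ->
  piece_ind (lo, hi, tau, v) y = (y < hi)%R%:R - (y < lo)%R%:R.
Proof.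
rewrite /piece_ind /in_piece /= => lh; rewrite leNgt; have [h|h] := ltP y lo.
  by rewrite (lt_le_trans h lh) subrr.
by rewrite subr0.
Qed.

Lemma psihatC_tiles y : \sum_(t <- pieces) (t.2 ^+ 2)%:C * piece_ind t y = cI `[- a, - a + 2 * pi[%classic y.
Proof.
have [p0 ha1 ha2 he hP] := consts.
have -> : cI `[- a, - a + 2 * pi[%classic y = piece_ind (- a, - a + 2 * pi, 0, 0) y by rewrite piece_indE.
have r2 : r ^+ 2 = 2^-1 by exact: r_sqr.
rewrite /pieces !big_cons big_nil /= -/a -/e -/P -/r.
rewrite !piece_ind_diff; [|lra|lra|lra|lra|lra|lra|lra|lra].
rewrite (_ : e + a = - a + 2 * pi); last lra.
rewrite sqrrN r2 expr1n rmorph1.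
have h2 : (2^-1)%:C + (2^-1)%:C = 1 :> R[i] by rewrite -rmorphD /=; congr (_%:C); lra.
(* The two halves over each doubly covered cell add up to 1, and the rest telescopes. *)
have alg (h y1 y2 y3 y4 y5 y6 : R[i]) : h + h = 1 ->
    1 * (y1 - y2) + (h * (y3 - y4) + (h * (y2 - y5) + (1 * (y4 - y6) + (h * (y3 - y4) +
    (1 * (y5 - y3) + (h * (y2 - y5) + 0)))))) = y1 - y6.
  move=> hh; transitivity (y1 - y6 + (h + h - 1) * (y2 - y5 + y3 - y4)); first by ring.
  by rewrite hh subrr mul0r addr0.
exact: alg.
Qed.

(** Each piece is shifted back by its [tau], which integer frequencies do not see; together the
    pieces weigh one full period by 1. *)
Lemma ci_psihatC_sqr (k : int) :
  ci (fun y => psihatC y * psihatC y * expi (y * k%:~R)) = if k == 0 then (2 * pi)%:C else 0.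
Proof.
have [p0 ha1 ha2 he hP] := consts.
have b1 (t : piece R) : bc (fun y => (t.2 ^+ 2)%:C * piece_ind t y * expi (y * k%:~R)).
  apply: bcM; last exact: bm_expiM.
  apply: bcZ; rewrite (_ : piece_ind t = fun y => 1 * cI `[t.1.1.1, t.1.1.2[%classic y); last first.
    by apply/funext => y; rewrite mul1r piece_indE.
  exact: bm_itv_bc (bm_cst _).
have b2 (t : piece R) : bc (fun y => (t.2 ^+ 2)%:C * piece_ind t (y - t.1.2) * expi (y * k%:~R)).
  apply: bcM; last exact: bm_expiM.
  apply: bcZ; rewrite (_ : (fun y => _) = fun y => 1 * cI `[t.1.1.1 + t.1.2, t.1.1.2 + t.1.2[%classic y).
    exact: bm_itv_bc (bm_cst _).
  apply/funext => y; rewrite mul1r piece_ind_shiftE /cI indicE mem_setE in_itv /=.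
  by case: (_ && _); rewrite ?rmorph1 ?rmorph0.
transitivity (\sum_(t <- pieces) ci (fun y => (t.2 ^+ 2)%:C * piece_ind t (y - t.1.2) * expi (y * k%:~R))).
  rewrite -ci_sum; last by move=> t; exact/bc_Cint/b2.
  by apply: eq_ci => y; rewrite psihatC_sqr mulr_suml.
transitivity (\sum_(t <- pieces) ci (fun y => (t.2 ^+ 2)%:C * piece_ind t y * expi (y * k%:~R))).
  rewrite big_seq [RHS]big_seq; apply: eq_bigr => t tin.
  have := ci_affine (- t.1.2) ltr01 (bc_Cint (b1 t)); rewrite invr1 mul1r => <-.
  apply: eq_ci => y; rewrite mul1r; congr (_ * _).
  by rewrite -(expi_tau n3 k (y - t.1.2) tin) subrK.
rewrite -ci_sum; last by move=> t; exact/bc_Cint/b1.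
have pi2 : 0 < 2 * pi :> R by rewrite mulr_gt0.
rewrite -(ci_expi_period (- a) pi2 k); apply: eq_ci => y.
rewrite -mulr_suml psihatC_tiles mulrC; congr (expi (_ * _) * _).
by rewrite mulrAC divff ?mul1r // gt_eqF.
Qed.

(** The three pieces between P - a and P + a are merged into one block. *)
Lemma psihatC_supp y : psihatC y = 0 \/ (- (2 * a) <= y < - a) \/
  [\/ a / 2 <= y < e / 2, a <= y < e, P - a <= y < P + a | 2 * P + a <= y < 2 * P + e].
Proof.
have [p0 ha1 ha2 he hP] := consts.
have [h|[t tin]] := piecesP n y; first by left; rewrite /psihatC h.
rewrite /in_piece => yt; right; move: t tin yt; apply: pieces_case => /= /andP[h1 h2].
- by left; apply/andP; split; lra.
- by right; constructor 1; apply/andP; split; lra.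
- by right; constructor 2; apply/andP; split; lra.
- by right; constructor 3; apply/andP; split; lra.
- by right; constructor 3; apply/andP; split; lra.
- by right; constructor 3; apply/andP; split; lra.
- by right; constructor 4; apply/andP; split; lra.
Qed.

(** The gaps listed are those that receive the dilates [2^q y] of points of the support. *)
Lemma psihatC_gap y : [\/ y < - (2 * a), e <= y < P - a, P + a <= y < 2 * P + a | 2 * P + e <= y] ->
  psihatC y = 0.
Proof.
have [p0 ha1 ha2 he hP] := consts.
move=> gap; have [//|h] := psihatC_supp y; exfalso.
by case: gap => [?|/andP[? ?]|/andP[? ?]|?];
  case: h => [/andP[? ?]|[/andP[? ?]|/andP[? ?]|/andP[? ?]|/andP[? ?]]]; lra.
Qed.

(** For [y] in B the point [2 y] lies in [a, e), for [y] in B + P in the last piece, whose value is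
    negative: the products are [r * r] and [r * (- r)]. From any other point of the support, [2 y]
    falls into a gap. *)
Lemma psihatC_double y : psihatC y * psihatC (2 * y) =
  (2^-1)%:C * (cI `[a / 2, e / 2[%classic y - cI `[a / 2 + P, e / 2 + P[%classic y).
Proof.
have [p0 ha1 ha2 he hP] := consts.
have r2 : (r%:C * r%:C = (2^-1)%:C :> R[i])%R.
  by rewrite -rmorphM -expr2; congr (_%:C); exact: r_sqr.
have [y1|y1] := boolP (a / 2 <= y < e / 2).
  rewrite cI_in ?cI_out /= ?in_itv //=; last by case/andP: y1 => *; apply/negP; rewrite negb_and -ltNge; apply/orP; left; lra.
  rewrite (psihatC_in n3 piece2_mem) /=; last by rewrite /in_piece /= subr0.
  rewrite (psihatC_in n3 piece3_mem) /=; last by rewrite /in_piece /= subr0; case/andP: y1 => *; apply/andP; split; lra.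
  by rewrite r2 subr0 mulr1.
have [y2|y2] := boolP (a / 2 + P <= y < e / 2 + P).
  rewrite cI_out ?cI_in /= ?in_itv //=; last by apply/negP.
  rewrite (psihatC_in n3 piece5_mem) /=; last by rewrite /in_piece /= lerBrDr ltrBlDr.
  rewrite (psihatC_in n3 piece7_mem) /=; last by rewrite /in_piece /=; case/andP: y2 => *; apply/andP; split; lra.
  by rewrite rmorphN mulrN r2 sub0r mulrN mulr1.
rewrite !cI_out /= ?in_itv /= ?subrr ?mulr0; [|exact/negP|exact/negP].
have [->|ys] := psihatC_supp y; first by rewrite mul0r.
have {}y2 : y < a / 2 + P \/ e / 2 + P <= y.
  by move: y2; rewrite negb_and -ltNge -leNgt => /orP.
rewrite [X in _ * X]psihatC_gap ?mulr0 //; move: ys; rewrite (negbTE y1).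
case=> [/andP[? ?]|[//|/andP[? ?]|/andP[? ?]|/andP[? ?]]].
- by constructor 1; lra.
- by constructor 2; apply/andP; split; lra.
- case: y2 => ?; last by constructor 4; lra.
  by constructor 3; apply/andP; split; lra.
- by constructor 4; lra.
Qed.

(** The dilates of [a, e) by 2^(n-1) and 2^n adjoin the block [P - a, P + a) on either side, so no
    dilate meets it. The three cases are [i <= n - 1], [i = n] and [i > n]. *)
Lemma pow2_interval (i : nat) (x : R) : (0 < i)%N -> 2 ^+ i * a <= x < 2 ^+ i * e ->
  [\/ 2 * a <= x < P - a, P + a <= x < 2 * P - 2 * a | 2 * P + 2 * a <= x].
Proof.
have [p0 ha1 ha2 he hP] := consts.
have cd : P - a = 2 ^+ n.-1 * e := c_dyadic R n3.
have dd : P + a = 2 ^+ n.-1 * (2 * a) := d_dyadic R n3.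
have e0 : 0 < e by lra.
have a0 : 0 < a by lra.
have le2 (u v : nat) : (u <= v)%N -> (2 : R) ^+ u <= 2 ^+ v.
  by move=> uv; rewrite ler_weXn2l // ler1n.
move=> i0 /andP[h1 h2].
have ha : 2 * a <= 2 ^+ i * a.
  by rewrite ler_wpM2r ?(ltW a0) // -{1}[2]expr1 le2.
have [i1|i1] := leqP i n.-1.
  constructor 1; apply/andP; split; first exact: le_trans ha h1.
  by apply: lt_le_trans h2 _; rewrite cd ler_wpM2r ?(ltW e0) // le2.
have [i2|i2] := leqP i n.
  constructor 2; apply/andP; split.
    apply: le_trans h1; rewrite dd mulrA ler_wpM2r ?(ltW a0) //.
    by rewrite -exprSr le2.
  apply: lt_le_trans h2 _; have -> : 2 * P - 2 * a = 2 ^+ n.-1.+1 * e by rewrite exprS -mulrA -cd; ring.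
  by rewrite ler_wpM2r ?(ltW e0) // le2 //; lia.
constructor 3; apply: le_trans h1.
have -> : 2 * P + 2 * a = 2 ^+ n.-1.+2 * a by rewrite !exprS; lra.
by rewrite ler_wpM2r ?(ltW a0) // le2 //; lia.
Qed.

Lemma psihatC_far (q : nat) y : (1 < q)%N -> psihatC y * psihatC (2 ^+ q * y) = 0.
Proof.
have [p0 ha1 ha2 he hP] := consts.
move=> q1; have q4 : 4 <= (2 : R) ^+ q.
  by rewrite (_ : 4 = 2 ^+ 2) ?ler_weXn2l ?ler1n // expr2; ring.
have [->|ys] := psihatC_supp y; first by rewrite mul0r.
rewrite [X in _ * X]psihatC_gap ?mulr0 //.
have far (u : R) : 0 <= u -> u <= y -> 4 * u <= 2 ^+ q * y.
  by move=> u0 uy; rewrite ler_pM // ler0n.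
have big (i : nat) : (0 < i)%N -> 2 ^+ i * a <= 2 ^+ q * y < 2 ^+ i * e ->
    [\/ 2 ^+ q * y < - (2 * a), e <= 2 ^+ q * y < P - a,
        P + a <= 2 ^+ q * y < 2 * P + a | 2 * P + e <= 2 ^+ q * y].
  move=> i0 /(pow2_interval i0)[/andP[? ?]|/andP[? ?]|?].
  - by constructor 2; apply/andP; split => //; lra.
  - by constructor 3; apply/andP; split => //; lra.
  - by constructor 4; lra.
have pow_lt (i : nat) (u : R) : a <= u < e -> 2 ^+ i * a <= 2 ^+ i * u < 2 ^+ i * e.
  by move=> /andP[h1 h2]; rewrite ler_pM2l ?ltr_pM2l ?exprn_gt0 // h1.
case: ys => [/andP[h1 h2]|[/andP[h1 h2]|yE|/andP[h1 h2]|/andP[h1 h2]]].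
- have h : 2 ^+ q * y <= 4 * y by rewrite -subr_ge0 -mulrBl mulr_le0 //; lra.
  by constructor 1; lra.
- apply: (big q.-1); first by case: (q) q1 => [|[]].
  rewrite (_ : 2 ^+ q * y = 2 ^+ q.-1 * (2 * y)).
    by apply: pow_lt; apply/andP; split; lra.
  by rewrite mulrA -exprSr prednK // ltnW.
- by apply: (big q); [exact: ltnW|exact: pow_lt].
- by constructor 4; have : 4 * (P - a) <= 2 ^+ q * y; [apply: far|]; lra.
- by constructor 4; have : 4 * (2 * P + a) <= 2 ^+ q * y; [apply: far|]; lra.
Qed.

(** The two halves of [psihatC_double] have opposite signs and differ by a shift by [P], invisible
    to integer frequencies, so their integrals cancel. *)
Lemma ci_psihatC_double (k : int) : ci (fun y => psihatC y * psihatC (2 * y) * expi (y * k%:~R)) = 0.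
Proof.
have bB (u v : R) : bc (fun y => expi (y * k%:~R) * cI `[u, v[%classic y).
  exact: bm_itv_bc (bm_expiM _).
have E : ci (fun y => expi (y * k%:~R) * cI `[a / 2 + P, e / 2 + P[%classic y) =
    ci (fun y => expi (y * k%:~R) * cI `[a / 2, e / 2[%classic y).
  have := ci_affine P ltr01 (bc_Cint (bB (a / 2 + P) (e / 2 + P))).
  rewrite invr1 mul1r => <-; apply: eq_ci => y; rewrite mul1r (expi_P n3 k y); congr (_ * _).
  by rewrite /cI !indicE !mem_setE !in_itv /= lerD2r ltrD2r.
transitivity ((2^-1)%:C * (ci (fun y => expi (y * k%:~R) * cI `[a / 2, e / 2[%classic y) +
    (-1) * ci (fun y => expi (y * k%:~R) * cI `[a / 2 + P, e / 2 + P[%classic y))).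
  rewrite -ciZ; last exact/bc_Cint/bB.
  rewrite -ciD; [|exact/bc_Cint/bB|exact/bc_Cint/bcZ/bB].
  rewrite -ciZ; last exact: (bc_Cint (bcD (bB _ _) (bcZ _ (bB _ _)))).
  by apply: eq_ci => y; rewrite psihatC_double; ring.
by rewrite E mulN1r subrr mulr0.
Qed.

Lemma inner_psi_ft_psihatC (j k j' k' : int) :
  inner (psi_ft psihatC j k) (psi_ft psihatC j' k') = if (j == j') && (k == k') then (2 * pi)%:C else 0.
Proof.
have bw := psihatC_bc R n; have rw := cj_psihatC.
have main (i l l' : int) (q : nat) : inner (psi_ft psihatC (i + q%:Z) l) (psi_ft psihatC i l') =
    if (q == 0)%N && (l == l') then (2 * pi)%:C else 0.
  rewrite inner_psi_ft //; case: q => [|[|q]].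
  - have s0 := pow2_gt0 R i; rewrite addr0.
    have -> : (Num.sqrt ((2 : R) ^ i))^-1 * (Num.sqrt (2 ^ i))^-1 * 2 ^ i = 1.
      by rewrite -invfM -expr2 sqr_sqrtr ?(ltW s0) // mulVf // gt_eqF.
    rewrite rmorph1 mul1r; under eq_ci do rewrite expr0 mul1r expn0 mul1r.
    by rewrite ci_psihatC_sqr subr_eq0 eq_sym.
  - by under eq_ci do rewrite expr1; rewrite ci_psihatC_double mulr0.
  - under eq_ci do rewrite psihatC_far // mul0r.
    by rewrite ci0 mulr0.
(* [main] takes the higher level first; the other order follows by conjugate symmetry. *)
have [h|h] := leP j' j.
  have -> : j = j' + `|j - j'|%N%:Z by lia.
  rewrite main; congr (if _ && _ then _ else _); lia.
have := main j k' k `|j' - j|%N.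
have -> : j + `|j' - j|%N%:Z = j' by lia.
move=> E; rewrite innerC ?E; [|exact/bc_L2/psi_ft_bc|exact/bc_L2/psi_ft_bc].
have -> : (`|j' - j|%N == 0)%N = false by lia.
have -> : (j == j') = false by lia.
by rewrite cj0.
Qed.

Lemma psi_n_orthonormal (j k j' k' : int) :
  inner (dil_trans (@psi_n R n) j k) (dil_trans (@psi_n R n) j' k') =
  if (j == j') && (k == k') then 1 else 0.
Proof.
have bw := psihatC_bc R n.
rewrite psi_nE !dil_transE // inner_ift; [|exact: psi_ft_bc|exact: psi_ft_bc].
rewrite inner_psi_ft_psihatC; case: ifP => _; last by rewrite mulr0.
by rewrite -rmorphM mulVf // gt_eqF // mulr_gt0 // pi_gt0.
Qed.

End Wavelet.

(** * Dyadic localisation on the positive half line *)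

Lemma dyadic_ge1 (R : realType) (z : R) : 1 <= z -> exists m : nat, 2 ^+ m <= z < 2 ^+ m.+1.
Proof.
move=> z1; have z0 : 0 <= z by apply: le_trans z1.
have /andP[t1 t2] := truncn_itv z0; set N := Num.truncn z in t1 t2.
have N1 : (0 < N)%N by rewrite /N -(@truncn1 R) le_truncn.
have /andP[h1 h2] := trunc_log_bounds (isT : (1 < 2)%N) N1.
exists (trunc_log 2 N); apply/andP; split.
  by apply: le_trans t1; rewrite -natrX ler_nat.
by apply: lt_le_trans t2 _; rewrite -natrX ler_nat.
Qed.

Lemma dyadic (R : realType) (c x : R) : 0 < c -> 0 < x ->
  exists l : int, 2 ^ l * c <= x < 2 ^ (l + 1) * c.
Proof.
move=> c0 x0; suff [l /andP[h1 h2]] : exists l : int, (2 : R) ^ l <= x / c < 2 ^ (l + 1).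
  by exists l; rewrite -ler_pdivlMr // -ltr_pdivrMr // h1.
have z0 : 0 < x / c by rewrite divr_gt0.
move: (x / c) z0 => z z0 {x0}.
have [z1|z1] := leP 1 z.
  have [m /andP[h1 h2]] := dyadic_ge1 z1; exists m%:Z; apply/andP; split => //.
  by rewrite -[m%:Z + 1]/((m + 1)%N%:Z) addn1.
have z1' : 1 <= z^-1 by rewrite invf_ge1 // ltW.
have [m /andP[h1 h2]] := dyadic_ge1 z1'.
have p0 (k : nat) : 0 < (2 : R) ^+ k by rewrite exprn_gt0.
have u1 : z <= (2 ^+ m)^-1 by rewrite -[z]invrK lef_pV2 // posrE ?invr_gt0.
have u2 : (2 ^+ m.+1)^-1 < z by rewrite -[z]invrK ltf_pV2 // posrE ?invr_gt0.
(* Inversion exchanges the strict and the weak bound of a half-open interval, so exact powers of 2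
   are treated apart. *)
have [zm|zm] := eqVneq z (2 ^+ m)^-1.
  exists (- m%:Z); rewrite -exprnN zm lexx /= expfzDr // -exprnN expr1z.
  by rewrite ltr_pMr ?invr_gt0 // ltr1n.
exists (- m.+1%:Z); rewrite -exprnN (ltW u2) /= (_ : - m.+1%:Z + 1 = - m%:Z); last by lia.
by rewrite -exprnN lt_neqAle zm.
Qed.

(** * Completeness of the wavelet system *)

Section Completeness.
Variable R : realType.
Implicit Types (f g h p : R -> R[i]) (S : int -> int -> Prop).

Variable n : nat.
Hypothesis n3 : (3 <= n)%N.

Let a : R := a_n R n.
Let e : R := e_n R n.
Let P : R := 2 ^+ n.-1 * pi.
Local Notation psihatC := (@psihatC R n).
Local Notation chi := (@chi R n).

Let consts : [/\ 0 < pi :> R, pi / 2 < a, a <= 4 / 7 * pi, e = 2 * pi - 2 * a & 4 * pi <= P].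
Proof.
by split; [exact: pi_gt0|exact: a_gt|exact: a_le|exact: e_nE|exact: P_ge].
Qed.

(** The part of the support over singly covered cells, where functions of level 0 are
    unconstrained. *)
Definition setK : set R :=
  `[- (2 * a), - a[%classic `|` `[P - a, P + a / 2[%classic `|` `[P + e / 2, P + a[%classic.
(** The two pieces over the cell [a/2, e/2). *)
Definition setB : set R := `[a / 2, e / 2[%classic `|` `[P + a / 2, P + e / 2[%classic.
Definition scale_set (l : int) (A : set R) : set R := [set y | A ((2 ^ l)^-1 * y)].

Lemma setKP y : setK y <-> [\/ - (2 * a) <= y < - a, P - a <= y < P + a / 2 | P + e / 2 <= y < P + a].
Proof.
rewrite /setK /setU /= !in_itv /=; split; first by move=> [[]|]; [constructor 1|constructor 2|constructor 3].
by move=> []; [left; left|left; right|right].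
Qed.

Lemma setBP y : setB y <-> (a / 2 <= y < e / 2) \/ (P + a / 2 <= y < P + e / 2).
Proof. by rewrite /setB /setU /= !in_itv. Qed.

Lemma measurable_scale l (A : set R) : measurable A -> measurable (scale_set l A).
Proof.
move=> mA; have mh : measurable_fun setT (fun y : R => (2 ^ l)^-1 * y) by exact: measurable_funM.
by have := mh measurableT _ mA; rewrite setTI.
Qed.

Lemma measurable_setK : measurable setK.
Proof. by apply: measurableU; [apply: measurableU|]; exact: measurable_itv. Qed.

Lemma measurable_setB : measurable setB.
Proof. by apply: measurableU; exact: measurable_itv. Qed.

Lemma cI_scale l (A : set R) y : cI (scale_set l A) y = cI A ((2 ^ l)^-1 * y).
Proof.
by have [h|h] := pselect (A ((2 ^ l)^-1 * y)); [rewrite !cI_in|rewrite !cI_out].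
Qed.

Lemma scale_setB l y : setB ((2 ^ (l + 1))^-1 * y) <->
  (a <= (2 ^ l)^-1 * y < e) \/ (2 * P + a <= (2 ^ l)^-1 * y < 2 * P + e).
Proof.
have -> : (2 ^ (l + 1))^-1 * y = (2 ^ l)^-1 * y / 2.
  by rewrite expfzDr ?pnatr_eq0 // expr1z invfM; ring.
move: (_ * y) => x; rewrite setBP.
by split; (case=> /andP[h1 h2]; [left|right]; apply/andP; split; lra).
Qed.

(** In the fundamental interval [a, 2 a), the part [a, e) is twice one half of [setB], and the part
    [e, 2 a) becomes after dilation by 2^(n-1) the block [P - a, P + a), which [setK] and [setB]
    share. On the negative side the fundamental interval [- 2 a, - a) lies in [setK]. *)
Lemma cover y : y != 0 -> exists l : int, setK ((2 ^ l)^-1 * y) \/ setB ((2 ^ l)^-1 * y).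
Proof.
have [p0 ha1 ha2 he hP] := consts.
have a0 : 0 < a by lra.
have scl (l : int) (u : R) : (u <= (2 ^ l)^-1 * y) = (2 ^ l * u <= y).
  by rewrite ler_pdivlMl // pow2_gt0.
have scl' (l : int) (u : R) : ((2 ^ l)^-1 * y < u) = (y < 2 ^ l * u).
  by rewrite ltr_pdivrMl // pow2_gt0.
have two (l : int) : (2 : R) ^ (l + 1) = 2 ^ l * 2 by rewrite expfzDr ?pnatr_eq0 // expr1z.
rewrite neq_lt => /orP[y0|y0].
  have ny0 : 0 < - y by rewrite oppr_gt0.
  have [l /andP[h1 h2]] := dyadic a0 ny0.
  rewrite two in h2; move: h1; rewrite le_eqVlt => /orP[/eqP h1|h1].
    (* At [y = - 2^l a] the right end of [- 2 a, - a) is excluded, so the point is reached as the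
       left end one level lower. *)
    exists (l - 1); left; apply/setKP; constructor 1; rewrite scl scl'.
    have := two (l - 1); rewrite subrK => E; have := pow2_gt0 R (l - 1).
    rewrite E in h1; move: h1; set s := 2 ^ (l - 1) => h1 s0.
    have : 0 < s * a by rewrite mulr_gt0.
    by move=> *; apply/andP; split; lra.
  exists l; left; apply/setKP; constructor 1; rewrite scl scl'.
  by move: h1 h2; set s := 2 ^ l => *; apply/andP; split; lra.
have [l /andP[h1 h2]] := dyadic a0 y0; rewrite two in h2.
have [h|h] := ltP y (2 ^ l * e).
  exists (l + 1); right; apply/scale_setB; left.
  by rewrite scl scl' h1.
(* Going down [n - 1] levels multiplies the argument by 2^(n-1) and sends [e, 2 a) to [P - a, P +
   a). *)
exists (l - n.-1%:Z).
have E : (2 : R) ^ l = 2 ^ (l - n.-1%:Z) * 2 ^+ n.-1.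
  by rewrite -[2 ^+ n.-1]/(2 ^ n.-1%:Z) -expfzDr ?pnatr_eq0 // subrK.
have cd : P - a = 2 ^+ n.-1 * e := c_dyadic R n3.
have dd : P + a = 2 ^+ n.-1 * (2 * a) := d_dyadic R n3.
have : P - a <= (2 ^ (l - n.-1%:Z))^-1 * y < P + a.
  by apply/andP; split; [rewrite scl cd mulrA -E|rewrite scl' dd (mulrA (2 ^ (l - n.-1%:Z))) -E; lra].
move: (_ * y) => x /andP[x1 x2].
have [u1|u1] := ltP x (P + a / 2).
  by left; apply/setKP; constructor 2; rewrite x1.
have [u2|u2] := ltP x (P + e / 2).
  by right; apply/setBP; right; rewrite u1.
by left; apply/setKP; constructor 3; rewrite u2.
Qed.

Lemma chi_setK y : setK y -> chi y = 1.
Proof.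
have [p0 ha1 ha2 he hP] := consts.
move/setKP => [] /andP[h1 h2].
- by apply: (chi_in n3 (piece1_mem R n)); apply/andP; rewrite /= -/a -/e; split; lra.
- by apply: (chi_in n3 (piece4_mem R n)); apply/andP; rewrite /= -/a -/e -/P; split; lra.
- by apply: (chi_in n3 (piece6_mem R n)); apply/andP; rewrite /= -/a -/e -/P; split; lra.
Qed.

Lemma chi_setB y : setB y -> chi y = 1.
Proof.
have [p0 ha1 ha2 he hP] := consts.
move/setBP => [] /andP[h1 h2].
- by apply: (chi_in n3 (piece2_mem R n)); apply/andP; rewrite /= -/a -/e; split; lra.
- by apply: (chi_in n3 (piece5_mem R n)); apply/andP; rewrite /= -/a -/e -/P; split; lra.
Qed.

Definition set2B : set R := [set y | a <= y < e \/ 2 * P + a <= y < 2 * P + e].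

Lemma chi_set2B y : set2B y -> chi y = 1.
Proof.
have [p0 ha1 ha2 he hP] := consts.
move=> [] /andP[h1 h2].
- by apply: (chi_in n3 (piece3_mem R n)); apply/andP; rewrite /= -/a -/e; split; lra.
- by apply: (chi_in n3 (piece7_mem R n)); apply/andP; rewrite /= -/a -/e -/P; split; lra.
Qed.

Lemma cI_chi (A : set R) y : (forall z, A z -> chi z = 1) -> cI A y = cI A y * chi y.
Proof.
move=> H; have [Ay|Ay] := pselect (A y); first by rewrite (H y Ay) mulr1.
by rewrite cI_out // mul0r.
Qed.

Lemma pow2K (l : int) (y : R) : 2 ^ l * ((2 ^ l)^-1 * y) = y.
Proof. by rewrite mulVKf // gt_eqF // pow2_gt0. Qed.

(** For functions supported in [setK] both relations of [level0_intro] read 0 = 0. *)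
Lemma fullset_setK S l : (forall k, S l k) -> fullset psihatC S (scale_set l setK).
Proof.
have [p0 ha1 ha2 he hP] := consts.
move=> Sl; split; first exact: measurable_scale measurable_setK.
move=> g bg; have bw := psihatC_bc R n.
pose f y := g (2 ^ l * y) * cI setK y.
have bf : bc f by apply: cI_bc measurable_setK _; apply: bc_scale bg; exact: pow2_gt0.
have f0 y : ~ setK y -> f y = 0 by move=> h; rewrite /f cI_out // mulr0.
have lf : level0 psihatC f.
  apply: (level0_intro n3 bf); rewrite -/a -/e -/P.
  - by move=> y; rewrite /f {1}(cI_chi _ chi_setK) mulrA.
  - move=> y /andP[h1 h2]; rewrite !f0 // => /setKP[] /andP[? ?]; lra.
  - move=> y /andP[h1 h2]; rewrite !f0 ?oppr0 // => /setKP[] /andP[? ?]; lra.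
have := level0_fspan bw l lf.
have -> : (fun y => f ((2 ^ l)^-1 * y)) = (fun y => g y * cI (scale_set l setK) y).
  by apply/funext => y; rewrite /f pow2K cI_scale.
by apply: fspan_sub => j k ->.
Qed.

Lemma fullset_setB S l : (forall k, S l k) -> (forall k, S (l - 1) k) ->
  fullset psihatC S (scale_set l setB).
Proof.
have [p0 ha1 ha2 he hP] := consts.
move=> Sl Sl1; split; first exact: measurable_scale measurable_setB.
move=> g bg; have bw := psihatC_bc R n.
pose f y := g (2 ^ l * y) * cI setB y.
have bf : bc f by apply: cI_bc measurable_setB _; apply: bc_scale bg; exact: pow2_gt0.
have f0 y : ~ setB y -> f y = 0 by move=> h; rewrite /f cI_out // mulr0.
have bfs (c : R) : bc (fun y => f (y + c)).
  by have := bc_affine c ltr01 bf; under eq_fun do rewrite mul1r.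
(* Since [f] vanishes off [setB], at most one of [f (y + P)] and [f (y - P)] survives, namely the
   value at the partner of [y]; [fs] and [fa] are the symmetric and antisymmetric parts for the
   exchange of partners. *)
pose fs y := (2^-1)%:C * (f y + f (y + P) + f (y - P)) * cI setB y.
pose fa y := (2^-1)%:C * (f y - f (y + P) - f (y - P)) * cI setB y.
have bs : bc fs.
  by apply: cI_bc measurable_setB _; apply: bcZ; apply: bcD => //; exact: bcD.
have ba : bc fa.
  by apply: cI_bc measurable_setB _; apply: bcZ; apply: bcB => //; exact: bcB.
have fs0 y : ~ setB y -> fs y = 0 by move=> h; rewrite /fs cI_out // mulr0.
have fa0 y : ~ setB y -> fa y = 0 by move=> h; rewrite /fa cI_out // mulr0.
have inB y : a / 2 <= y < e / 2 -> [/\ setB y, setB (y + P), f (y - P) = 0 & f (y + P + P) = 0].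
  move=> yB; split; [by apply/setBP; left|apply/setBP; right| |].
  - by case/andP: yB => *; apply/andP; split; lra.
  - by apply: f0 => /setBP[] /andP[? ?]; case/andP: yB => *; lra.
  - by apply: f0 => /setBP[] /andP[? ?]; case/andP: yB => *; lra.
have ls : level0 psihatC fs.
  apply: (level0_intro n3 bs); rewrite -/a -/e -/P.
  - by move=> y; rewrite /fs {1}(cI_chi _ chi_setB) mulrA.
  - move=> y /inB[B1 B2 z1 z2]; rewrite /fs (cI_in B1) (cI_in B2) z1 z2 addrK; ring.
  - move=> y /andP[h1 h2]; rewrite !fs0 ?oppr0 // => /setBP[] /andP[? ?]; lra.
(* Stretched by 2, the antisymmetric part lives on [set2B], where its change of sign is the second
   relation of [level0_intro]; the stretching is undone by working at level [l - 1]. *)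
pose F y := fa (2^-1 * y).
have bF : bc F by apply: bc_scale ba; rewrite invr_gt0.
have la : level0 psihatC F.
  apply: (level0_intro n3 bF); rewrite -/a -/e -/P.
  - move=> y; rewrite /F; have [h|h] := pselect (setB (2^-1 * y)); last by rewrite fa0 // mul0r.
    by rewrite chi_set2B ?mulr1 //; case/setBP: h => /andP[? ?]; [left|right]; apply/andP; split; lra.
  - by move=> y /andP[h1 h2]; rewrite /F !fa0 // => /setBP[] /andP[? ?]; lra.
  - move=> y yB; have /inB[B1 B2 z1 z2] : a / 2 <= 2^-1 * y < e / 2.
      by case/andP: yB => *; apply/andP; split; lra.
    rewrite /F (_ : 2^-1 * (y + 2 * P) = 2^-1 * y + P); last by field.
    by rewrite /fa (cI_in B1) (cI_in B2) z1 z2 addrK; ring.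
have hs := level0_fspan bw l ls; have hF := level0_fspan bw (l - 1) la.
have Hs : fspan psihatC S (fun y => fs ((2 ^ l)^-1 * y)) by apply: fspan_sub hs => j k ->.
have Ha : fspan psihatC S (fun y => F ((2 ^ (l - 1))^-1 * y)) by apply: fspan_sub hF => j k ->.
have := fspanD bw Hs Ha.
rewrite (_ : (fun y => _) = (fun y => g y * cI (scale_set l setB) y)) //.
apply/funext => y; rewrite cI_scale /F.
have -> : 2^-1 * ((2 ^ (l - 1))^-1 * y) = (2 ^ l)^-1 * y.
  by rewrite mulrA -invfM -{1}[2]expr1z -expfzDr ?pnatr_eq0 // addrC subrK.
have h2 : (2^-1)%:C + (2^-1)%:C = 1 :> R[i] by rewrite -rmorphD /=; congr (_%:C); lra.
set x := (2 ^ l)^-1 * y.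
transitivity (((2^-1)%:C + (2^-1)%:C) * f x * cI setB x); first by rewrite /fs /fa; ring.
by rewrite h2 mul1r /f pow2K -mulrA cI_sqr.
Qed.

(** Enumerates the levels, since [fullset_bigcup] takes unions of sequences. *)
Definition int_of (k : nat) : int := if odd k then - (k./2%:Z) else k./2%:Z.

Lemma int_of_surj (l : int) : exists k, int_of k = l.
Proof.
case: l => m; first by exists m.*2; rewrite /int_of odd_double doubleK.
by exists (m.+1.*2.+1); rewrite /int_of /= odd_double /= uphalf_double NegzE.
Qed.

Lemma psi_n_complete f : L2 f -> in_closed_span (fun _ _ => True) (@psi_n R n) f.
Proof.
rewrite (psi_nE R n3); have bw := psihatC_bc R n; apply: fspan_complete => // g bg.
pose A k := scale_set (int_of k) setK `|` scale_set (int_of k) setB.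
have DA : fullset psihatC (fun _ _ => True) (\bigcup_k A k).
  apply: (fullset_bigcup bw) => k.
  by apply: (fullsetU bw); [exact: fullset_setK|exact: fullset_setB].
apply: (fullset_full bw DA) bg => y /cover[l hl].
by have [k kl] := int_of_surj l; exists k => //; rewrite /A kl.
Qed.

End Completeness.

(** * Translation invariance of V_0 and its failure for the next finer translations *)

Section Classes.
Variable R : realType.
Implicit Types (f g h p : R -> R[i]) (S : int -> int -> Prop).

Variable n : nat.
Hypothesis n3 : (3 <= n)%N.

Let a : R := a_n R n.
Let e : R := e_n R n.
Let P : R := 2 ^+ n.-1 * pi.
Local Notation psihatC := (@psihatC R n).
Local Notation psi := (@psi_n R n).

Let consts : [/\ 0 < pi :> R, pi / 2 < a, a <= 4 / 7 * pi, e = 2 * pi - 2 * a & 4 * pi <= P].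
Proof.
by split; [exact: pi_gt0|exact: a_gt|exact: a_le|exact: e_nE|exact: P_ge].
Qed.

Lemma psi_n_L2 (j k : int) : L2 (dil_trans psi j k).
Proof. by rewrite (psi_nE R n3); apply: Lpsi; exact: psihatC_bc. Qed.

Lemma psi_n_wavelet : is_wavelet psi.
Proof.
split; first exact: psi_n_L2.
by split; [exact: psi_n_orthonormal|exact: psi_n_complete].
Qed.

Lemma psihatC_2P y : a <= y < e -> psihatC (y + 2 * P) = - psihatC y.
Proof.
have [p0 ha1 ha2 he hP] := consts.
move=> /andP[h1 h2].
rewrite (_ : psihatC y = (1 / Num.sqrt 2)%:C); last first.
  by apply: (psihatC_in n3 (piece3_mem R n)); rewrite /in_piece /= subr0; apply/andP.
rewrite (_ : psihatC (y + 2 * P) = (- (1 / Num.sqrt 2))%:C); first by rewrite rmorphN.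
by apply: (psihatC_in n3 (piece7_mem R n)); rewrite /in_piece /= -/P addrK; apply/andP.
Qed.

Lemma psihatC_split y : psihatC y = psihatC y * cI (@setK R n) y + psihatC y * cI (@setB R n) y + psihatC y * cI (@set2B R n) y.
Proof.
have [p0 ha1 ha2 he hP] := consts.
have K u : (@setK R n) u <-> [\/ - (2 * a) <= u < - a, P - a <= u < P + a / 2 |
    P + e / 2 <= u < P + a] := setKP n u.
have B u : (@setB R n) u <-> (a / 2 <= u < e / 2) \/ (P + a / 2 <= u < P + e / 2) := setBP n u.
rewrite -!mulrDr; have [->|h] := psihatC_supp n3 y; first by rewrite mul0r.
suff -> : cI (@setK R n) y + cI (@setB R n) y + cI (@set2B R n) y = 1 by rewrite mulr1.
have T u : (@set2B R n) u <-> (a <= u < e) \/ (2 * P + a <= u < 2 * P + e) by [].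
rewrite -/a -/e -/P in h.
have inK : (@setK R n) y -> cI (@setK R n) y + cI (@setB R n) y + cI (@set2B R n) y = 1.
  move=> yK; have nB : ~ (@setB R n) y by move=> /B[] /andP[? ?]; case/K: yK => /andP[? ?]; lra.
  have nT : ~ (@set2B R n) y by move=> /T[] /andP[? ?]; case/K: yK => /andP[? ?]; lra.
  by rewrite (cI_in yK) (cI_out nB) (cI_out nT) !addr0.
have inB : (@setB R n) y -> cI (@setK R n) y + cI (@setB R n) y + cI (@set2B R n) y = 1.
  move=> yB; have nK : ~ (@setK R n) y by move=> /K[] /andP[? ?]; case/B: yB => /andP[? ?]; lra.
  have nT : ~ (@set2B R n) y by move=> /T[] /andP[? ?]; case/B: yB => /andP[? ?]; lra.
  by rewrite (cI_in yB) (cI_out nK) (cI_out nT) add0r addr0.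
have in2 : (@set2B R n) y -> cI (@setK R n) y + cI (@setB R n) y + cI (@set2B R n) y = 1.
  move=> y2; have nK : ~ (@setK R n) y by move=> /K[] /andP[? ?]; case/T: y2 => /andP[? ?]; lra.
  have nB : ~ (@setB R n) y by move=> /B[] /andP[? ?]; case/T: y2 => /andP[? ?]; lra.
  by rewrite (cI_in y2) (cI_out nK) (cI_out nB) !add0r.
case: h => [h|[h|h|/andP[h1 h2]|h]].
- by apply: inK; apply/K; constructor 1.
- by apply: inB; apply/B; left.
- by apply: in2; left.
- have [u1|u1] := ltP y (P + a / 2).
    by apply: inK; apply/K; constructor 2; rewrite -/a -/P h1.
  have [u2|u2] := ltP y (P + e / 2).
    by apply: inB; apply/B; right; rewrite -/a -/P u1.
  by apply: inK; apply/K; constructor 3; rewrite -/e -/P u2.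
- by apply: in2; right.
Qed.

Lemma measurable_set2B : measurable (@set2B R n).
Proof.
rewrite (_ : @set2B R n = `[a, e[%classic `|` `[2 * P + a, 2 * P + e[%classic).
  by apply: measurableU; exact: measurable_itv.
by apply/seteqP; split => y; rewrite /set2B /setU /= !in_itv.
Qed.

Lemma scale_set2B l : scale_set l (@set2B R n) = scale_set (l + 1) (@setB R n).
Proof. by apply/seteqP; split => y /(scale_setB n l y). Qed.

(** Over [setK] and [setB], level [j < 0] contributes to V_0 whatever the modulation, and [set2B] at
    level [j] is [setB] at level [j + 1]. Only [j = -1] is critical: level 0 is excluded there, and
    the modulation has to preserve antisymmetry. *)
Lemma V0_transl_gen (m j k : int) : j < 0 ->
  cspan psi (fun l _ => l < 0) (transl (m%:~R / 2 ^+ (n - 2)) (dil_trans psi j k)).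
Proof.
have [p0 ha1 ha2 he hP] := consts.
move=> j0; have bw := psihatC_bc R n; set t : R := m%:~R / _.
rewrite (psi_nE R n3) dil_transE // transl_ift.
pose g y := psi_ft psihatC j k y * expi (y * - t).
have bg : bc g by apply: bcM; [exact: psi_ft_bc|exact: bm_expiM].
suff [] : fspan psihatC (fun l _ => l < 0) g by [].
have -> : g = fun y => g y * cI (scale_set j (@setK R n)) y + g y * cI (scale_set j (@setB R n)) y +
    g y * cI (scale_set j (@set2B R n)) y.
  apply/funext => y; rewrite !cI_scale /g /psi_ft; set x := _^-1 * y.
  by rewrite {1}(psihatC_split x); ring.
have j1 : j - 1 < 0 by lia.
have [_ DK] := fullset_setK R n3 (S := fun l _ => l < 0) (l := j) (fun=> j0).
have [_ DB] := fullset_setB R n3 (S := fun l _ => l < 0) (l := j) (fun=> j0) (fun=> j1).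
apply: (fspanD bw); first by apply: (fspanD bw); [exact: DK|exact: DB].
have [jE|jE] := eqVneq j (- 1); last first.
  have j2 : j + 1 < 0 by lia.
  have j3 : j + 1 - 1 < 0 by lia.
  have [_ D2] := fullset_setB R n3 (S := fun l _ => l < 0) (l := j + 1) (fun=> j2) (fun=> j3).
  by rewrite scale_set2B; exact: D2.
pose F y := g (2 ^ j * y) * cI (@set2B R n) y.
have bF : bc F by apply: cI_bc measurable_set2B _; apply: bc_scale bg; exact: pow2_gt0.
have F0 y : ~ (@set2B R n) y -> F y = 0 by move=> h; rewrite /F cI_out // mulr0.
have lF : level0 psihatC F.
  apply: (level0_intro n3 bF); rewrite -/a -/e -/P.
  - by move=> y; rewrite /F {1}(cI_chi _ (chi_set2B n3)) mulrA.
  - by move=> y /andP[h1 h2]; rewrite !F0 // => -[] /andP; rewrite -/a -/e -/P => -[? ?]; lra.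
  move=> y ye; rewrite /F cI_in ?cI_in; [|by left|]; last first.
    by right; rewrite -/a -/e -/P; case/andP: ye => *; apply/andP; split; lra.
  rewrite !mulr1 /g /psi_ft !mulKf ?gt_eqF ?pow2_gt0 // (psihatC_2P ye).
  have -> : expi (- ((y + 2 * P) * k%:~R)) = expi (- (y * k%:~R)).
    rewrite -!mulrN -!intrN (_ : y + 2 * P = y + P + P); last by ring.
    by rewrite !(expi_P n3).
  have -> : expi (2 ^ j * (y + 2 * P) * - t) = expi (2 ^ j * y * - t); last by ring.
  (* With [j = -1] the phase changes by [- (P * t) = - 2 pi m], as [P = 2^(n-1) pi] and
     [t = m / 2^(n-2)]. *)
  rewrite (_ : 2 ^ j * (y + 2 * P) * - t = 2 ^ j * y * - t + 2 * pi * (- m)%:~R); first exact: expi_period.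
  rewrite jE /t /P intrN -[2 ^ (- 1)]/((2 : R)^-1).
  have -> : n.-1 = (n - 2).+1 by lia.
  by rewrite exprS; field; rewrite expf_neq0 ?pnatr_eq0.
have := level0_fspan bw j lF.
have -> : (fun y => F ((2 ^ j)^-1 * y)) = (fun y => g y * cI (scale_set j (@set2B R n)) y).
  by apply/funext => y; rewrite /F pow2K cI_scale.
by apply: fspan_sub => i l ->.
Qed.

Lemma psi_n_Lk : in_Lk (n - 2) psi.
Proof.
split; first exact: psi_n_wavelet.
move=> m f /(cspanP psi_n_L2) Vf; apply/(cspanP psi_n_L2).
by apply: (cspan_transl psi_n_L2) Vf => j k; exact: V0_transl_gen.
Qed.

Lemma expi_Npi : expi (- pi) = -1 :> R[i].
Proof. by rewrite /expi cosN sinN cospi sinpi oppr0; apply: complex_ext; rewrite /= ?oppr0. Qed.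

Lemma cnorm2_psihatC_setB y : (@setB R n) y -> cnorm2 (psihatC (2 * y)) = 2^-1.
Proof.
have [p0 ha1 ha2 he hP] := consts.
have -> : 2^-1 = (1 / Num.sqrt 2 : R) ^+ 2 by rewrite r_sqr.
move=> /setBP[] /andP; rewrite -/a -/e -/P => -[h1 h2].
  rewrite (psihatC_in n3 (piece3_mem R n)) ?cnorm2_real // /in_piece /= subr0 -/a -/e.
  by apply/andP; split; lra.
rewrite (psihatC_in n3 (piece7_mem R n)) ?cnorm2_real ?sqrrN // /in_piece /= -/a -/e -/P.
by apply/andP; split; lra.
Qed.

(** For [t = 2^-(n-1)] one has [P t = pi], so the translate of the generator of level -1 has a
    symmetric part [h] over [setB]. This [h] belongs to level 0, which is orthogonal to V_0; if the
    translate were in V_0, the integral of [|g|^2] over [setB] would vanish. *)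
Lemma psi_n_not_Lk : ~ in_Lk (n - 2).+1 psi.
Proof.
have [p0 ha1 ha2 he hP] := consts.
move=> [_ /(_ 1 (dil_trans psi (- 1) 0))].
have bw := psihatC_bc R n.
set t : R := 1%:~R / _ => H.
have j0 : (- 1 : int) < 0 by [].
have /(cspanP psi_n_L2) := H (proj2 (cspanP psi_n_L2 _ _) (cspan_gen psi_n_L2 (S := fun l _ => l < 0) (k := 0) j0)).
rewrite {2}(psi_nE R n3) dil_transE // transl_ift.
pose g y := psi_ft psihatC (- 1) 0 y * expi (y * - t); rewrite -/g => cg.
have bg : bc g by apply: bcM; [exact: psi_ft_bc|exact: bm_expiM].
pose h y := g y * cI (@setB R n) y.
have bh : bc h by apply: cI_bc bg; exact: measurable_setB.
pose c : R := (Num.sqrt (2 ^ (- 1)))^-1.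
have gE y : g y = c%:C * psihatC (2 * y) * expi (y * - t).
  by rewrite /g /psi_ft -/c -[2 ^ (- 1)]/((2 : R)^-1) invrK mulr0 oppr0 expi0 mulr1.
have Pt : P * t = pi.
  rewrite /P /t (_ : (n - 2).+1 = n.-1); last by lia.
  by rewrite mulrAC mulrCA divff ?expf_neq0 ?pnatr_eq0 // !mulr1 mul1r.
have gP y : a / 2 <= y < e / 2 -> g (y + P) = g y.
  move=> /andP[h1 h2]; rewrite !gE.
  rewrite (_ : 2 * (y + P) = 2 * y + 2 * P); last by ring.
  rewrite psihatC_2P; last by apply/andP; split; lra.
  rewrite (_ : (y + P) * - t = y * - t + - pi); last by rewrite -Pt; ring.
  by rewrite expiD expi_Npi; ring.
have h0 y : ~ (@setB R n) y -> h y = 0 by move=> u; rewrite /h cI_out // mulr0.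
have lh : level0 psihatC h.
  apply: (level0_intro n3 bh); rewrite -/a -/e -/P.
  - by move=> y; rewrite /h {1}(cI_chi _ (chi_setB n3)) mulrA.
  - move=> y yB; rewrite /h gP // !cI_in //; first by apply/setBP; left.
    by apply/setBP; right; rewrite -/a -/e -/P; case/andP: yB => *; apply/andP; split; lra.
  - by move=> y /andP[h1 h2]; rewrite !h0 ?oppr0 // => /setBP[] /andP; rewrite -/a -/e -/P => -[? ?]; lra.
have [_ ch] := level0_fspan bw 0 lh.
rewrite (_ : (fun y => h _) = h) in ch; last by apply/funext => y; rewrite expr0z invr1 mul1r.
rewrite -(psi_nE R n3) in ch.
have Lh := ift_L2 bh; have Lg := ift_L2 bg.
(* Two passages to the limit: [h] is in the closed span of level 0, hence orthogonal to each
   generator of negative level, and [g] is in the closed span of the latter. *)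
have E : inner (ift h) (ift g) = 0.
  apply: (cspan_orth psi_n_L2 Lh _ cg) => j k jn.
  rewrite innerC //; last exact: psi_n_L2.
  rewrite (cspan_orth psi_n_L2 (psi_n_L2 j k) _ ch) ?cj0 // => i l ->.
  by rewrite psi_n_orthonormal // (_ : (j == 0) = false) //; lia.
move: E; rewrite inner_ift // innerE.
(* On [setB] the value of [|g|^2] is [c^2 / 2], and [setB] has total length [e - a]. *)
rewrite (_ : ci _ = ((c ^+ 2 / 2) * (e - a))%:C); last first.
  have bB (u v : R) : Cint (cI `[u, v[%classic).
    have := bc_Cint (bm_itv_bc u v (bm_cst (1 : R[i]))).
    by under eq_fun do rewrite mul1r.
  transitivity ((c ^+ 2 / 2)%:C * (ci (cI `[a / 2, e / 2[%classic) + ci (cI `[P + a / 2, P + e / 2[%classic))).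
    rewrite -ciD // -ciZ; last exact: CintD.
    apply: eq_ci => y; rewrite /h mulrAC mulJ_cnorm2.
    have N : (@setB R n) y -> cnorm2 (g y) = c ^+ 2 / 2.
      by move=> yB; rewrite gE !cnorm2M cnorm2_real cnorm2_expi mulr1 cnorm2_psihatC_setB.
    have [b1|b1] := boolP (a / 2 <= y < e / 2).
      have yB : (@setB R n) y by left; rewrite /= in_itv.
      rewrite N // (cI_in yB) (cI_in (_ : `[a / 2, e / 2[%classic y)) ?cI_out ?addr0 //=.
      by rewrite in_itv /= => /andP[? ?]; case/andP: b1 => ? ?; lra.
    rewrite (cI_out (_ : ~ `[a / 2, e / 2[%classic y)) ?add0r; last by rewrite /= in_itv; exact/negP.
    have [b2|b2] := boolP (P + a / 2 <= y < P + e / 2).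
      have yB : (@setB R n) y by right; rewrite /= in_itv.
      by rewrite N // (cI_in yB) cI_in //= in_itv.
    rewrite !cI_out ?mulr0 //=; first by rewrite in_itv; exact/negP.
    by move=> /setBP[] u; [move: b1|move: b2]; rewrite u.
  rewrite !ci_cI; [|lra|lra]; by rewrite -rmorphD -rmorphM; congr (_%:C); field.
rewrite -rmorphM => /(congr1 (@complex.Re R)) /= /eqP.
have c0 : 0 < c by rewrite invr_gt0 sqrtr_gt0 pow2_gt0.
rewrite gt_eqF // mulr_gt0 ?invr_gt0 ?mulr_gt0 ?exprn_gt0 ?invr_gt0 //; lra.
Qed.

End Classes.

Theorem theorem6p2 (R : realType) (n : nat) :
  (3 <= n)%N -> is_wavelet (@psi_n R n) /\ in_Mk (n - 2) (@psi_n R n).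
Proof.
move=> n3; split; first exact: psi_n_wavelet.
by split; [exact: psi_n_Lk|exact: psi_n_not_Lk].
Qed.
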